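(* Let $k$ be a field, $n$ a natural number and $Q$ a quiver. The Schiver double $\mathcal{D}_Q(n)$ is independent of the orientation of $Q$, and as such is an invariant of the underlying graph of $Q$: if $Q$ and $Q'$ are quivers with the same underlying graph, then $\mathcal{D}_Q(n)\cong\mathcal{D}_{Q'}(n)$ as algebras.
   Context: A quiver $Q$ is a locally finite oriented graph, with vertex set $V$ and edge set $E$; an edge $e$ has source $s(e)$ and tail (target) $t(e)$. Let $P_Q$ be the path algebra of $Q$ modulo the ideal of paths of length $>1$, and $P_Q(n)=\mathrm{End}_{P_Q}(P_Q^{\oplus n})$, the algebra Morita equivalent to $P_Q$ all of whose simple modules have dimension $n$; as a vector space $P_Q(n)\cong M^{\oplus V}\oplus M^{\oplus E}$ with $M=M_n(k)$, where the copy of $M$ at an edge is a bimodule (by matrix multiplication) for the matrix algebras at the end vertices of the edge, and products of two edge components are zero. It is a super-algebra, with paths of length $0$ and $1$ of parity $0$ and $1$. Schur super-bialgebra: for a super-algebra $A$, $A^{\otimes r}$ is the super tensor power, with product obtained from $(a\otimes b)(a'\otimes b')=(-1)^{|b||a'|}aa'\otimes bb'$. $\Sigma_r$ acts on $A^{\otimes r}$ by automorphisms, $(i,i+1)$ swapping the $i$-th and $(i+1)$-st factors with sign $(-1)^{|a_i||a_{i+1}|}$. $T(A)=\bigoplus_{r\ge0}A^{\otimes r}$ is the direct sum of these super-algebras, with comultiplication $\Delta(a_1\otimes\dots\otimes a_r)=\sum_{i=0}^r(a_1\otimes\dots\otimes a_i)\otimes(a_{i+1}\otimes\dots\otimes a_r)$.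 $\mathcal{S}(A)=\bigoplus_{r\ge0}(A^{\otimes r})^{\Sigma_r}$ is a sub-super-bialgebra. If $A$ has a parity-preserving anti-automorphism $\sigma$, $\mathcal{S}(A)$ has the algebra and coalgebra anti-automorphism induced by $a_1\otimes\dots\otimes a_r\mapsto\sigma(a_r)\otimes\dots\otimes\sigma(a_1)$. Set $\mathcal{S}_Q(n)=\mathcal{S}(P_Q(n))$ and let $\mathcal{A}_Q(n)$ be its graded dual. Double: if $B$ is a graded super-bialgebra with parity-preserving endomorphism $\sigma$ which is an algebra and coalgebra anti-automorphism, and $B^*$ is the graded dual, then $D(B)=B\otimes B^*$ is a super-algebra ($|a\otimes\alpha|=|a|+|\alpha|$) with associative product $$(a\otimes\alpha)(b\otimes\beta)=\sum(-1)^{s(a,\alpha,b,\beta)}a_{(2)}b_{(1)}\otimes\beta_{(2)}\alpha_{(1)}\langle a_{(1)}^\sigma,\beta_{(1)}\rangle\langle\alpha_{(2)},b_{(2)}^\sigma\rangle,$$ $s(a,\alpha,b,\beta)=|a_{(1)}|(|a_{(2)}|+|b_{(1)}|)+|b_{(1)}||\alpha|+|\alpha_{(1)}||\beta|$ (Sweedler notation). Schiver double: the disjoint union $Q\coprod Q^{op}$ has an orientation-reversing automorphism exchanging $Q$ and $Q^{op}$, which, together with transposition of matrices, gives an anti-automorphism $\sigma$ of $P_{Q\coprod Q^{op}}(n)$ and hence of $\mathcal{S}_{Q\coprod Q^{op}}(n)=\mathcal{S}_Q(n)\otimes\mathcal{S}_{Q^{op}}(n)$. The Schiver double is the natural algebra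 summand $\mathcal{D}_Q(n)=\mathcal{S}_Q(n)\otimes\mathcal{A}_{Q^{op}}(n)$ of $D(\mathcal{S}_{Q\coprod Q^{op}}(n))$.
   Formalization: In characteristic 2 the invariants are also required to vanish on words with two equal adjacent odd letters (otherwise false: n=1, 0→1→2 vs 0→1←2); for infinite quivers the graded dual is taken for the finer grading by end vertices, whose components are finite-dimensional. *)

(* Defs.v *)
From HB Require Import structures.
From mathcomp Require Import all_boot all_order all_algebra.
From mathcomp Require Import boolp classical_sets functions.
From mathcomp Require Import finmap monalg.

Set Implicit Arguments.
Unset Strict Implicit.
Unset Printing Implicit Defensive.

Import GRing.Theory.
Local Open Scope ring_scope.
Local Open Scope quotient_scope.

Section Tensor.
Variable k : fieldType.

Section Def.
Variables U W : lmodType k.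

Definition bilinear_map (X : lmodType k) (f : U -> W -> X) : Prop :=
  (forall w, linear (f^~ w)) /\ (forall u, linear (f u)).

Definition formal_eval (X : lmodType k) (f : U -> W -> X) (s : seq (U * W)) : X :=
  \sum_(p <- s) f p.1 p.2.

(* A list [:: (u1, w1); ...] stands for the formal sum u1 (x) w1 + ...; two
   formal sums are identified when every bilinear map evaluates them to the
   same vector, i.e. the universal property is taken as the definition. *)
Definition formal_eq (s t : seq (U * W)) : bool :=
  `[< forall (X : lmodType k) (f : U -> W -> X),
        bilinear_map f -> formal_eval f s = formal_eval f t >].

Lemma formal_eq_refl : reflexive formal_eq.
Proof. by move=> s; apply/asboolP. Qed.

Lemma formal_eq_sym : symmetric formal_eq.
Proof. by move=> s t; apply/asbool_equiv_eq; split=> h X f hf; rewrite h. Qed.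

Lemma formal_eq_trans : transitive formal_eq.
Proof.
move=> t s r /asboolP st /asboolP tr; apply/asboolP=> X f hf.
by rewrite st // tr.
Qed.

Canonical formal_equiv :=
  EquivRel formal_eq formal_eq_refl formal_eq_sym formal_eq_trans.

Definition tens := {eq_quot formal_eq}.

HB.instance Definition _ := Choice.on tens.

Definition pure (u : U) (w : W) : tens := \pi_tens [:: (u, w)].

(* The linear map induced on the tensor product by a bilinear map.  With
   [t] the value of a comultiplication it is a Sweedler sum:
   [tlift (fun a1 a2 => E) (Delta a)] is the sum of [E] over (a). *)
Definition tlift (X : lmodType k) (f : U -> W -> X) (t : tens) : X :=
  formal_eval f (repr t).

Lemma tlift_pi (X : lmodType k) (f : U -> W -> X) s :
  bilinear_map f -> tlift f (\pi_tens s) = formal_eval f s.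
Proof.
move=> hf; rewrite /tlift.
have /eqmodP/asboolP -> // : repr (\pi_tens s) = s %[mod tens] by rewrite reprK.
Qed.

Lemma tens_eqP (t1 t2 : tens) :
  (forall (X : lmodType k) (f : U -> W -> X),
     bilinear_map f -> tlift f t1 = tlift f t2) -> t1 = t2.
Proof.
move=> h; rewrite -[t1]reprK -[t2]reprK; apply/eqmodP/asboolP=> X f hf.
exact: h.
Qed.

Lemma bilinear_mapZ (X : lmodType k) (f : U -> W -> X) c u w :
  bilinear_map f -> f (c *: u) w = c *: f u w.
Proof.
case=> hl _; have f0 : f 0 w = 0.
  by have := hl w (-1) 0 0; rewrite /= scaler0 addr0 scaleN1r addNr.
by have := hl w c u 0; rewrite /= f0 !addr0.
Qed.

Definition tens_add (t1 t2 : tens) : tens := \pi_tens (repr t1 ++ repr t2).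
Definition tens_scale (c : k) (t : tens) : tens :=
  \pi_tens [seq (c *: p.1, p.2) | p <- repr t].
Definition tens_zero : tens := \pi_tens [::].

Lemma tlift_add (X : lmodType k) (f : U -> W -> X) t1 t2 : bilinear_map f ->
  tlift f (tens_add t1 t2) = tlift f t1 + tlift f t2.
Proof. by move=> hf; rewrite tlift_pi // /formal_eval big_cat. Qed.

Lemma tlift_scale (X : lmodType k) (f : U -> W -> X) c t : bilinear_map f ->
  tlift f (tens_scale c t) = c *: tlift f t.
Proof.
move=> hf; rewrite tlift_pi // /formal_eval big_map scaler_sumr.
by apply: eq_bigr => p _; rewrite bilinear_mapZ.
Qed.

Lemma tlift_zero (X : lmodType k) (f : U -> W -> X) : bilinear_map f ->
  tlift f tens_zero = 0.
Proof. by move=> hf; rewrite tlift_pi // /formal_eval big_nil. Qed.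

Lemma tens_addA : associative tens_add.
Proof. by move=> a b c; apply: tens_eqP=> X f hf; rewrite !tlift_add // addrA. Qed.

Lemma tens_addC : commutative tens_add.
Proof. by move=> a b; apply: tens_eqP=> X f hf; rewrite !tlift_add // addrC. Qed.

Lemma tens_add0 : left_id tens_zero tens_add.
Proof.
by move=> a; apply: tens_eqP=> X f hf; rewrite tlift_add // tlift_zero // add0r.
Qed.

Lemma tens_addN : left_inverse tens_zero (tens_scale (-1)) tens_add.
Proof.
move=> a; apply: tens_eqP=> X f hf.
by rewrite tlift_add // tlift_scale // tlift_zero // scaleN1r addNr.
Qed.

HB.instance Definition _ :=
  GRing.isZmodule.Build tens tens_addA tens_addC tens_add0 tens_addN.

Lemma tens_scaleA a b (t : tens) :
  tens_scale a (tens_scale b t) = tens_scale (a * b) t.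
Proof. by apply: tens_eqP=> X f hf; rewrite !tlift_scale // scalerA. Qed.

Lemma tens_scale1 : left_id 1 tens_scale.
Proof. by move=> t; apply: tens_eqP=> X f hf; rewrite tlift_scale // scale1r. Qed.

Lemma tens_scaleDr : right_distributive tens_scale +%R.
Proof.
move=> c a b; apply: tens_eqP=> X f hf.
by rewrite !(tlift_scale, tlift_add) // scalerDr.
Qed.

Lemma tens_scaleDl (t : tens) : {morph tens_scale^~ t : a b / a + b}.
Proof.
move=> a b; apply: tens_eqP=> X f hf.
by rewrite !(tlift_scale, tlift_add) // scalerDl.
Qed.

HB.instance Definition _ := GRing.Zmodule_isLmodule.Build k tens
  tens_scaleA tens_scale1 tens_scaleDr tens_scaleDl.

Lemma tlift_linear (X : lmodType k) (f : U -> W -> X) :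
  bilinear_map f -> linear (tlift f).
Proof.
by move=> hf c s t; rewrite [LHS]tlift_add // [tlift f (_ *: _)]tlift_scale.
Qed.

Lemma tlift_pure (X : lmodType k) (f : U -> W -> X) u w :
  bilinear_map f -> tlift f (pure u w) = f u w.
Proof. by move=> hf; rewrite tlift_pi // /formal_eval big_seq1. Qed.

Lemma pure_bilinear : bilinear_map pure.
Proof.
split=> [w c u1 u2|u c w1 w2]; apply: tens_eqP=> X f hf;
  by rewrite (tlift_linear hf) !tlift_pure //; case: hf => hl hr;
     rewrite ?(hl w) ?(hr u).
Qed.

Lemma tens_sum_pure (t : tens) : t = \sum_(p <- repr t) pure p.1 p.2.
Proof.
apply: tens_eqP => X f hf.
have h0 : tlift f 0 = 0 by exact: tlift_zero.
have hD a b : tlift f (a + b) = tlift f a + tlift f b by exact: tlift_add.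
rewrite (big_morph _ hD h0) /tlift -/(tlift f _) [LHS]/formal_eval.
by apply: eq_bigr => p _; rewrite -[RHS]/(tlift f _) tlift_pure.
Qed.

End Def.
End Tensor.

Arguments pure {k U W} u w.
Arguments tlift {k U W X} f t.

(* The operations of a graded super-bialgebra with anti-automorphism; no law is
   required, as none enters the formula for the product of the double. *)
Record sbialg (k : fieldType) := SBialg {
  sb_car :> lmodType k;
  sb_deg : choiceType;
  sb_hom : sb_deg -> sb_car -> sb_car;
  sb_par : bool -> sb_car -> sb_car;
  sb_mul : sb_car -> sb_car -> sb_car;
  sb_comul : sb_car -> tens sb_car sb_car;
  sb_anti : sb_car -> sb_car
}.

Arguments sb_hom {k s} i x.
Arguments sb_par {k s} b x.
Arguments sb_mul {k s} x y.
Arguments sb_comul {k s} x.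
Arguments sb_anti {k s} x.

Section Double.
Variables (k : fieldType) (B : sbialg k).

(* The linear forms that factor through finitely many homogeneous components,
   i.e. the direct sum of the duals of the components. *)
Definition gdual_pred : {pred (B -> k^o)} := [pred f : B -> k^o |
  `[< linear f /\
      exists s : seq (sb_deg B), forall x : B,
        (forall i, i \in s -> sb_hom i x = 0) -> f x = 0 >]].

Lemma gdual_closed : subsemimod_closed gdual_pred.
Proof.
split; first split.
- apply/asboolP; split; last by exists [::].
  by move=> c x y; rewrite -[LHS]/(0 : k^o) -[RHS]/(c *: (0 : k^o) + 0) scaler0 addr0.
- move=> f g /asboolP[lf [s hs]] /asboolP[lg [t ht]]; apply/asboolP; split.
    move=> c x y; rewrite -[LHS]/(f _ + g _) lf lg -[RHS]/(c *: (_ + _) + (_ + _)).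
    by rewrite scalerDr addrACA.
  exists (s ++ t) => x hx; rewrite -[LHS]/(f x + g x) hs ?ht ?addr0 //.
    by move=> i it; apply: hx; rewrite mem_cat it orbT.
  by move=> i it; apply: hx; rewrite mem_cat it.
- move=> c f /asboolP[lf [s hs]]; apply/asboolP; split.
    move=> d x y; rewrite -[LHS]/(c *: f _) lf -[RHS]/(d *: (c *: _) + c *: _).
    by rewrite scalerDr !scalerA mulrC.
  by exists s => x hx; rewrite -[LHS]/(c *: f x) hs // scaler0.
Qed.

Record gdual := GDual { gdual_val : B -> k^o; _ : gdual_val \in gdual_pred }.

HB.instance Definition _ := [isSub of gdual for gdual_val].
HB.instance Definition _ := [Choice of gdual by <:].
HB.instance Definition _ :=
  GRing.SubChoice_isSubLmodule.Build k (B -> k^o) gdual_pred gdual gdual_closed.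

Definition ev (f : gdual) (x : B) : k := gdual_val f x.

(* The structure of the graded dual is adjoint to that of [B], without signs:
   <beta alpha, x> = <beta, x_(1)> <alpha, x_(2)> and
   <beta_(1), x> <beta_(2), y> = <beta, x y>; it is with this convention that the
   product of the double is associative.  Each operation is described as the
   unique element with the required pairings. *)
Definition gdual_mul (f g : gdual) : gdual :=
  xget 0 [set h | forall x, ev h x =
    tlift (fun x1 x2 => ev f x1 * ev g x2 : k^o) (sb_comul x)].

Definition gdual_comul (f : gdual) : tens gdual gdual :=
  xget 0 [set t | forall x y,
    tlift (fun f1 f2 => ev f1 x * ev f2 y : k^o) t = ev f (sb_mul x y)].

Definition gdual_par (b : bool) (f : gdual) : gdual :=
  xget 0 [set h | forall x, ev h x = ev f (sb_par b x)].

Definition double := tens B gdual.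

(* (a (x) alpha)(b (x) beta).  The Sweedler sums are the nested [tlift]s, and the
   booleans are the parities occurring in the sign: i = |alpha|, j = |beta|,
   p = |a_(1)|, q = |a_(2)|, r = |b_(1)|, t = |alpha_(1)|; summing over them
   extends the formula from homogeneous elements to all elements. *)
Definition double_mul_pure (a : B) (al : gdual) (b : B) (be : gdual) : double :=
  \sum_(i : bool) \sum_(j : bool)
  tlift (fun a1 a2 => tlift (fun b1 b2 =>
  tlift (fun al1 al2 => tlift (fun be1 be2 =>
    \sum_(p : bool) \sum_(q : bool) \sum_(r : bool) \sum_(t : bool)
      ((-1) ^+ (p * (q + r) + r * i + t * j)%N
        * ev be1 (sb_anti (sb_par p a1)) * ev al2 (sb_anti b2)) *:
      pure (sb_mul (sb_par q a2) (sb_par r b1))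
           (gdual_mul be2 (gdual_par t al1)))
  (gdual_comul (gdual_par j be))) (gdual_comul (gdual_par i al)))
  (sb_comul b)) (sb_comul a).

Definition double_mul (x y : double) : double :=
  tlift (fun a al => tlift (fun b be => double_mul_pure a al b be) y) x.

End Double.

(* A super-algebra given by a homogeneous basis [letter] that is closed, up to
   zero, under multiplication: [lmul a b = None] means ab = 0.  The basis is
   moreover homogeneous for a grading [ldeg]. *)
Record salg := SAlg {
  letter : choiceType;
  lpar : letter -> bool;
  lmul : letter -> letter -> option letter;
  deg : choiceType;
  ldeg : letter -> deg;
  lmulA : forall a b c, obind (lmul^~ c) (lmul a b) = obind (lmul a) (lmul b c);
  lmul_par : forall a b c, lmul a b = Some c -> lpar c = lpar a (+) lpar b
}.

Arguments lpar {s} a.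
Arguments lmul {s} a b.
Arguments ldeg {s} a.

Record salg_anti (A : salg) := SAlgAnti {
  lanti :> letter A -> letter A;
  lantiK : involutive lanti;
  lanti_par : forall a, lpar (lanti a) = lpar a;
  lantiM : forall a b, lmul (lanti b) (lanti a) = omap lanti (lmul a b)
}.

Section Lext.
Variables (k : fieldType) (K : choiceType) (X : lmodType k).

Definition lext (f : K -> X) (x : {malg k[K]}) : X :=
  \sum_(w <- msupp x) x@_w *: f w.

Lemma lextEw (f : K -> X) x (d : {fset K}) :
  {subset msupp x <= d} -> lext f x = \sum_(w <- d) x@_w *: f w.
Proof.
move=> sub; rewrite /lext; apply: big_fset_incl; first exact/fsubsetP.
by move=> w _ /mcoeff_outdom ->; rewrite scale0r.
Qed.

Lemma lext_linear (f : K -> X) : linear (lext f).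
Proof.
move=> c x y; pose d := (msupp x `|` msupp y `|` msupp (c *: x + y))%fset.
rewrite !(@lextEw f _ d); try by move=> w; rewrite !inE => ->; rewrite ?orbT.
rewrite scaler_sumr -big_split /=; apply: eq_bigr => w _.
by rewrite mcoeffD mcoeffZ scalerDl scalerA.
Qed.

Lemma lextU (f : K -> X) w : lext f << w >> = f w.
Proof.
rewrite (@lextEw f _ [fset w]%fset) ?big_seq_fset1 ?mcoeffUU ?scale1r //.
by move=> v; move/(fsubsetP msuppU_le).
Qed.

Lemma lext_eq (f g : K -> X) x : f =1 g -> lext f x = lext g x.
Proof. by move=> fg; apply: eq_bigr => w _; rewrite fg. Qed.

End Lext.

Section Words.
Variables (k : fieldType) (A : salg).

Notation word := (seq (letter A)).

(* The words of length r are the basis of the r-th tensor power of [A]. *)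
Notation T := {malg k[word]}.

Definition wpar (u : word) : bool := odd (count lpar u).

(* Product of two words up to sign; the boolean is the exponent of -1, from
   (a (x) u)(b (x) v) = (-1)^(|u||b|) ab (x) uv. *)
Fixpoint wmul (u v : word) : option (bool * word) :=
  match u, v with
  | [::], [::] => Some (false, [::])
  | a :: u', b :: v' =>
      if (lmul a b, wmul u' v') is (Some c, Some (e, w))
      then Some ((wpar u' && lpar b) (+) e, c :: w) else None
  | _, _ => None
  end.

(* Exchange of the letters in positions i and i+1, when both exist. *)
Fixpoint wswap (i : nat) (w : word) : word :=
  match i, w with
  | 0, a :: b :: v => b :: a :: v
  | i'.+1, a :: v => a :: wswap i' v
  | _, _ => w
  end.

Fixpoint wswap_sign (i : nat) (w : word) : bool :=
  match i, w with
  | 0, a :: b :: _ => lpar a && lpar b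
  | i'.+1, _ :: v => wswap_sign i' v
  | _, _ => false
  end.

Definition wmulT (u v : word) : T :=
  if wmul u v is Some (e, w) then << (-1) ^+ e *g w >> else 0.

Definition tmul (x y : T) : T := lext (fun u => lext (wmulT u) y) x.

Definition tcomul (x : T) : {malg k[(word * word)%type]} :=
  lext (fun w => \sum_(i < (size w).+1) << (take i w, drop i w) >>) x.

Definition tact (i : nat) (x : T) : T :=
  lext (fun w => << (-1) ^+ wswap_sign i w *g wswap i w >> : T) x.

Definition tproj (P : pred word) (x : T) : T :=
  lext (fun w => if P w then << w >> else 0 : T) x.

Definition wanti (s : salg_anti A) (w : word) : word := rev (map s w).

Definition tanti (s : salg_anti A) (x : T) : T :=
  lext (fun w => << wanti s w >> : T) x.

(* The invariants of the symmetric groups; the second condition concerns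
   characteristic 2 only.  If 2 <> 0, a word that an adjacent transposition sends
   to its opposite has coefficient 0 in every invariant.  In characteristic 2 the
   signs are invisible and this is imposed, so that odd basis elements contribute
   exterior powers in every characteristic, as in the reduction modulo 2 of the
   invariants over the integers.  Otherwise they would contribute divided powers
   in characteristic 2, whose dual is symmetric, and the Schiver double would
   depend on the orientation. *)
Definition schur_pred : {pred T} := [pred x : T |
  `[< (forall i, tact i x = x) /\
      (2 \in [pchar k] ->
       forall i w, wswap i w = w -> wswap_sign i w -> x@_w = 0) >]].

Lemma wswapK i : involutive (wswap i).
Proof. by elim: i => [|i IH] [|a w] //=; [case: w | rewrite IH]. Qed.

Lemma wswap_signK i w : wswap_sign i (wswap i w) = wswap_sign i w.
Proof. by elim: i w => [|i IH] [|a w] //=; case: w => //= b w; rewrite andbC. Qed.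

Lemma count_wswap P i (w : word) : count P (wswap i w) = count P w.
Proof.
by elim: i w => [|i IH] [|a w] //=; [case: w => //= b w; rewrite addnCA | rewrite IH].
Qed.

Lemma wswapP i (w : word) :
  (wswap i w = w /\ wswap_sign i w = false) \/
  exists u a b v, w = u ++ a :: b :: v /\ i = size u.
Proof.
elim: i w => [|i IH] [|a w] /=; first (by left); last 2 first.
- by left.
- case: (IH w) => [[-> ->]|[u [b [c [v [-> ->]]]]]]; first by left.
  by right; exists (a :: u), b, c, v.
- by case: w => [|b w]; [left | right; exists [::], a, b, w].
Qed.

Lemma wswap_cat u a b v : wswap (size u) (u ++ a :: b :: v) = u ++ b :: a :: v.
Proof. by elim: u => //= c u ->. Qed.

Lemma wswap_sign_cat u a b v :
  wswap_sign (size u) (u ++ a :: b :: v) = lpar a && lpar b.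
Proof. by elim: u => //= c u ->. Qed.

Lemma wantiK (s : salg_anti A) : involutive (wanti s).
Proof.
by move=> w; rewrite /wanti map_rev revK -map_comp map_id_in // => a _ /=; rewrite lantiK.
Qed.

Lemma wanti_wswap (s : salg_anti A) i w : exists j,
  wanti s (wswap i w) = wswap j (wanti s w) /\
  wswap_sign j (wanti s w) = wswap_sign i w.
Proof.
case: (wswapP i w) => [[-> ->]|[u [a [b [v [-> ->]]]]]].
  exists (size w); case: (wswapP (size w) (wanti s w)) => [[-> ->] //|].
  case=> u [a [b [v [e szw]]]]; have := congr1 size e.
  by rewrite size_rev size_map szw size_cat -[in LHS](addn0 (size u)) => /addnI.
exists (size v); rewrite wswap_cat wswap_sign_cat /wanti !map_cat /= !rev_cat.
rewrite !rev_cons -!cats1 -!catA /= -(size_map s v) -(size_rev (map s v)).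
by rewrite wswap_cat wswap_sign_cat !lanti_par andbC.
Qed.

Lemma wmul_wswap i u v : wmul (wswap i u) (wswap i v) =
  omap (fun p => (p.1 (+) wswap_sign i u (+) wswap_sign i v (+) wswap_sign i p.2,
                  wswap i p.2)) (wmul u v).
Proof.
elim: i u v => [|i IH] [|a u] [|c v] //=.
- by case: v.
- by case: u.
- case: u v => [|b u] [|d v] //=.
  + by case: (lmul a c).
  + by case: (lmul a d); case: (lmul a c).
  + by case: (lmul b c); case: (lmul a c).
  case E1: (lmul b d) => [e|]; last by case: (lmul a c).
  case E2: (lmul a c) => [f|]; case: (wmul u v) => [[h w]|] //=.
  congr (Some (_, _)); rewrite /wpar /= !oddD !oddb (lmul_par E1) (lmul_par E2).
  by case: (odd _) (lpar a) (lpar b) (lpar c) (lpar d) h => [] [] [] [] [] [].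
- rewrite IH; case: (lmul a c) => //= e; case: (wmul u v) => //= -[h w] /=.
  by rewrite /wpar count_wswap -!addbA.
Qed.

Lemma wmul_fixed i u v e w : wmul u v = Some (e, w) ->
  wswap i u = u -> wswap i v = v -> wswap_sign i w ->
  wswap_sign i u || wswap_sign i v.
Proof.
elim: i u v e w => [|i IH] [|a u] [|c v] e w //=; try by case=> _ <-.
- case: u v => [|b u] [|d v] //=; try by case: (lmul a c).
    by case: (lmul a c) => // f [_ <-].
  case E2: (lmul a c) => [f|] //; case E1: (lmul b d) => [g|] //=.
  case: (wmul u v) => [[h z]|] //= [_ <-] [? _] [? _] /=; subst.
  rewrite (lmul_par E1) (lmul_par E2).
  by case: (lpar _) (lpar _) => [] [].
- case: (lmul a c) => //= f; case E: (wmul u v) => [[h z]|] //= [_ <-] [eu] [ev] /=.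
  exact: IH E eu ev.
Qed.

Lemma mcoeff_lext (K : choiceType) (f : K -> K) (c : K -> k) (x : {malg k[K]}) w :
  involutive f ->
  (lext (fun u => << c u *g f u >> : {malg k[K]}) x)@_w = c (f w) * x@_(f w).
Proof.
move=> fK; rewrite (@lextEw _ _ _ _ _ (f w |` msupp x)%fset); last first.
  by move=> u; rewrite !inE => ->; rewrite orbT.
rewrite raddf_sum /= (bigD1_seq (f w)) /= ?fset_uniq ?fset1U1 //.
rewrite mcoeffZ mcoeffU fK eqxx mulrC big1 ?addr0 // => u uw.
by rewrite mcoeffZ mcoeffU -(inj_eq (inv_inj fK)) fK (negPf uw) mulr0.
Qed.

Lemma mcoeff_tact i (x : T) w :
  (tact i x)@_w = (-1) ^+ wswap_sign i w * x@_(wswap i w).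
Proof. by rewrite mcoeff_lext ?wswap_signK //; exact: wswapK. Qed.

Lemma mcoeff_tanti (s : salg_anti A) (x : T) w : (tanti s x)@_w = x@_(wanti s w).
Proof. by rewrite mcoeff_lext ?mul1r //; exact: wantiK. Qed.

Lemma mcoeff_tproj P (x : T) w : (tproj P x)@_w = if P w then x@_w else 0.
Proof.
transitivity ((lext (fun u => << (P u)%:R *g id u >> : T) x)@_w); last first.
  by rewrite mcoeff_lext //=; case: (P w); rewrite ?mul1r ?mul0r.
congr _@_w; apply: lext_eq => u /=.
by case: (P u) => //; rewrite monalgU0.
Qed.

Definition sym_invariant (x : T) : Prop :=
  forall i w, x@_(wswap i w) = (-1) ^+ wswap_sign i w * x@_w.

Definition alternating (x : T) : Prop := 2 \in [pchar k] ->
  forall i w, wswap i w = w -> wswap_sign i w -> x@_w = 0.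

Lemma sym_invariantP (x : T) : (forall i, tact i x = x) <-> sym_invariant x.
Proof.
split=> [h i w|h i].
  by rewrite -[in LHS](h i) mcoeff_tact wswap_signK wswapK.
by apply/malgP => w; rewrite mcoeff_tact h signrMK.
Qed.

Lemma schurP (x : T) : reflect (sym_invariant x /\ alternating x) (x \in schur_pred).
Proof.
by apply: (iffP (asboolP _)) => -[h1 h2]; split=> //; apply/sym_invariantP.
Qed.

Lemma schur_closed : subsemimod_closed schur_pred.
Proof.
split; first split.
- by apply/schurP; split=> [i w|_ i w _ _]; rewrite !mcoeff0 ?mulr0.
- move=> x y /schurP[ix ax] /schurP[iy ay]; apply/schurP; split=> [i w|k2 i w h1 h2].
    by rewrite !mcoeffD ix iy mulrDr.
  by rewrite mcoeffD (ax k2 i) ?(ay k2 i) ?addr0.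
- move=> c x /schurP[ix ax]; apply/schurP; split=> [i w|k2 i w h1 h2].
    by rewrite !mcoeffZ ix mulrCA.
  by rewrite mcoeffZ (ax k2 i) ?mulr0.
Qed.

Record schur := Schur { schur_val : T; _ : schur_val \in schur_pred }.

HB.instance Definition _ := [isSub of schur for schur_val].
HB.instance Definition _ := [Choice of schur by <:].
HB.instance Definition _ :=
  GRing.SubChoice_isSubLmodule.Build k T schur_pred schur schur_closed.

Lemma schur_valP (x : schur) : schur_val x \in schur_pred.
Proof. exact: valP. Qed.

Lemma tproj_schur (P : pred word) (x : T) : (forall i w, P (wswap i w) = P w) ->
  x \in schur_pred -> tproj P x \in schur_pred.
Proof.
move=> hP /schurP[ix ax]; apply/schurP; split=> [i w|k2 i w h1 h2].
  by rewrite !mcoeff_tproj hP ix; case: (P w); rewrite ?mulr0.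
by rewrite mcoeff_tproj (ax k2 i) // if_same.
Qed.

Lemma tanti_schur s (x : T) : x \in schur_pred -> tanti s x \in schur_pred.
Proof.
move=> /schurP[ix ax]; apply/schurP; split=> [i w|k2 i w h1 h2].
  have [j [e1 e2]] := wanti_wswap s i w.
  by rewrite !mcoeff_tanti e1 ix e2.
have [j [e1 e2]] := wanti_wswap s i w.
by rewrite mcoeff_tanti (ax k2 j) // ?e2 // -e1 h1.
Qed.

Lemma lext_comp (K : choiceType) (X Y : lmodType k) (g : X -> Y) (f : K -> X)
    (x : {malg k[K]}) : linear g -> g (lext f x) = lext (g \o f) x.
Proof.
move=> lg; have g0 : g 0 = 0.
  by have := lg (-1) 0 0; rewrite !scaleN1r !addNr.
rewrite /lext; elim: (enum_fset _) => [|w s IH]; first by rewrite !big_nil.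
by rewrite !big_cons lg IH.
Qed.

Lemma lextZU (K : choiceType) (X : lmodType k) (f : K -> X) c w :
  lext f << c *g w >> = c *: f w.
Proof.
rewrite (@lextEw _ _ _ _ _ [fset w]%fset) ?big_seq_fset1 ?mcoeffUU //.
by move=> v; move/(fsubsetP msuppU_le).
Qed.

Lemma lext_scale (K : choiceType) (X : lmodType k) (f : K -> X) c x :
  lext (fun w => c *: f w) x = c *: lext f x.
Proof.
rewrite /lext scaler_sumr; apply: eq_bigr => w _.
by rewrite !scalerA mulrC.
Qed.

Lemma tact_tmul i (x y : T) : tact i (tmul x y) = tmul (tact i x) (tact i y).
Proof.
rewrite {1}/tact lext_comp; last exact: lext_linear.
rewrite /tmul {1}/tact lext_comp; last exact: lext_linear.
apply: lext_eq => u /=; rewrite lextZU lext_comp; last exact: lext_linear.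
rewrite (@lext_comp _ _ _ (lext (wmulT (wswap i u)))); last exact: lext_linear.
rewrite -lext_scale; apply: lext_eq => v /=.
rewrite lextZU {2}/wmulT wmul_wswap {1}/wmulT.
case: (wmul u v) => [[e w]|] /=; last first.
  by rewrite !scaler0 /lext msupp0 big_seq_fset0.
rewrite lextZU; apply/malgP => z; rewrite !mcoeffZ !mcoeffU !mulrnAr.
congr (_ *+ _); rewrite !signr_addb.
by case: (wswap_sign i u) (wswap_sign i v) e => [] [] [] /=; rewrite !(expr0, expr1, mulrNN, mulrN, mulNr, mulr1, mul1r, opprK).
Qed.

Lemma sum_involution_char2 (K : choiceType) (s : seq K) (f : K -> K) (F : K -> k) :
  2 \in [pchar k] -> uniq s -> involutive f -> {in s, forall p, f p \in s} ->
  (forall p, F (f p) = F p) -> (forall p, f p = p -> F p = 0) ->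
  \sum_(p <- s) F p = 0.
Proof.
move=> k2 us fK; move: {2}(size s) (leqnn (size s)) => n.
elim: n s us => [|n IH] [|p s] us sz fs Ff F0; rewrite ?big_nil //.
move: us => /= /andP[ps us]; rewrite big_cons.
have sub (q : K) : q \in s -> f q != p -> f q \in s.
  by move=> qs /negPf qp; have := fs q; rewrite !inE qs orbT qp /=; apply.
have [fp|fp] := eqVneq (f p) p.
  rewrite F0 // add0r IH // => q qs; apply: sub => //.
  by apply: contraNneq ps => fqp; rewrite -fp -fqp fK.
have fps : f p \in s by have := fs p; rewrite !inE eqxx (negPf fp) /=; apply.
rewrite (perm_big _ (perm_to_rem fps)) /= big_cons Ff addrA.
rewrite -mulr2n -mulr_natr (pcharf0 k2) mulr0 add0r; apply: IH => //.
- exact: rem_uniq.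
- by rewrite size_rem //; rewrite /= ltnS in sz; exact: leq_trans (leq_pred _) sz.
move=> q; rewrite !mem_rem_uniq // !inE => /andP[qfp qs].
have fqp : f q != p by apply: contraNneq qfp => <-; rewrite fK.
by rewrite (inj_eq (inv_inj fK)) sub // andbT; apply: contraNneq ps => <-.
Qed.

Lemma tmul_schur (x y : T) :
  x \in schur_pred -> y \in schur_pred -> tmul x y \in schur_pred.
Proof.
move=> /schurP[ix ax] /schurP[iy ay]; apply/schurP; split.
  by apply/sym_invariantP => i; rewrite tact_tmul !(sym_invariantP _).2.
move=> k2 i w h1 h2.
have signE b : (-1) ^+ b = 1 :> k.
  have : 1 + 1 = 0 :> k by exact: pcharf0 k2.
  by move/eqP; rewrite addr_eq0 => /eqP e; rewrite -e expr1n.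
have msw (z : T) : sym_invariant z -> forall v, (wswap i v \in msupp z) = (v \in msupp z).
  by move=> iz v; rewrite -!mcoeff_neq0 iz signE mul1r.
pose F (p : word * word) := x@_p.1 * (y@_p.2 * (wmulT p.1 p.2)@_w).
have -> : (tmul x y)@_w =
    \sum_(p <- [seq (u, v) | u <- msupp x, v <- msupp y]) F p.
  rewrite big_allpairs_dep /tmul /lext raddf_sum /=; apply: eq_bigr => u _.
  rewrite mcoeffZ raddf_sum mulr_sumr /=; apply: eq_bigr => v _.
  by rewrite mcoeffZ.
apply: (@sum_involution_char2 _ _ (fun p => (wswap i p.1, wswap i p.2))) => //.
- by apply: allpairs_uniq; rewrite ?fset_uniq // => -[? ?] [? ?].
- by move=> [u v]; rewrite /= !wswapK.
- move=> _ /allpairsP[[u v] [/= hu hv ->]].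
  by apply/allpairsP; exists (wswap i u, wswap i v); rewrite /= !msw.
- move=> [u v]; rewrite /F /= ix iy !signE !mul1r /wmulT wmul_wswap.
  case: (wmul u v) => [[e z]|] //=; rewrite !mcoeffU !signE.
  by rewrite -(inj_eq (inv_inj (wswapK i))) wswapK h1.
- move=> [u v] [eu ev]; rewrite /F /wmulT /=.
  case E: (wmul u v) => [[e z]|]; last by rewrite mcoeff0 !mulr0.
  rewrite mcoeffU; case: eqVneq => [ez|]; last by rewrite !mulr0.
  rewrite ez in E; case/orP: (wmul_fixed E eu ev h2) => s.
    by rewrite (ax k2 i) // mul0r.
  by rewrite (ay k2 i) // mul0r mulr0.
Qed.

End Words.

Section SchurBialgebra.
Variables (k : fieldType) (A : salg) (s : salg_anti A).

Notation word := (seq (letter A)).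
Notation S := (schur k A).

Lemma perm_wswap i (w : word) : perm_eq (wswap i w) w.
Proof. by apply/permP => P; rewrite count_wswap. Qed.

Definition has_deg (d : seq (deg A)) (w : word) : bool :=
  perm_eq (map ldeg w) d.

Lemma has_deg_wswap d i w : has_deg d (wswap i w) = has_deg d w.
Proof. by rewrite /has_deg; apply: permPl; apply: perm_map; exact: perm_wswap. Qed.

Lemma wpar_wswap b i (w : word) : (wpar (wswap i w) == b) = (wpar w == b).
Proof. by rewrite /wpar count_wswap. Qed.

Definition schur_hom (d : seq (deg A)) (x : S) : S :=
  Schur (tproj_schur (has_deg_wswap d) (schur_valP x)).

Definition schur_par (b : bool) (x : S) : S :=
  Schur (tproj_schur (wpar_wswap b) (schur_valP x)).

Definition schur_mul (x y : S) : S :=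
  Schur (tmul_schur (schur_valP x) (schur_valP y)).

Definition schur_antimap (x : S) : S := Schur (tanti_schur s (schur_valP x)).

(* [tlift schur_pair] is the inclusion of S (x) S in the tensor square of the
   tensor algebra, whose basis consists of the pairs of words. *)
Definition schur_pair (x y : S) : {malg k[(word * word)%type]} :=
  lext (fun u => lext (fun v => << (u, v) >>) (schur_val y)) (schur_val x).

(* S is a subcoalgebra: this is the deconcatenation, read in S (x) S. *)
Definition schur_comul (x : S) : tens S S :=
  xget 0 [set t | tlift schur_pair t = tcomul (schur_val x)].

(* The homogeneous components are indexed by the multisets of degrees of the
   letters, each represented by any of its enumerations. *)
Definition schur_sbialg : sbialg k :=
  @SBialg k S (seq (deg A)) schur_hom schur_par schur_mul schur_comul
    schur_antimap.

End SchurBialgebra.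

Record quiver (V E : choiceType) := Quiver {
  src : E -> V;
  tgt : E -> V;
  locally_finite : forall v, exists s : seq E,
    forall e, src e = v \/ tgt e = v -> e \in s
}.

Section Quivers.
Variables V E : choiceType.

Definition endpoints (Q : quiver V E) (e : E) : {fset V} :=
  [fset src Q e; tgt Q e]%fset.

Definition same_underlying_graph (Q Q' : quiver V E) : Prop :=
  endpoints Q =1 endpoints Q'.

Lemma op_locally_finite (Q : quiver V E) v : exists s : seq E,
  forall e, tgt Q e = v \/ src Q e = v -> e \in s.
Proof. by have [s hs] := locally_finite Q v; exists s => e []; auto. Qed.

Definition quiver_op (Q : quiver V E) : quiver V E :=
  Quiver (op_locally_finite Q).

Definition sum_fun (f g : E -> V) (e : E + E) : V + V :=
  match e with inl e => inl (f e) | inr e => inr (g e) end.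

Lemma sum_locally_finite (Q R : quiver V E) v : exists s : seq (E + E),
  forall e, sum_fun (src Q) (src R) e = v \/ sum_fun (tgt Q) (tgt R) e = v ->
    e \in s.
Proof.
case: v => v.
- have [s hs] := locally_finite Q v; exists (map inl s).
  by case=> e /= [] // [h]; apply: map_f; apply: hs; auto.
- have [s hs] := locally_finite R v; exists (map inr s).
  by case=> e /= [] // [h]; apply: map_f; apply: hs; auto.
Qed.

Definition quiver_sum (Q R : quiver V E) :
    quiver (V + V)%type (E + E)%type :=
  Quiver (sum_locally_finite Q R).

End Quivers.

Section PathAlgebra.
Variables (V E : choiceType) (Q : quiver V E) (n : nat).

(* P_Q(n): the basis consists of the matrix units E_ij of the copies of M_n at
   the vertices and at the edges.  The matrices at an edge are multiplied on the
   left by those at its source and on the right by those at its target. *)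
Definition pq_letter : choiceType := ((V + E) * ('I_n * 'I_n))%type.

Definition path_mul (x y : V + E) : option (V + E) :=
  match x, y with
  | inl v, inl w => if v == w then Some (inl v) else None
  | inl v, inr e => if v == src Q e then Some (inr e) else None
  | inr e, inl v => if tgt Q e == v then Some (inr e) else None
  | inr _, inr _ => None
  end.

Definition pq_par (a : pq_letter) : bool := if a.1 is inr _ then true else false.

Definition pq_mul (a b : pq_letter) : option pq_letter :=
  if a.2.2 == b.2.1 then omap (fun p => (p, (a.2.1, b.2.2))) (path_mul a.1 b.1)
  else None.

(* The Peirce grading, by the end vertices of the path.  Since the quiver is
   locally finite, the components of the induced multigrading of the Schur
   bialgebra are finite-dimensional, and for finitely many vertices the graded
   dual is the same as for the coarser grading by the length of words. *)
Definition pq_deg (a : pq_letter) : V * V :=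
  match a.1 with inl v => (v, v) | inr e => (src Q e, tgt Q e) end.

Lemma path_mulA x y z :
  obind (path_mul^~ z) (path_mul x y) = obind (path_mul x) (path_mul y z).
Proof.
by case: x => [v|e]; case: y => [w|f]; case: z => [u|g] //=;
   do 4?[case: eqP => [?|?] //=]; congruence.
Qed.

Lemma pq_mulA a b c :
  obind (pq_mul^~ c) (pq_mul a b) = obind (pq_mul a) (pq_mul b c).
Proof.
case: a b c => [x [i j]] [y [j' l]] [z [l' m]]; rewrite /pq_mul /=.
have := path_mulA x y z.
have [<-|nj] := eqVneq j j'; have [<-|nl] := eqVneq l l' => /=;
  case: (path_mul x y) => [p|]; case: (path_mul y z) => [q|] //=;
  rewrite ?eqxx ?(negPf nj) ?(negPf nl) //=; do ?[by move=> ->]; by move=> <-.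
Qed.

Lemma pq_mul_par a b c : pq_mul a b = Some c -> pq_par c = pq_par a (+) pq_par b.
Proof.
case: a b => [x [i j]] [y [j' l]]; rewrite /pq_mul /pq_par /=.
by case: eqP => // _; case: x y => [v|e] [w|f] //=; case: eqP => //= _ [<-].
Qed.

Definition path_salg : salg := @SAlg pq_letter pq_par pq_mul (V * V)%type pq_deg
  pq_mulA pq_mul_par.

End PathAlgebra.

Section Schiver.
Variables (k : fieldType) (n : nat) (V E : choiceType) (Q : quiver V E).

Definition double_quiver := quiver_sum Q (quiver_op Q).
Definition double_salg : salg := path_salg double_quiver n.

Definition sum_swap (T : Type) (x : T + T) : T + T :=
  match x with inl x => inr x | inr x => inl x end.

(* The exchange of Q and its opposite, composed with the transposition. *)
Definition double_anti_fun (a : letter double_salg) : letter double_salg :=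
  (match a.1 with
   | inl v => inl (sum_swap v)
   | inr e => inr (sum_swap e)
   end, (a.2.2, a.2.1)).

Lemma double_antiK : involutive double_anti_fun.
Proof. by case=> [[[v|v]|[e|e]] [i j]]. Qed.

Lemma double_anti_par a : lpar (double_anti_fun a) = lpar a.
Proof. by case: a => [[[v|v]|[e|e]] [i j]]. Qed.

Lemma double_antiM a b : lmul (double_anti_fun b) (double_anti_fun a) =
  omap double_anti_fun (lmul a b).
Proof.
case: a b => [x [i j]] [y [j' l]]; rewrite /lmul /= /pq_mul /= eq_sym.
case: eqP => //= _.
case: x => [[v|v]|[e|e]]; case: y => [[w|w]|[f|f]] //=;
  rewrite /eq_op /= eq_sym; by case: eqP => //= ->.
Qed.

Definition double_anti : salg_anti double_salg :=
  SAlgAnti double_antiK double_anti_par double_antiM.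

Definition double_bialg : sbialg k := schur_sbialg k double_anti.

Definition in_Q (a : letter double_salg) : bool :=
  match a.1 with inl (inl _) | inr (inl _) => true | _ => false end.

(* S_Q(n), as a graded summand of the Schur bialgebra of the double quiver. *)
Definition in_SQ (x : double_bialg) : Prop :=
  forall w, ~~ all in_Q w -> (schur_val x)@_w = 0.

(* The dual of the corresponding summand for the opposite of Q. *)
Definition in_AQop (f : gdual double_bialg) : Prop :=
  forall x : double_bialg,
    (forall w, all (predC in_Q) w -> (schur_val x)@_w = 0) -> ev f x = 0.

Definition schiver_pred : {pred double double_bialg} :=
  [pred t : double double_bialg |
   `[< exists s : seq (double_bialg * gdual double_bialg),
        (forall p, p \in s -> in_SQ p.1 /\ in_AQop p.2) /\
        t = \sum_(p <- s) pure p.1 p.2 >]].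

Lemma schiver_closed : subsemimod_closed schiver_pred.
Proof.
split; first split.
- by apply/asboolP; exists [::]; rewrite big_nil.
- move=> x y /asboolP[s [hs ->]] /asboolP[t [ht ->]]; apply/asboolP.
  exists (s ++ t); rewrite big_cat; split=> // p.
  by rewrite mem_cat => /orP[/hs|/ht].
- move=> c x /asboolP[s [hs ->]]; apply/asboolP.
  exists [seq (c *: p.1, p.2) | p <- s]; split.
    move=> _ /mapP[p /hs [h1 h2] ->] /=; split=> // w hw.
    by rewrite -[schur_val _]/(c *: schur_val p.1) mcoeffZ h1 ?mulr0.
  rewrite big_map scaler_sumr; apply: eq_bigr => p _ /=.
  by rewrite bilinear_mapZ //; exact: pure_bilinear.
Qed.

Record schiver := Schiver {
  schiver_val : double double_bialg;
  _ : schiver_val \in schiver_pred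
}.

HB.instance Definition _ := [isSub of schiver for schiver_val].
HB.instance Definition _ := [Choice of schiver by <:].
HB.instance Definition _ := GRing.SubChoice_isSubLmodule.Build k
  (double double_bialg) schiver_pred schiver schiver_closed.

(* The summand is a subalgebra: this is the restricted product. *)
Definition schiver_mul (x y : schiver) : schiver :=
  xget 0 [set z | schiver_val z = double_mul (schiver_val x) (schiver_val y)].

End Schiver.

(* Main.v *)
(* The Schiver double D_Q(n) is a form of the Schur super-algebra of the trivial
   extension of P_Q(n), which is the zigzag algebra of the underlying graph: an edge
   e and the linear form e* dual to its opposite multiply to the forms dual to the
   two end vertices, without signs, so that reversing e just exchanges e and e*.

   Let W range over the words in the letters of the trivial extension.  An element
   of D_Q(n) has a coefficient at each W, supersymmetric in W, and a basis is given
   by the elements b(P) with coefficient function W |-> (sign of the rearrangement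
   of P into W).  If o_P denotes this function and m(P)! the product of the
   factorials of the multiplicities of the even dual letters of P, then the
   structure constants of D_Q(n) are images of integers c(P, P'; W) with
     m(W)! c(P, P'; W) = m(P)! m(P')! (o_P * o_P')(W),
   where * is the letterwise super product of the trivial extension.  The identity
   determines c, and everything else in it depends only on the zigzag algebra.  It
   expresses that xi_v |-> m(v)! o_v turns the product of the double into *. *)

From mathcomp Require Import all_boot all_order all_algebra.
From mathcomp Require Import boolp classical_sets.
From mathcomp Require Import finmap monalg ring zify.
Require Import Defs.

Set Implicit Arguments.
Unset Strict Implicit.
Unset Printing Implicit Defensive.

Import GRing.Theory Num.Theory.
Local Open Scope ring_scope.

(** * Supersymmetric functions on words *)

(** The graded dual turns the divided powers of even letters in a Schur algebra into symmetric
    powers. A dual letter at a vertex therefore contributes symmetric powers to D_Q(n), but divided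
    powers to the Schur algebra of the trivial extension, and the factorials measure the difference.
    Odd letters contribute exterior powers, whose duals are again exterior powers, hence no
    factorials. As reversing an edge only moves odd letters between the algebra and its dual, the
    factorials are the same for all orientations.

    In positive characteristic the factorials may vanish, and the comparison with the trivial
    extension then no longer determines the product. This is why the structure constants are
    computed in [int], where a factorial can be cancelled, and mapped to the field only
    afterwards. *)

Section Words.
Variables (A : salg) (R : comNzRingType).
Notation L := (letter A).
Notation word := (seq L).
Implicit Types (a b l m : L) (u v w t : word) (F G : word -> R).

Lemma wpar_cons a w : wpar (a :: w) = lpar a (+) wpar w.
Proof. by rewrite /wpar /= oddD oddb. Qed.

Lemma wpar_cat u v : wpar (u ++ v) = wpar u (+) wpar v.
Proof. by rewrite /wpar count_cat oddD. Qed.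

Lemma wpar_perm u v : perm_eq u v -> wpar u = wpar v.
Proof. by move=> /permP h; rewrite /wpar h. Qed.

Definition supersym F :=
  forall i w, F (wswap i w) = (-1) ^+ wswap_sign i w * F w.

Lemma supersym_cons F a : supersym F -> supersym (fun w => F (a :: w)).
Proof. by move=> h i w; exact: (h i.+1 (a :: w)). Qed.

Lemma supersym_cat F u : supersym F -> supersym (fun w => F (u ++ w)).
Proof. by elim: u F => //= a u IH F /(supersym_cons a)/IH. Qed.

Lemma supersym_scale F c : supersym F -> supersym (fun w => c * F w).
Proof. by move=> h i w; rewrite h mulrCA. Qed.

Lemma supersym_swap F u a b v : supersym F ->
  F (u ++ b :: a :: v) = (-1) ^+ (lpar a && lpar b) * F (u ++ a :: b :: v).
Proof. by move=> h; rewrite -wswap_cat h wswap_sign_cat. Qed.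

Lemma supersym_move F u a v : supersym F ->
  F (u ++ a :: v) = (-1) ^+ (lpar a && wpar u) * F (a :: u ++ v).
Proof.
elim: u F => [|b u IH] F sF; first by rewrite andbF mul1r.
rewrite /= (IH _ (supersym_cons b sF)) (@supersym_swap F [::] a b) // mulrA.
rewrite -signr_addb wpar_cons; congr ((-1) ^+ _ * _).
by case: (lpar a) (lpar b) (wpar u) => [] [] [].
Qed.

Lemma supersym_catC F u v : supersym F ->
  F (u ++ v) = (-1) ^+ (wpar u && wpar v) * F (v ++ u).
Proof.
elim: v u F => [|a v IH] u F sF; first by rewrite cats0 andbF mul1r.
rewrite supersym_move // (IH _ _ (supersym_cons a sF)) mulrA -signr_addb wpar_cons.
by rewrite /= andbC -andb_addr.
Qed.

(** One chain of adjacent transpositions takes [u] to [w] and multiplies [F] and [G] by the same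
    sign. Comparing two functions avoids defining that sign, which is ambiguous when an odd letter
    is repeated. *)
Lemma supersym_perm_eq F G u : supersym F -> supersym G -> F u = G u ->
  forall w, perm_eq u w -> F w = G w.
Proof.
elim: u F G => [|a u IH] F G sF sG e w pw.
  by have := perm_size pw; case: w {pw}.
have aw : a \in w by rewrite -(perm_mem pw) mem_head.
case/splitPr: aw pw => w1 w2 pw.
rewrite (supersym_move _ _ _ sF) (supersym_move _ _ _ sG); congr (_ * _).
apply: (IH _ _ (supersym_cons a sF) (supersym_cons a sG) e).
rewrite -(perm_cons a); apply: (perm_trans pw); apply/permPl.
exact: (perm_catCA w1 [:: a] w2).
Qed.


(* The value at [w] of the super shuffle product of the letter [l] and [G]. *)
Fixpoint contr l G w : R :=
  if w is m :: w' then
    (l == m)%:R * G w' +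
    (-1) ^+ (lpar l && lpar m) * contr l (fun x => G (m :: x)) w'
  else 0.

Lemma eq_contr l F G w : F =1 G -> contr l F w = contr l G w.
Proof. by elim: w F G => //= m w IH F G h; rewrite h (IH _ (fun x => G (m :: x))). Qed.

Lemma contrZ l c G w : contr l (fun x => c * G x) w = c * contr l G w.
Proof.
elim: w G => [|m w IH] G /=; first by rewrite mulr0.
by rewrite IH mulrDr; congr (_ + _); rewrite mulrCA.
Qed.

Lemma contr_sum (I : Type) (r : seq I) l (G : I -> word -> R) w :
  contr l (fun x => \sum_(i <- r) G i x) w = \sum_(i <- r) contr l (G i) w.
Proof.
elim: w G => [|m w IH] G /=; first by rewrite big1.
by rewrite IH !mulr_sumr -big_split.
Qed.

Lemma supersym_contr l G : supersym G -> supersym (contr l G).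
Proof.
move=> sG i w; elim: i w G sG => [|i IH] [|a w] G sG /=; rewrite ?expr0 ?mulr0 //.
  case: w => [|b w]; rewrite ?mul1r //=.
  rewrite (eq_contr _ _ (fun x => @supersym_swap G [::] a b x sG)) contrZ.
  set X := contr _ _ _.
  case: (eqVneq l a) (eqVneq l b) => [<-|_] [<-|_];
    case: (lpar l) => //; try case: (lpar a); try case: (lpar b);
    rewrite /= ?expr0 ?expr1; ring.
rewrite IH ?sG; last exact: supersym_cons.
by rewrite mulrDr; congr (_ + _); rewrite mulrCA.
Qed.


Lemma contrD l F G w :
  contr l (fun x => F x + G x) w = contr l F w + contr l G w.
Proof.
elim: w F G => [|m w IH] F G /=; first by rewrite addr0.
by rewrite (IH (fun x => F (m :: x))) !mulrDr addrACA.
Qed.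

Lemma contrC l m G w :
  contr l (contr m G) w = (-1) ^+ (lpar l && lpar m) * contr m (contr l G) w.
Proof.
elim: w G => [|a w IH] G /=; first by rewrite mulr0.
rewrite !contrD !contrZ IH.
case: (eqVneq l a) (eqVneq m a) => [->|_] [->|_];
  do 3?[case: (lpar _)]; rewrite /= ?expr0 ?expr1; ring.
Qed.

(** The prefix [u] collects the letters that the recursion has already passed; it is empty in the
    application. *)
Lemma contr_neq0 l G u w (y : word) :
  (forall x, G x != 0 -> perm_eq (l :: u ++ x) y) ->
  contr l G w != 0 -> perm_eq (u ++ w) y.
Proof.
elim: w u G => [|m w IH] u G h /=; first by rewrite eqxx.
have [G0|] := eqVneq ((l == m)%:R * G w) 0.
  rewrite G0 add0r => nz; rewrite -cat_rcons.
  apply: (IH _ (fun x => G (m :: x))) => [x /h hx|].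
    by rewrite cat_rcons.
  by apply: contra_neq nz => ->; rewrite mulr0.
case: (eqVneq l m) => [<-|_]; last by rewrite mul0r eqxx.
rewrite /= mul1r => /h hw _; apply: perm_trans hw; apply/permPl.
exact: (perm_catCA u [:: l] w).
Qed.

Lemma contr_notin l G w : l \notin w -> contr l G w = 0.
Proof.
elim: w G => //= m w IH G; rewrite inE negb_or => /andP[/negPf-> lw].
by rewrite /= mul0r add0r IH // mulr0.
Qed.

Lemma supersym_rem l G w : ~~ lpar l -> supersym G -> l \in w ->
  G (l :: rem l w) = G w.
Proof.
move=> /negPf l0; elim: w G => //= m w IH G sG.
case: (eqVneq m l) => [-> //|ml]; rewrite inE eq_sym (negPf ml) /= => lw.
rewrite (@supersym_swap G [::] m l) // l0 andbF mul1r.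
exact: (IH (fun x => G (m :: x)) (supersym_cons _ sG)).
Qed.

(** An even letter moves without sign, so all its occurrences in [w] contribute the same value. *)
Lemma contr_even l G w : ~~ lpar l -> supersym G ->
  contr l G w = (count_mem l w)%:R * G (rem l w).
Proof.
move=> /negPf l0; elim: w G => [|m w IH] G sG /=; first by rewrite mul0r.
rewrite l0 expr0 mul1r (IH (fun x => G (m :: x))); last exact: supersym_cons.
rewrite [m == l]eq_sym; case: eqVneq => [<-|_]; last by rewrite /= mul0r !add0r.
rewrite /= natrD mulrDl mul1r; congr (_ + _).
have [lw|lw] := boolP (l \in w); last by rewrite (count_memPn lw) !mul0r.
by rewrite supersym_rem ?l0.
Qed.

(* The super permanent of the matrix of equalities between the letters of [u] and
   those of [w], i.e. the signed number of rearrangements taking [u] to [w]. *)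
Fixpoint sperm u : word -> R :=
  if u is l :: u' then contr l (sperm u') else fun w => (w == [::])%:R.

Lemma supersym_sperm u : supersym (sperm u).
Proof.
elim: u => [|l u IH]; last exact: supersym_contr.
move=> i w /=; case: (wswapP i w) => [[-> ->]|[x [a [b [y [-> ->]]]]]].
  by rewrite mul1r.
by rewrite wswap_cat; case: x => [|c x]; rewrite !mulr0n mulr0.
Qed.

Lemma sperm_neq0 u w : sperm u w != 0 -> perm_eq u w.
Proof.
elim: u w => [|l u IH] w /=; first by case: w => //=; rewrite eqxx.
move=> h; rewrite perm_sym; apply: (@contr_neq0 l (sperm u) [::]) h => x /IH.
by rewrite perm_cons perm_sym.
Qed.

Lemma sperm_wpar u w : sperm u w != 0 -> wpar w = wpar u.
Proof. by move/sperm_neq0/wpar_perm. Qed.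

Lemma supersym_sperml w : supersym (sperm^~ w).
Proof.
move=> i u; case: (wswapP i u) => [[-> ->]|[x [a [b [y [-> ->]]]]]].
  by rewrite mul1r.
rewrite wswap_cat wswap_sign_cat /=.
elim: x w => [|l x IH] w /=; first by rewrite contrC andbC.
by rewrite (eq_contr _ _ IH) contrZ.
Qed.

(** A permanent equals that of the transposed matrix. For fixed [u] both sides are supersymmetric in
    [w], and they agree trivially at [w = u]. *)
Lemma spermC u w : sperm u w = sperm w u.
Proof.
have [p|p] := boolP (perm_eq u w).
  exact: (supersym_perm_eq (supersym_sperm u) (supersym_sperml u) (erefl _) p).
have [->|/sperm_neq0] := eqVneq (sperm u w) 0; last by rewrite (negPf p).
by have [->|/sperm_neq0] := eqVneq (sperm w u) 0; rewrite // perm_sym (negPf p).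
Qed.

Definition odd_uniq u := uniq (filter lpar u).

Fixpoint even_fact u : nat :=
  if u is l :: u' then
    ((if lpar l then 1 else (count_mem l u').+1) * even_fact u')%N
  else 1.

Lemma even_fact_gt0 u : (0 < even_fact u)%N.
Proof. by elim: u => //= l u IH; rewrite muln_gt0 IH; case: ifP. Qed.

Lemma even_fact_filter u : even_fact (filter (fun l => ~~ lpar l) u) = even_fact u.
Proof.
elim: u => //= l u IH; case: (boolP (lpar l)) => l0 /=; rewrite ?mul1n //.
rewrite (negPf l0) IH; congr (_.+1 * _)%N; rewrite count_filter.
by apply: eq_count => m /=; case: (eqVneq m l) => // ->.
Qed.

(** The rearrangements that fix [u] permute equal letters. When the odd letters are distinct, only
    even ones are permuted, without sign, in a product of factorials of ways. *)
Lemma sperm_diag u : odd_uniq u -> sperm u u = (even_fact u)%:R.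
Proof.
rewrite /odd_uniq; elim: u => [|l u IH] //=; rewrite eqxx /= mul1r.
case: ifP => l0 /=.
  rewrite mem_filter l0 /= => /andP[lu uu]; rewrite IH // contr_notin //.
  by rewrite mulr0 addr0 mul1n.
move=> uu; rewrite IH // mul1r contr_even ?l0 //; last exact/supersym_cons/supersym_sperm.
rewrite mulSn natrD natrM; congr (_ + _).
have [lu|lu] := boolP (l \in u); last by rewrite (count_memPn lu) !mul0r.
rewrite -IH //; congr (_ * _).
by rewrite supersym_rem ?l0 //; exact: supersym_sperm.
Qed.

Definition alternate F :=
  forall i w, wswap i w = w -> wswap_sign i w -> F w = 0.

Lemma alternate_cons F a : alternate F -> alternate (fun w => F (a :: w)).
Proof. by move=> h i w e s; apply: (h i.+1) => //=; rewrite e. Qed.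

(** A repeated odd letter can be moved next to its first copy, where [alternate] forces the value
    0. *)
Lemma alternate_odd_uniq F u :
  supersym F -> alternate F -> ~~ odd_uniq u -> F u = 0.
Proof.
elim: u F => //= a u IH F sF aF; rewrite /odd_uniq /=.
case: (boolP (lpar a)) => a1 /=; last first.
  exact: (IH _ (supersym_cons a sF) (alternate_cons a aF)).
rewrite negb_and mem_filter a1 /= negbK; case: (boolP (a \in u)) => [|_] /=.
  case/splitPr=> x y _; rewrite (supersym_move _ _ _ (supersym_cons a sF)).
  by rewrite (aF 0 (a :: a :: _)) ?mulr0 //= a1.
exact: (IH _ (supersym_cons a sF) (alternate_cons a aF)).
Qed.

End Words.

(** * The sign of a rearrangement of words *)

Section SignOfRearrangement.
Variable A : salg.
Notation word := (seq (letter A)).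
Implicit Types (u v w : word) (F G : word -> int).

(** Over [int] the signs alone force this vanishing, which then passes to every field,
    characteristic 2 included. *)
Lemma supersym_alternate F : supersym F -> alternate F.
Proof. by move=> sF i w e s; have := sF i w; rewrite e s expr1 mulN1r; lia. Qed.

(* The sign of the rearrangement taking [u] to [w], and 0 when [w] is not a
   rearrangement of [u] or contains an odd letter twice. *)
Definition rsgn u w : int := sgz (sperm int u w).

Lemma supersym_rsgn u : supersym (rsgn u).
Proof.
move=> i w; rewrite /rsgn supersym_sperm sgzM; congr (_ * _).
by case: (wswap_sign i w).
Qed.

Lemma rsgnC u w : rsgn u w = rsgn w u.
Proof. by rewrite /rsgn spermC. Qed.

Lemma rsgn_neq0 u w : rsgn u w != 0 -> perm_eq u w.
Proof. by rewrite sgz_eq0; exact: sperm_neq0. Qed.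

Lemma rsgn_diag u : rsgn u u = (odd_uniq u)%:R.
Proof.
case: (boolP (odd_uniq u)) => uu.
  by rewrite /rsgn sperm_diag // gtr0_sgz // ltr0n even_fact_gt0.
exact: (alternate_odd_uniq (supersym_rsgn u) (supersym_alternate (supersym_rsgn u))).
Qed.

(** Identities between functions supported on one orbit reduce to a single value; if [u] repeats an
    odd letter, both functions vanish on the whole orbit. *)
Lemma supersym_eq u F G : supersym F -> supersym G ->
  (forall w, F w != 0 -> perm_eq u w) -> (forall w, G w != 0 -> perm_eq u w) ->
  (odd_uniq u -> F u = G u) -> F =1 G.
Proof.
move=> sF sG hF hG e w; have [p|p] := boolP (perm_eq u w).
  apply: (supersym_perm_eq sF sG) p; have [/e //|nu] := boolP (odd_uniq u).
  rewrite (alternate_odd_uniq sF) ?(alternate_odd_uniq sG) //;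
    exact: supersym_alternate.
have [->|/hF] := eqVneq (F w) 0; last by rewrite (negPf p).
by have [->|/hG] := eqVneq (G w) 0; last by rewrite (negPf p).
Qed.

Lemma sperm_rsgn u w : sperm int u w = (even_fact u)%:R * rsgn u w.
Proof.
move: w; apply: (@supersym_eq u (sperm int u) (fun w => (even_fact u)%:R * rsgn u w)).
- exact: supersym_sperm.
- exact: supersym_scale (@supersym_rsgn u).
- exact: sperm_neq0.
- by move=> w; rewrite mulf_eq0 negb_or => /andP[_ /rsgn_neq0].
- by move=> uu; rewrite rsgn_diag uu mulr1 sperm_diag.
Qed.

End SignOfRearrangement.

(** * Super convolution and shuffle product *)

Section Convolution.
Variables (A : salg) (R : comNzRingType).
Notation L := (letter A).
Notation word := (seq L).
Implicit Types (a b l m : L) (u v w t : word) (F G : word -> R).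
Implicit Types (fac : L -> seq (L * L)).

Fixpoint wfac fac w : seq (word * word) :=
  if w is m :: w' then
    [seq (p.1 :: q.1, p.2 :: q.2) | p <- fac m, q <- wfac fac w']
  else [:: ([::], [::])].

Fixpoint wsgn u v : bool :=
  match u, v with
  | _ :: u', b :: v' => (wpar u' && lpar b) (+) wsgn u' v'
  | _, _ => false
  end.

(** If [fac] lists the factorizations of each letter into two letters, this is the coefficient at
    [w] of the product, in the super tensor powers, of elements with coefficients [F] and [G]. *)
Definition conv fac F G w : R :=
  \sum_(p <- wfac fac w) (-1) ^+ wsgn p.1 p.2 * (F p.1 * G p.2).

(** The sign for moving an element of parity [b] past the word. *)
Definition tw (b : bool) F w : R := (-1) ^+ (b && wpar w) * F w.

Lemma conv_nil fac F G : conv fac F G [::] = F [::] * G [::].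
Proof. by rewrite /conv /= big_seq1 mul1r. Qed.

Lemma conv_cons fac F G m w : conv fac F G (m :: w) =
  \sum_(p <- fac m)
    conv fac (tw (lpar p.2) (fun x => F (p.1 :: x))) (fun x => G (p.2 :: x)) w.
Proof.
rewrite /conv /= big_allpairs_dep; apply: eq_bigr => p _; apply: eq_bigr => q _.
by rewrite /= signr_addb /tw andbC; ring.
Qed.

Lemma eq_conv fac F F' G G' w : F =1 F' -> G =1 G' ->
  conv fac F G w = conv fac F' G' w.
Proof. by move=> hF hG; apply: eq_bigr => p _; rewrite hF hG. Qed.

Lemma convZl fac c F G w : conv fac (fun x => c * F x) G w = c * conv fac F G w.
Proof. by rewrite /conv mulr_sumr; apply: eq_bigr => p _; ring. Qed.

Lemma convZr fac c F G w : conv fac F (fun x => c * G x) w = c * conv fac F G w.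
Proof. by rewrite /conv mulr_sumr; apply: eq_bigr => p _; ring. Qed.

Lemma convDr fac F G G' w :
  conv fac F (fun x => G x + G' x) w = conv fac F G w + conv fac F G' w.
Proof. by rewrite /conv -big_split; apply: eq_bigr => p _ /=; ring. Qed.

Lemma convDl fac F F' G w :
  conv fac (fun x => F x + F' x) G w = conv fac F G w + conv fac F' G w.
Proof. by rewrite /conv -big_split; apply: eq_bigr => p _ /=; ring. Qed.

Definition fac_par fac :=
  forall m p, p \in fac m -> lpar m = lpar p.1 (+) lpar p.2.

Lemma wfac_par fac w p : fac_par fac -> p \in wfac fac w ->
  wpar w = wpar p.1 (+) wpar p.2.
Proof.
move=> hf; elim: w p => [|m w IH] p /=; first by rewrite inE => /eqP->.
case/allpairsP=> -[a q] /= [/hf ha /IH hq ->] /=.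
by rewrite !wpar_cons ha hq addbACA.
Qed.

Lemma conv_tw fac (b : bool) F G w : fac_par fac ->
  conv fac (tw b F) (tw b G) w = tw b (conv fac F G) w.
Proof.
move=> hf; rewrite /conv /tw mulr_sumr; apply: eq_big_seq => p /(wfac_par hf)->.
by rewrite andb_addr signr_addb; ring.
Qed.

Lemma supersym_tw (b : bool) F : supersym F -> supersym (tw b F).
Proof.
move=> sF i w; rewrite /tw sF (wpar_perm (perm_wswap i w)); ring.
Qed.

End Convolution.

Section Shuffle.
Variables (A : salg) (R : comNzRingType).
Notation L := (letter A).
Notation word := (seq L).
Implicit Types (a b l m : L) (u v w t : word) (F G : word -> R).

(* The value at [t] of the super shuffle product of [F] and [G]. *)
Fixpoint shuf F G t : R :=
  if t is m :: t' then
    shuf (fun x => F (m :: x)) G t' + shuf (tw (lpar m) F) (fun x => G (m :: x)) t'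
  else F [::] * G [::].

Lemma eq_shuf F F' G G' t : F =1 F' -> G =1 G' -> shuf F G t = shuf F' G' t.
Proof.
elim: t F F' G G' => [|m t IH] F F' G G' hF hG /=; first by rewrite hF hG.
by congr (_ + _); apply: IH => // x; rewrite /tw ?hF ?hG.
Qed.

Lemma shufDl F F' G t : shuf (fun x => F x + F' x) G t = shuf F G t + shuf F' G t.
Proof.
elim: t F F' G => [|m t IH] F F' G /=; first by rewrite mulrDl.
rewrite (IH (fun x => F (m :: x))) addrACA; congr (_ + _); rewrite -IH.
by apply: eq_shuf => // x; rewrite /tw mulrDr.
Qed.

Lemma shufZl c F G t : shuf (fun x => c * F x) G t = c * shuf F G t.
Proof.
elim: t F G => [|m t IH] F G /=; first by rewrite mulrA.
rewrite (IH (fun x => F (m :: x))) mulrDr; congr (_ + _); rewrite -IH.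
by apply: eq_shuf => // x; rewrite /tw mulrCA.
Qed.

Lemma shufZr c F G t : shuf F (fun x => c * G x) t = c * shuf F G t.
Proof.
elim: t F G => [|m t IH] F G /=; first by rewrite mulrCA.
by rewrite IH (IH _ (fun x => G (m :: x))) mulrDr.
Qed.

Lemma shuf_suml (I : Type) (r : seq I) (F : I -> word -> R) G t :
  shuf (fun x => \sum_(i <- r) F i x) G t = \sum_(i <- r) shuf (F i) G t.
Proof.
elim: t F G => [|m t IH] F G /=; first by rewrite mulr_suml.
rewrite big_split /= -IH -(IH (fun i => tw (lpar m) (F i))); congr (_ + _).
by apply: eq_shuf => // x; rewrite /tw mulr_sumr.
Qed.

Lemma shuf_sumr (I : Type) (r : seq I) F (G : I -> word -> R) t :
  shuf F (fun x => \sum_(i <- r) G i x) t = \sum_(i <- r) shuf F (G i) t.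
Proof.
elim: t F G => [|m t IH] F G /=; first by rewrite mulr_sumr.
by rewrite big_split /= -IH -(IH _ (fun i x => G i (m :: x))).
Qed.

Lemma tw_contr (b : bool) l F t :
  tw b (contr l F) t = (-1) ^+ (b && lpar l) * contr l (tw b F) t.
Proof.
rewrite /tw; elim: t F => [|m t IH] F /=; first by rewrite !mulr0.
have -> : contr l (fun x => (-1) ^+ (b && wpar (m :: x)) * F (m :: x)) t =
    (-1) ^+ (b && lpar m) *
    contr l (fun x => (-1) ^+ (b && wpar x) * F (m :: x)) t.
  rewrite -contrZ; apply: eq_contr => x.
  by rewrite wpar_cons andb_addr signr_addb mulrA.
rewrite wpar_cons andb_addr signr_addb mulrDr.
rewrite [X in _ + X = _](_ : _ = (-1) ^+ (b && lpar m) * (-1) ^+ (lpar l && lpar m) *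
  ((-1) ^+ (b && wpar t) * contr l (fun x => F (m :: x)) t)); last by ring.
by rewrite IH; case: (eqVneq l m) => [<-|_] /=; ring.
Qed.

(** [contr l] is the shuffle by the single letter [l], so this is a case of the associativity of the
    shuffle product. *)
Lemma shuf_contr l F G t : shuf (contr l F) G t = contr l (shuf F G) t.
Proof.
elim: t F G => [|m t IH] F G /=; first by rewrite mul0r.
rewrite shufDl !shufZl contrD IH -addrA mulrDr -(IH (tw _ F)); congr (_ + (_ + _)).
by rewrite -shufZl; apply: eq_shuf => // x; rewrite tw_contr andbC.
Qed.

Lemma shuf_nil G t : shuf (fun w => (w == [::])%:R) G t = G t.
Proof.
elim: t G => [|m t IH] G /=; first by rewrite mul1r.
rewrite -[RHS](IH (fun x => G (m :: x))) -[RHS]add0r; congr (_ + _).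
  rewrite -[RHS](mul0r (shuf (fun _ => 0) G t)) -shufZl.
  by apply: eq_shuf => // x; rewrite mulr0n mul0r.
by apply: eq_shuf => // -[|a x]; rewrite /tw ?andbF ?mul1r // mulr0.
Qed.

(** Laplace expansion of the permanent along the rows of [u]. Concatenation of words, which is the
    product of the dual, thus becomes the shuffle product of functions. *)
Lemma sperm_cat u v t : sperm R (u ++ v) t = shuf (sperm R u) (sperm R v) t.
Proof.
elim: u t => [|l u IH] t /=; first by rewrite shuf_nil.
by rewrite shuf_contr; apply: eq_contr.
Qed.

End Shuffle.

(** * The product of the trivial extension *)

Section TrivialExtension.
Variables (A : salg) (s : salg_anti A) (R : comNzRingType).
Notation L := (letter A).
Notation word := (seq L).
Implicit Types (a b l m y z : L) (u v w t : word) (F G f g : word -> R).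
Variable fac : L -> seq (L * L).
(* [(y, a) \in facl m] and [(a, y) \in facr m] mean y a* = m* resp. a* y = m* for the
   dual letters a*, m*. *)
Variables facl facr : L -> seq (L * L).
Hypothesis fac_parP : fac_par fac.
Hypothesis fac_uniq : forall m, uniq (fac m).
Hypothesis facl_uniq : forall m, uniq (facl m).
Hypothesis facr_uniq : forall m, uniq (facr m).
Hypothesis faclE : forall y a m, ((y, a) \in facl m) = ((s y, m) \in fac a).
Hypothesis facrE : forall a y m, ((a, y) \in facr m) = ((m, s y) \in fac a).

Lemma facl_parP : fac_par facl.
Proof.
move=> m [y a]; rewrite faclE => /fac_parP /= ->.
by rewrite lanti_par addbA addbb.
Qed.

Lemma facr_parP : fac_par facr.
Proof.
move=> m [a y]; rewrite facrE => /fac_parP /= ->.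
by rewrite lanti_par -addbA addbb addbF.
Qed.

(** The left action on dual letters is the transpose of multiplication: [(y, a)] in [facl m0]
    corresponds to [(s y, m0)] in [fac a]. *)
Lemma sum_facl m0 (u0 : L) (h : L -> R) :
  \sum_(p <- facl m0) (u0 == p.2)%:R * h p.1 =
  \sum_(p <- fac u0) (p.2 == m0)%:R * h (s p.1).
Proof.
transitivity (\sum_(p <- [seq p <- facl m0 | u0 == p.2]) h p.1).
  rewrite big_filter [RHS]big_mkcond; apply: eq_bigr => p _.
  by case: (u0 == p.2); rewrite ?mul1r ?mul0r.
transitivity (\sum_(p <- [seq p <- fac u0 | p.2 == m0]) h (s p.1)); last first.
  rewrite big_filter [LHS]big_mkcond; apply: eq_bigr => p _.
  by case: (p.2 == m0); rewrite ?mul1r ?mul0r.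
rewrite -(big_map (fun p => (s p.1, u0)) xpredT (fun p => h p.1)).
apply: perm_big; apply: uniq_perm.
- exact: filter_uniq.
- rewrite map_inj_in_uniq; first exact: filter_uniq.
  move=> [y a] [z b]; rewrite !mem_filter /= => /andP[/eqP-> _] /andP[/eqP-> _].
  by case=> /(inv_inj (lantiK s)) ->.
move=> [y a]; rewrite mem_filter /=; apply/andP/mapP.
  move=> [/eqP<-]; rewrite faclE => h'.
  by exists (s y, m0); rewrite ?mem_filter /= ?eqxx ?lantiK.
case=> -[z b]; rewrite mem_filter /= => /andP[/eqP-> zm] [-> ->].
by rewrite faclE lantiK.
Qed.

Lemma sum_facr m0 (u0 : L) (h : L -> R) :
  \sum_(p <- facr m0) (u0 == p.1)%:R * h p.2 =
  \sum_(p <- fac u0) (p.1 == m0)%:R * h (s p.2).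
Proof.
transitivity (\sum_(p <- [seq p <- facr m0 | u0 == p.1]) h p.2).
  rewrite big_filter [RHS]big_mkcond; apply: eq_bigr => p _.
  by case: (u0 == p.1); rewrite ?mul1r ?mul0r.
transitivity (\sum_(p <- [seq p <- fac u0 | p.1 == m0]) h (s p.2)); last first.
  rewrite big_filter [LHS]big_mkcond; apply: eq_bigr => p _.
  by case: (p.1 == m0); rewrite ?mul1r ?mul0r.
rewrite -(big_map (fun p => (u0, s p.2)) xpredT (fun p => h p.2)).
apply: perm_big; apply: uniq_perm.
- exact: filter_uniq.
- rewrite map_inj_in_uniq; first exact: filter_uniq.
  move=> [a y] [b z]; rewrite !mem_filter /= => /andP[/eqP-> _] /andP[/eqP-> _].
  by case=> /(inv_inj (lantiK s)) ->.
move=> [a y]; rewrite mem_filter /=; apply/andP/mapP.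
  move=> [/eqP<-]; rewrite facrE => h'.
  by exists (m0, s y); rewrite ?mem_filter /= ?eqxx ?lantiK.
case=> -[b z]; rewrite mem_filter /= => /andP[/eqP-> zm] [-> ->].
by rewrite facrE lantiK.
Qed.

(** The action is letterwise, so it applies to the inserted letter [u0] on its own: [u0] is replaced
    by [p.2], for [p] in [fac u0], while [f] receives the letter [s p.1]. Supersymmetry of [f]
    brings this letter to the front from wherever [u0] was inserted. *)
Lemma conv_facl_contr f G (u0 : L) t : supersym f ->
  conv facl f (contr u0 G) t =
  \sum_(p <- fac u0)
    contr p.2 (conv facl (tw (lpar u0) (fun x => f (s p.1 :: x))) G) t.
Proof.
elim: t f G => [|m0 t IH] f G sf.
  by rewrite conv_nil /= mulr0 big1.
(* The first letter [m0] either arises from [u0], or leaves [u0] to be inserted further on, where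
   the induction hypothesis applies. *)
transitivity (\sum_(p <- facl m0) ((u0 == p.2)%:R *
      conv facl (tw (lpar u0) (fun x => f (p.1 :: x))) G t +
    \sum_(q <- fac u0) (-1) ^+ (lpar u0 && lpar p.2) *
      contr q.2 (conv facl
        (tw (lpar u0) (fun x => tw (lpar p.2) (fun x => f (p.1 :: x)) (s q.1 :: x)))
        (fun x => G (p.2 :: x))) t)).
  rewrite conv_cons; apply: eq_bigr => p _ /=.
  rewrite convDr !convZr; congr (_ + _).
    by case: eqVneq => [->|_]; rewrite ?mul0r.
  by rewrite -mulr_sumr IH //; exact/supersym_tw/supersym_cons.
rewrite big_split /=.
rewrite (sum_facl _ _ (fun z => conv facl (tw (lpar u0) (fun x => f (z :: x))) G t)).
rewrite exchange_big -big_split /=; apply: eq_big_seq => q hq; congr (_ + _).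
rewrite -[in RHS](eq_contr _ _ (fun x => esym (conv_cons _ _ _ _ _))) contr_sum mulr_sumr.
apply: eq_big_seq => p hp; rewrite -!contrZ; apply: eq_contr => x.
rewrite -!convZl; apply: eq_conv => // y.
rewrite /tw !wpar_cons (@supersym_swap _ _ f [::] p.1 (s q.1)) //.
have -> := facl_parP hp; have := fac_parP hq; rewrite lanti_par => ->.
rewrite !mulrA -!signr_addb; congr ((-1) ^+ _ * _).
by case: (lpar p.1) (lpar p.2) (lpar q.1) (lpar q.2) (wpar y) => [] [] [] [] [].
Qed.

(** Mirror image of [conv_facl_contr]. The acting letter has to pass what remains of [G], hence the
    twist of [G]. *)
Lemma conv_facr_contr G g (v0 : L) t : supersym g ->
  conv facr (contr v0 G) g t =
  \sum_(p <- fac v0)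
    contr p.1 (conv facr (tw (lpar p.2) G) (fun x => g (s p.2 :: x))) t.
Proof.
elim: t g G => [|m0 t IH] g G sg.
  by rewrite conv_nil /= mul0r big1.
transitivity (\sum_(p <- facr m0) ((v0 == p.1)%:R *
      conv facr (tw (lpar p.2) G) (fun x => g (p.2 :: x)) t +
    \sum_(q <- fac v0) (-1) ^+ (lpar v0 && (lpar p.1 (+) lpar p.2)) *
      contr q.1 (conv facr
        (tw (lpar q.2) (tw (lpar p.2) (fun x => G (p.1 :: x))))
        (fun x => g (p.2 :: s q.2 :: x))) t)).
  rewrite conv_cons; apply: eq_bigr => p _ /=.
  rewrite -mulr_sumr -(IH (fun x => g (p.2 :: x))); last exact: supersym_cons.
  rewrite -!convZl -convDl; apply: eq_conv => // x.
  rewrite {1}/tw mulrDr [LHS]addrC [RHS]addrC; congr (_ + _); last first.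
    by rewrite /tw mulrCA.
  rewrite mulrCA -/(tw _ _ _) tw_contr mulrA -signr_addb.
  by rewrite [lpar p.2 && _]andbC -andb_addr.
rewrite big_split /=.
rewrite (sum_facr _ _ (fun z => conv facr (tw (lpar z) G) (fun x => g (z :: x)) t)).
rewrite exchange_big -big_split /=; apply: eq_big_seq => q hq; congr (_ + _).
  by rewrite lanti_par.
rewrite -[in RHS](eq_contr _ _ (fun x => esym (conv_cons _ _ _ _ _))) contr_sum mulr_sumr.
apply: eq_big_seq => p hp; rewrite -!contrZ; apply: eq_contr => x.
rewrite -convZl.
transitivity (conv facr
  (fun w => (-1) ^+ (lpar p.2 && lpar q.2) * ((-1) ^+ (lpar v0 && (lpar p.1 (+) lpar p.2))
    * tw (lpar q.2) (tw (lpar p.2) (fun w => G (p.1 :: w))) w))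
  (fun w => g (s q.2 :: p.2 :: w)) x).
  rewrite [RHS]convZl -convZr; apply: eq_conv => // y.
  by rewrite (@supersym_swap _ _ g [::] p.2 (s q.2)) // lanti_par signrMK.
rewrite -convZl; apply: eq_conv => // y.
rewrite /tw !wpar_cons.
have -> := facr_parP hp; have -> := fac_parP hq.
rewrite !mulrA -!signr_addb; congr ((-1) ^+ _ * _).
by case: (lpar p.1) (lpar p.2) (lpar q.1) (lpar q.2) (wpar y) => [] [] [] [] [].
Qed.

Lemma wanti_cons a u : wanti s (a :: u) = wanti s u ++ [:: s a].
Proof. by rewrite /wanti /= rev_cons cats1. Qed.

Lemma wpar_wanti u : wpar (wanti s u) = wpar u.
Proof.
rewrite /wpar /wanti count_rev count_map; congr odd; apply: eq_count => a /=.
exact: lanti_par.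
Qed.

(* The left action of the algebra on linear forms, x |-> xi_u (s(a) x), is the
   product by [a] in the trivial extension.  Reversing words in the
   anti-automorphism [s] produces exactly the sign of that product. *)
Lemma conv_facl_sperm f u t : supersym f ->
  conv facl f (sperm R u) t =
  \sum_(q <- wfac fac u) (-1) ^+ wsgn q.1 q.2 * (f (wanti s q.1) * sperm R q.2 t).
Proof.
elim: u f t => [|u0 u IH] f t sf /=.
  rewrite big_seq1 mul1r; case: t => [|m t]; first by rewrite conv_nil.
  rewrite conv_cons big1 ?mulr0 // => p _.
  by rewrite /conv big1 // => q _; rewrite mulr0n !mulr0.
rewrite conv_facl_contr // big_allpairs_dep; apply: eq_big_seq => p hp.
rewrite (eq_contr _ _ (fun x => IH _ x (supersym_tw _ (supersym_cons _ sf)))).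
rewrite contr_sum; apply: eq_bigr => q _ /=; rewrite !contrZ wanti_cons.
rewrite (supersym_catC _ _ sf) /tw wpar_wanti wpar_cons addbF lanti_par.
rewrite (fac_parP hp) !mulrA -!signr_addb; congr (_ * _ * _); congr ((-1) ^+ _).
by case: (lpar p.1) (lpar p.2) (wpar q.1) (wsgn _ _) => [] [] [] [].
Qed.

Lemma conv_facr_sperm g v t : supersym g ->
  conv facr (sperm R v) g t =
  \sum_(q <- wfac fac v) (-1) ^+ wsgn q.1 q.2 * (g (wanti s q.2) * sperm R q.1 t).
Proof.
elim: v g t => [|v0 v IH] g t sg /=.
  rewrite big_seq1 mul1r; case: t => [|m t]; first by rewrite conv_nil mulrC.
  rewrite conv_cons big1 ?mulr0 // => p _.
  by rewrite /conv big1 // => q _; rewrite /tw mulr0n mulr0 mul0r mulr0.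
rewrite conv_facr_contr // big_allpairs_dep; apply: eq_big_seq => p hp.
(* [sperm R v] is supported on words of the parity of [v], so the twist is a scalar. *)
have twE x : conv facr (tw (lpar p.2) (sperm R v)) (fun x => g (s p.2 :: x)) x =
    (-1) ^+ (lpar p.2 && wpar v) * conv facr (sperm R v) (fun x => g (s p.2 :: x)) x.
  rewrite -convZl; apply: eq_conv => // y; rewrite /tw.
  by have [->|/sperm_wpar-> //] := eqVneq (sperm R v y) 0; rewrite !mulr0.
rewrite (eq_contr _ _ twE) contrZ (eq_contr _ _ (fun x => IH _ x (supersym_cons _ sg))).
rewrite contr_sum mulr_sumr; apply: eq_big_seq => q /(wfac_par fac_parP) hq /=.
rewrite !contrZ wanti_cons (supersym_catC _ _ sg) wpar_wanti wpar_cons addbF lanti_par.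
rewrite hq !mulrA -!signr_addb; congr (_ * _ * _); congr ((-1) ^+ _).
by case: (lpar p.2) (wpar q.1) (wpar q.2) (wsgn _ _) => [] [] [] [].
Qed.

Variable inA : pred L.

(* The sign of moving the letters of [inA] in front of the others. *)
Fixpoint unshuf_sgn w : bool :=
  if w is m :: w' then
    [&& ~~ inA m, lpar m & wpar (filter inA w')] (+) unshuf_sgn w'
  else false.

(** The sign of the unshuffle turns the pair into one supersymmetric function of mixed words, the
    coefficient function of a pure tensor in the double. *)
Definition ext f g w : R :=
  (-1) ^+ unshuf_sgn w * (f (filter inA w) * g (filter (predC inA) w)).

Lemma ext_in f g m w : inA m -> ext f g (m :: w) = ext (fun x => f (m :: x)) g w.
Proof. by move=> h; rewrite /ext /= h. Qed.

Lemma ext_notin f g m w : ~~ inA m ->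
  ext f g (m :: w) = ext (tw (lpar m) f) (fun x => g (m :: x)) w.
Proof. by move=> /negPf h; rewrite /ext /= h /= signr_addb /tw; ring. Qed.

Lemma wpar_filter w : wpar w = wpar (filter inA w) (+) wpar (filter (predC inA) w).
Proof.
by rewrite -wpar_cat; apply/wpar_perm; rewrite perm_sym perm_filterC.
Qed.

Lemma tw_ext (b : bool) f g w : tw b (ext f g) w = ext (tw b f) (tw b g) w.
Proof. by rewrite /ext /tw wpar_filter andb_addr signr_addb; ring. Qed.

Lemma eq_ext f f' g g' w : f =1 f' -> g =1 g' -> ext f g w = ext f' g' w.
Proof. by move=> hf hg; rewrite /ext hf hg. Qed.

Lemma extZr c f g w : ext f (fun x => c * g x) w = c * ext f g w.
Proof. by rewrite /ext; ring. Qed.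

Lemma unshuf_sgn_cat u t : all inA u -> all (predC inA) t -> unshuf_sgn (u ++ t) = false.
Proof.
elim: u => [|m u IH] /=; last by move=> /andP[-> /IH h] /h.
move=> _; elim: t => //= m t IH /andP[_ ht].
rewrite IH // addbF (eq_in_filter (a2 := pred0)) ?filter_pred0 ?andbF // => x.
by move=> /(allP ht) /= /negPf.
Qed.

(** This reduces an identity to sorted words, the form in which [conv_ext] and [conv_ext_out]
    compute a convolution. *)
Lemma supersym_unshuf F w : supersym F ->
  F w = (-1) ^+ unshuf_sgn w * F (filter inA w ++ filter (predC inA) w).
Proof.
elim: w F => [|m w IH] F sF /=; first by rewrite mul1r.
rewrite (IH (fun x => F (m :: x))); last exact: supersym_cons.
case: (inA m) => //=; rewrite (supersym_move _ _ _ sF).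
by rewrite signr_addb -mulrA [RHS]mulrCA signrMK.
Qed.

Lemma supersym_ext f g : supersym f -> supersym g -> supersym (ext f g).
Proof.
move=> sf sg i w; elim: i w f g sf sg => [|i IH] [|a w] f g sf sg /=; rewrite ?mul1r //.
  case: w => [|b w]; rewrite ?mul1r // /ext /=.
  have ff := @supersym_swap _ _ f [::] a b _ sf.
  have gg := @supersym_swap _ _ g [::] a b _ sg.
  case: (inA a); case: (inA b);
    rewrite /= ?ff ?gg ?wpar_cons ?(andb_addr, signr_addb) /=;
    case: (lpar a); case: (lpar b); case: (wpar (filter inA w)); rewrite /= ?expr0 ?expr1; ring.
have [h|h] := boolP (inA a).
  by rewrite !ext_in // IH //; exact: supersym_cons.
rewrite !ext_notin // IH //; first exact: supersym_tw.
exact: supersym_cons.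
Qed.

Variable zfac : L -> seq (L * L).
Hypothesis zfac_in : forall m, inA m -> zfac m = fac m.
Hypothesis zfac_out : forall m, ~~ inA m -> zfac m = facl m ++ facr m.
Hypothesis fac_inA : forall m p, inA m -> p \in fac m -> inA p.1 && inA p.2.
Hypothesis facl_inA : forall m p, ~~ inA m -> p \in facl m -> inA p.1 && ~~ inA p.2.
Hypothesis facr_inA : forall m p, ~~ inA m -> p \in facr m -> ~~ inA p.1 && inA p.2.

Definition homog (j : bool) F := forall w, wpar w != j -> F w = 0.

Lemma homog_sperm u : homog (wpar u) (sperm R u).
Proof.
by move=> w h; have [//|/sperm_wpar e] := eqVneq (sperm R u w) 0; rewrite e eqxx in h.
Qed.

Lemma homog_tw j (b : bool) F w : homog j F -> tw b F w = (-1) ^+ (b && j) * F w.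
Proof.
by move=> h; rewrite /tw; have [-> //|/h ->] := eqVneq (wpar w) j; rewrite !mulr0.
Qed.

Lemma homog_cons j F m : homog j F -> homog (j (+) lpar m) (fun x => F (m :: x)).
Proof.
move=> h w hw; apply: h; apply: contra hw => /eqP <-; rewrite wpar_cons.
by rewrite addbAC addbb.
Qed.

(* In a product of dual letters, each dual letter comes from one of the two factors
   and is acted upon by a letter of the other. *)
Lemma conv_ext_out f al g be j t : all (predC inA) t -> homog j be ->
  conv zfac (ext f al) (ext g be) t =
  shuf (conv facl f be) (tw j (conv facr al g)) t.
Proof.
elim: t f al g be j => [|m t IH] f al g be j /=.
  by move=> _ _; rewrite /tw /= andbF !conv_nil /ext /= !mul1r; ring.
move=> /andP[/= mA tA] hj; rewrite conv_cons zfac_out // big_cat /=; congr (_ + _).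
  (* If the dual letter [m] comes from [be], a letter of [f] acts on it from the left; this is the
     first term of [shuf]. *)
  rewrite [RHS](eq_shuf _ (conv_cons _ _ _ _) (fun=> erefl)) shuf_suml.
  apply: eq_big_seq => p hp; have /andP[p1 p2] := facl_inA mA hp.
  transitivity (conv zfac
    (ext (tw (lpar p.2) (fun x => f (p.1 :: x))) (tw (lpar p.2) al))
    (ext (tw (lpar p.2) g) (fun x => be (p.2 :: x))) t).
    apply: eq_conv => x; last exact: ext_notin.
    by rewrite -tw_ext /tw ext_in.
  rewrite (IH _ _ _ _ _ tA (homog_cons (m := p.2) hj)); apply: eq_shuf => // x.
  rewrite {1}/tw (conv_tw _ _ _ _ facr_parP) /tw mulrA -signr_addb.
  by rewrite andb_addl addbK.
(* If [m] comes from [al], a letter of [g] acts on it from the right. Since [be] is homogeneous, its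
   twist by [m] is a sign that can be factored out. *)
rewrite [RHS](eq_shuf (F' := fun x => (-1) ^+ (lpar m && j) *
    conv facl (tw (lpar m) f) be x)
  (G' := fun x => \sum_(p <- facr m) (-1) ^+ (j && lpar m) * tw j
    (conv facr (tw (lpar p.2) (fun x => al (p.1 :: x))) (fun x => g (p.2 :: x))) x)).
- rewrite shufZl shuf_sumr mulr_sumr; apply: eq_big_seq => p hp.
  have /andP[p1 p2] := facr_inA mA hp.
  rewrite shufZr mulrA -signr_addb [_ && lpar m]andbC addbb mul1r.
  transitivity (conv zfac
    (ext (tw (lpar m) f) (tw (lpar p.2) (fun x => al (p.1 :: x))))
    (ext (fun x => g (p.2 :: x)) be) t).
    apply: eq_conv => x; last exact: ext_in.
    rewrite /tw ext_notin // -/(tw _ _ _) tw_ext; apply: eq_ext => // y.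
    by rewrite (facr_parP hp) /tw mulrA -signr_addb -andb_addl addbC.
  by rewrite (IH _ _ _ _ _ tA hj).
- move=> x; rewrite -(conv_tw _ _ _ _ facl_parP) -convZr.
  by apply: eq_conv => // y; exact: homog_tw.
move=> x; rewrite /tw conv_cons mulr_sumr wpar_cons; apply: eq_bigr => p _.
by rewrite mulrA -signr_addb -andb_addr.
Qed.

(** The leading letters of [inA] multiply inside the algebra and split off through their
    factorizations; the twists record the passage of the right factors [p.2] across the rest of the
    left element. *)
Lemma conv_ext f al g be w t : all inA w ->
  conv zfac (ext f al) (ext g be) (w ++ t) =
  \sum_(p <- wfac fac w) (-1) ^+ wsgn p.1 p.2 *
    conv zfac (ext (tw (wpar p.2) (fun x => f (p.1 ++ x))) (tw (wpar p.2) al))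
      (ext (fun x => g (p.2 ++ x)) be) t.
Proof.
elim: w f al g => [|m w IH] f al g /=.
  move=> _; rewrite big_seq1 mul1r; apply: eq_conv => x //.
  by apply: eq_ext => y; rewrite /tw mul1r.
move=> /andP[mA wA]; rewrite conv_cons zfac_in // big_allpairs_dep.
apply: eq_big_seq => p hp; have /andP[p1 p2] := fac_inA mA hp.
transitivity (conv zfac
    (ext (tw (lpar p.2) (fun x => f (p.1 :: x))) (tw (lpar p.2) al))
    (ext (fun x => g (p.2 :: x)) be) (w ++ t)).
  apply: eq_conv => x; last exact: ext_in.
  by rewrite -tw_ext /tw ext_in.
rewrite IH //; apply: eq_bigr => q _ /=; rewrite signr_addb [_ ^+ (_ && _) * _]mulrC -mulrA.
congr (_ * _); rewrite -convZl; apply: eq_conv => // x.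
rewrite -extZr /ext; congr (_ * _).
by rewrite /tw !wpar_cons wpar_cat !andb_addl !andb_addr !signr_addb [wpar q.1 && _]andbC; ring.
Qed.

(* The coefficients of the product in the Schur double of [f (x) xi_v] and
   [g (x) xi_u], with the sign prescribed by the formula for the double. *)
Definition dprod f v g u (h : word -> word -> R) w t : R :=
  \sum_(r <- wfac fac v) \sum_(q <- wfac fac u) \sum_(p <- wfac fac w)
  (-1) ^+ (wsgn r.1 r.2 (+) wsgn q.1 q.2 (+) wsgn p.1 p.2 (+)
           (wpar q.1 && (wpar p.1 (+) wpar p.2)) (+) (wpar p.2 && wpar v) (+)
           (wpar r.1 && wpar u)) *
  (f (wanti s q.1 ++ p.1) * g (p.2 ++ wanti s r.2) * h (q.2 ++ r.1) t).

(** The choice of [sperm] for [h] is essential: as [sperm] of a concatenation is a shuffle, the sums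
    over [q] and [r] separate into the left action on the function of [u] and the right action on
    that of [v], which is what [conv_ext_out] produces. *)
Lemma dprod_conv f v g u w t : supersym f -> supersym g ->
  all inA w -> all (predC inA) t ->
  dprod f v g u (sperm R) w t =
  conv zfac (ext f (sperm R v)) (ext g (sperm R u)) (w ++ t).
Proof.
move=> sf sg wA tA; rewrite conv_ext // /dprod.
under [LHS]eq_bigr => r _ do rewrite exchange_big.
rewrite exchange_big; apply: eq_bigr => p _ /=.
rewrite (conv_ext_out _ _ _ tA (@homog_sperm u)).
rewrite (eq_shuf (F' := fun x => \sum_(q <- wfac fac u) (-1) ^+ wsgn q.1 q.2 *
      (tw (wpar p.2) (fun x => f (p.1 ++ x)) (wanti s q.1) * sperm R q.2 x))
    (G' := fun x => \sum_(r <- wfac fac v)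
       (-1) ^+ (wsgn r.1 r.2 (+) (wpar u && wpar r.1) (+) (wpar p.2 && wpar v)) *
        (g (p.2 ++ wanti s r.2) * sperm R r.1 x))); last first.
- move=> x; rewrite /tw -/(tw _ _ _).
  transitivity ((-1) ^+ (wpar u && wpar x) * ((-1) ^+ (wpar p.2 && wpar v) *
     conv facr (sperm R v) (fun x => g (p.2 ++ x)) x)).
    rewrite -convZl; congr (_ * _); apply: eq_conv => // y.
    exact: homog_tw (@homog_sperm v).
  rewrite conv_facr_sperm; last exact: supersym_cat.
  rewrite !mulr_sumr; apply: eq_bigr => r _.
  have [->|/sperm_wpar->] := eqVneq (sperm R r.1 x) 0; first by rewrite !mulr0.
  by rewrite !signr_addb; ring.
- move=> x; apply: conv_facl_sperm; exact/supersym_tw/supersym_cat.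
rewrite shuf_suml mulr_sumr exchange_big; apply: eq_bigr => q _ /=.
rewrite shufZl shuf_sumr !mulr_sumr; apply: eq_bigr => r _.
rewrite shufZl shufZr shufZr -sperm_cat /tw wpar_wanti.
rewrite (supersym_catC p.1 (wanti s q.1) sf) wpar_wanti [wpar p.1 && _]andbC.
rewrite [wpar p.2 && wpar q.1]andbC [wpar r.1 && wpar u]andbC.
rewrite !andb_addr !signr_addb; ring.
Qed.

End TrivialExtension.

(** * Symmetry and relabelling of the convolution *)

Section ConvolutionSymmetry.
Variables (A : salg) (R : comNzRingType).
Notation L := (letter A).
Notation word := (seq L).
Implicit Types (F G : word -> R) (fac : L -> seq (L * L)).

(** This is the statement, read on coefficients, that symmetric groups act on super tensor powers by
    algebra automorphisms: exchanging adjacent letters exchanges their factorizations. *)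
Lemma supersym_conv fac F G : fac_par fac -> supersym F -> supersym G ->
  supersym (conv fac F G).
Proof.
move=> fpar sF sG i w; elim: i w F G sF sG => [|i IH] [|a w] F G sF sG /=;
  rewrite ?mul1r //.
  case: w => [|b w]; rewrite ?mul1r // !conv_cons.
  under eq_bigr => p _ do rewrite conv_cons.
  rewrite exchange_big mulr_sumr; apply: eq_big_seq => q hq.
  rewrite conv_cons mulr_sumr; apply: eq_big_seq => p hp.
  rewrite (eq_conv _ _
    (F' := fun x => (-1) ^+ ((lpar p.1 && lpar q.1) (+) (lpar p.2 && lpar q.1) (+)
                             (lpar q.2 && lpar p.1)) *
       tw (lpar p.2) (fun x => tw (lpar q.2) (fun x => F (q.1 :: x)) (p.1 :: x)) x)
    (G' := fun x => (-1) ^+ (lpar p.2 && lpar q.2) * G (q.2 :: p.2 :: x))).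
  - rewrite convZl convZr mulrA -signr_addb (fpar _ _ hp) (fpar _ _ hq).
    congr ((-1) ^+ _ * _).
    by case: (lpar p.1) (lpar p.2) (lpar q.1) (lpar q.2) => [] [] [] [].
  - move=> x; rewrite /tw (@supersym_swap _ _ F [::] q.1 p.1) // !wpar_cons.
    rewrite !mulrA -!signr_addb; congr ((-1) ^+ _ * _).
    by case: (lpar p.1) (lpar p.2) (lpar q.1) (lpar q.2) (wpar x) => [] [] [] [] [].
  by move=> x; rewrite (@supersym_swap _ _ G [::] q.2 p.2) // andbC.
rewrite !conv_cons mulr_sumr; apply: eq_bigr => p _; apply: IH.
  exact/supersym_tw/supersym_cons.
exact: supersym_cons.
Qed.

End ConvolutionSymmetry.

Section Relabelling.
Variables (A A' : salg) (R : comNzRingType).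
Variable phi : letter A -> letter A'.
Hypothesis phi_inj : injective phi.
Hypothesis phi_par : forall m, lpar (phi m) = lpar m.

Lemma perm_wfac fac fac' w :
  (forall m, perm_eq (fac' (phi m)) [seq (phi p.1, phi p.2) | p <- fac m]) ->
  perm_eq (wfac fac' (map phi w)) [seq (map phi p.1, map phi p.2) | p <- wfac fac w].
Proof.
move=> h; elim: w => //= m w IH; rewrite map_allpairs.
apply: perm_trans (perm_allpairs _ (h m) IH) _.
rewrite -!map_comp.
match goal with |- is_true (perm_eq ?a ?b) => have -> : a = b end; last exact: perm_refl.
by congr flatten; apply: eq_map => p /=; rewrite -!map_comp.
Qed.

Lemma conv_map fac fac' (F G : seq (letter A') -> R) w :
  (forall m, perm_eq (fac' (phi m)) [seq (phi p.1, phi p.2) | p <- fac m]) ->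
  conv fac' F G (map phi w) = conv fac (F \o map phi) (G \o map phi) w.
Proof.
move=> /perm_wfac h; rewrite /conv (perm_big _ (h w)) big_map.
apply: eq_bigr => -[u v] _ /=; congr ((-1) ^+ nat_of_bool _ * _).
elim: u v => [|a u IH] [|b v] //=; rewrite IH phi_par; congr ((_ && _) (+) _).
by rewrite /wpar count_map; congr odd; apply: eq_count => m /=; rewrite phi_par.
Qed.

Lemma contr_map l (G : seq (letter A') -> R) w :
  contr (phi l) G (map phi w) = contr l (G \o map phi) w.
Proof.
by elim: w G => //= m w IH G; rewrite (inj_eq phi_inj) !phi_par IH.
Qed.

Lemma sperm_map u w : sperm R (map phi u) (map phi w) = sperm R u w.
Proof.
elim: u w => [|l u IH] w /=; first by case: w.
by rewrite contr_map; exact: eq_contr.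
Qed.

End Relabelling.

(** The algebra is a product of the span of [inA] and its image under [s], an abstract form of the
    algebras of the quiver and its opposite. The lists make the sums finite: [fac] for the coproduct
    of the dual, [facl] and [facr] for the actions on dual letters. *)
Record factorization (A : salg) (s : salg_anti A) (inA : pred (letter A)) :=
    Factorization {
  fac : letter A -> seq (letter A * letter A);
  facl : letter A -> seq (letter A * letter A);
  facr : letter A -> seq (letter A * letter A);
  fac_uniq : forall m, uniq (fac m);
  facl_uniq : forall m, uniq (facl m);
  facr_uniq : forall m, uniq (facr m);
  facP : forall m p, (p \in fac m) = (lmul p.1 p.2 == Some m);
  faclP : forall m p, (p \in facl m) = (lmul (s p.1) m == Some p.2);
  facrP : forall m p, (p \in facr m) = (lmul m (s p.2) == Some p.1);
  inA_anti : forall m, inA (s m) = ~~ inA m;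
  inA_mul : forall a b c, lmul a b = Some c -> inA a = inA c /\ inA b = inA c
}.

Arguments fac {A s inA} X m : rename.
Arguments facl {A s inA} X m : rename.
Arguments facr {A s inA} X m : rename.

(** * Structure constants of the double over the integers *)

Section StructureConstants.
Variables (A : salg) (s : salg_anti A) (inA : pred (letter A)).
Variable X : factorization s inA.
Notation L := (letter A).
Notation word := (seq L).
Implicit Types (u v w t P : word).

(* The factorizations of a letter in the trivial extension of the subalgebra
   spanned by [inA]: a letter outside [inA] stands for the linear form dual to it,
   on which [inA] acts through the anti-automorphism. *)
Definition zfac m := if inA m then fac X m else facl X m ++ facr X m.

Lemma fac_parX : fac_par (fac X).
Proof. by move=> m p; rewrite facP => /eqP/lmul_par. Qed.

Lemma faclE y a m : ((y, a) \in facl X m) = ((s y, m) \in fac X a).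
Proof. by rewrite faclP facP. Qed.

Lemma facrE a y m : ((a, y) \in facr X m) = ((m, s y) \in fac X a).
Proof. by rewrite facrP facP. Qed.

Lemma fac_in m p : inA m -> p \in fac X m -> inA p.1 && inA p.2.
Proof. by rewrite facP => mA /eqP/(inA_mul X)[-> ->]; rewrite mA. Qed.

Lemma facl_out m p : ~~ inA m -> p \in facl X m -> inA p.1 && ~~ inA p.2.
Proof.
rewrite faclP => mA /eqP/(inA_mul X)[e1 e2]; move: e1; rewrite (inA_anti X) -e2.
by rewrite (negPf mA); case: (inA p.1).
Qed.

Lemma facr_out m p : ~~ inA m -> p \in facr X m -> ~~ inA p.1 && inA p.2.
Proof.
rewrite facrP => mA /eqP/(inA_mul X)[e1 e2]; move: e2; rewrite (inA_anti X) -e1.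
by rewrite (negPf mA); case: (inA p.2).
Qed.

Lemma zfac_par : fac_par zfac.
Proof.
move=> m p; rewrite /zfac; case: ifP => _; first exact: fac_parX.
rewrite mem_cat => /orP[].
  exact: (facl_parP fac_parX faclE).
exact: (facr_parP fac_parX facrE).
Qed.

Notation inw := (filter inA).
Notation outw := (filter (predC inA)).

(** Rearranging [P] into [w] amounts to unshuffling [P], rearranging both parts and shuffling back.
    By [supersym_eq] only [w = P] has to be compared. *)
Lemma rsgn_ext P w : rsgn P w =
  (-1) ^+ unshuf_sgn inA P * ext inA (rsgn (inw P)) (rsgn (outw P)) w.
Proof.
move: w; apply: (@supersym_eq _ P (rsgn P)
  (fun w => (-1) ^+ unshuf_sgn inA P * ext inA (rsgn (inw P)) (rsgn (outw P)) w)).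
- exact: supersym_rsgn.
- exact/supersym_scale/supersym_ext/supersym_rsgn/supersym_rsgn.
- exact: rsgn_neq0.
- move=> w; rewrite /ext !mulf_eq0 !negb_or => /and4P[_ _ /rsgn_neq0 p1 /rsgn_neq0 p2].
  rewrite -(permPl (permEl (perm_filterC inA P))) perm_sym.
  rewrite -(permPl (permEl (perm_filterC inA w))) perm_sym.
  exact: perm_cat.
move=> uP; rewrite /ext signrMK !rsgn_diag uP /odd_uniq.
have sub q : uniq (filter lpar (filter q P)).
  rewrite -filter_predI (eq_filter (a2 := predI q lpar)); last first.
    by move=> x /=; rewrite andbC.
  by rewrite filter_predI filter_uniq.
by rewrite !sub.
Qed.

(* The structure constants of the Schur double in the basis of orbit sums. *)
Definition dconst P P' w : int :=
  (-1) ^+ (unshuf_sgn inA P (+) unshuf_sgn inA P' (+) unshuf_sgn inA w) *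
  dprod s (fac X) (rsgn (inw P)) (outw P) (rsgn (inw P')) (outw P') (@rsgn A)
    (inw w) (outw w).

Lemma dprodZ f v g u c (h : word -> word -> int) w t :
  dprod s (fac X) f v g u (fun x y => c * h x y) w t =
  c * dprod s (fac X) f v g u h w t.
Proof.
rewrite /dprod !mulr_sumr; apply: eq_bigr => r _; rewrite mulr_sumr.
by apply: eq_bigr => q _; rewrite mulr_sumr; apply: eq_bigr => p _; ring.
Qed.

Lemma eq_dprod f v g u (h h' : word -> word -> int) w t :
  (forall x, h x t = h' x t) ->
  dprod s (fac X) f v g u h w t = dprod s (fac X) f v g u h' w t.
Proof.
by move=> e; apply: eq_bigr => r _; apply: eq_bigr => q _; apply: eq_bigr => p _; rewrite e.
Qed.

(** [dconst] pairs the dual part with orbit sums, hence [rsgn], whereas [dprod_conv] is about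
    [sperm]; each passage from one to the other costs a factorial. *)
Lemma dconst_conv P P' w : (even_fact (outw w))%:R * dconst P P' w =
  (even_fact (outw P))%:R * (even_fact (outw P'))%:R *
  conv zfac (rsgn P) (rsgn P') w.
Proof.
rewrite /dconst mulrCA -dprodZ.
(* By the symmetry of [sperm], the factorial can be taken for the fixed word [outw w] instead of
   [q.2 ++ r.1], which varies in the sum. *)
rewrite (@eq_dprod _ _ _ _ _ (sperm int)); last first.
  by move=> x; rewrite spermC sperm_rsgn rsgnC.
rewrite (@dprod_conv A s int (fac X) (facl X) (facr X) fac_parX (fac_uniq X)
  (facl_uniq X) (facr_uniq X) faclE facrE inA zfac); try exact: supersym_rsgn;
  try exact: filter_all.
- have extE Y : ext inA (rsgn (inw Y)) (sperm int (outw Y)) =1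
      (fun w => (even_fact (outw Y))%:R * ((-1) ^+ unshuf_sgn inA Y * rsgn Y w)).
    move=> x; rewrite rsgn_ext signrMK -extZr; apply: eq_ext => // y.
    exact: sperm_rsgn.
  rewrite [X in _ * X = _](eq_conv _ _ (extE P) (extE P')).
  rewrite (supersym_unshuf inA w
    (supersym_conv zfac_par (@supersym_rsgn _ P) (@supersym_rsgn _ P'))).
  rewrite !(convZl, convZr) !signr_addb.
  set a := (-1) ^+ unshuf_sgn inA P; set b := (-1) ^+ unshuf_sgn inA P'.
  have a2 : a * a = 1 by rewrite -signr_addb addbb.
  have b2 : b * b = 1 by rewrite -signr_addb addbb.
  transitivity (a * a * (b * b) * ((even_fact (outw P))%:R * (even_fact (outw P'))%:R *
    ((-1) ^+ unshuf_sgn inA w * conv zfac (rsgn P) (rsgn P') (inw w ++ outw w)))).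
    by ring.
  by rewrite a2 b2 !mul1r.
- by move=> m mA; rewrite /zfac mA.
- by move=> m /negPf mA; rewrite /zfac mA.
- exact: fac_in.
- exact: facl_out.
- exact: facr_out.
Qed.

End StructureConstants.


Lemma even_fact_map (A A' : salg) (phi : letter A -> letter A') u :
  injective phi -> (forall m, lpar (phi m) = lpar m) ->
  even_fact (map phi u) = even_fact u.
Proof.
move=> pinj ppar; elim: u => //= l u ->; rewrite ppar count_map.
by congr ((if _ then _ else _.+1) * _)%N; apply: eq_count => m /=; rewrite (inj_eq pinj).
Qed.

Lemma rsgn_map (A A' : salg) (phi : letter A -> letter A') u w :
  injective phi -> (forall m, lpar (phi m) = lpar m) ->
  rsgn (map phi u) (map phi w) = rsgn u w.
Proof. by move=> pinj ppar; rewrite /rsgn sperm_map. Qed.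

Lemma dconst_map (A A' : salg) (s : salg_anti A) (s' : salg_anti A')
    (inA : pred (letter A)) (inA' : pred (letter A'))
    (X : factorization s inA) (X' : factorization s' inA')
    (phi : letter A -> letter A') P P' w :
  injective phi -> (forall m, lpar (phi m) = lpar m) ->
  (forall m, ~~ lpar m -> inA' (phi m) = inA m) ->
  (forall m, perm_eq (zfac X' (phi m)) [seq (phi p.1, phi p.2) | p <- zfac X m]) ->
  dconst X' (map phi P) (map phi P') (map phi w) = dconst X P P' w.
Proof.
move=> pinj ppar peven pz.
(* [even_fact] sees only even letters, which [phi] keeps on their side, whereas odd letters may
   change theirs. *)
have factE u : even_fact (filter (predC inA') (map phi u)) =
    even_fact (filter (predC inA) u).
  rewrite -even_fact_filter -[RHS]even_fact_filter -[RHS](even_fact_map _ pinj ppar).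
  rewrite -!filter_predI filter_map; congr (even_fact (map phi _)).
  apply: eq_filter => m /=; rewrite ppar; case: (boolP (lpar m)) => //= m0.
  by rewrite peven.
(* The cancellation takes place in [int]; in the field this factor may be 0. *)
apply: (@mulfI _ (even_fact (filter (predC inA') (map phi w)))%:R).
  by rewrite pnatr_eq0 -lt0n even_fact_gt0.
rewrite dconst_conv !factE dconst_conv; congr (_ * _).
rewrite (conv_map ppar _ _ _ pz); apply: eq_conv => x; exact: rsgn_map.
Qed.

Lemma scale_regularE (k : fieldType) (a : k) (x : k^o) : a *: x = a * x.
Proof. by []. Qed.

(** * Bases of tensor products *)

Section Linear.
Variables (k : fieldType) (U X : lmodType k) (g : U -> X).
Hypothesis lg : linear g.

Lemma lin0 : g 0 = 0.
Proof. by have := lg (-1) 0 0; rewrite !scaleN1r !addNr. Qed.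

Lemma linZ c u : g (c *: u) = c *: g u.
Proof. by have := lg c u 0; rewrite lin0 !addr0. Qed.

Lemma linD u v : g (u + v) = g u + g v.
Proof. by have := lg 1 u v; rewrite !scale1r. Qed.

Lemma lin_sum (I : Type) (r : seq I) (F : I -> U) :
  g (\sum_(i <- r) F i) = \sum_(i <- r) g (F i).
Proof. exact: (big_morph g linD lin0). Qed.

End Linear.

Section TensorSums.
Variables (k : fieldType) (U W : lmodType k).
Implicit Types t : tens U W.

Lemma eq_tlift (X : lmodType k) (f g : U -> W -> X) t :
  (forall u w, f u w = g u w) -> tlift f t = tlift g t.
Proof. by move=> e; apply: eq_bigr => p _; rewrite e. Qed.

Lemma tlift_comp (X Y : lmodType k) (f : U -> W -> X) (g : X -> Y) t :
  linear g -> g (tlift f t) = tlift (fun u w => g (f u w)) t.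
Proof. by move=> lg; rewrite /tlift /formal_eval lin_sum. Qed.

Lemma tlift_lin (X : lmodType k) c (f g : U -> W -> X) t :
  tlift (fun u w => c *: f u w + g u w) t = c *: tlift f t + tlift g t.
Proof. by rewrite /tlift /formal_eval scaler_sumr -big_split. Qed.

Lemma tlift_sumf (X : lmodType k) (I : Type) (r : seq I) (f : I -> U -> W -> X) t :
  tlift (fun u w => \sum_(i <- r) f i u w) t = \sum_(i <- r) tlift (f i) t.
Proof. by rewrite /tlift /formal_eval exchange_big. Qed.

Lemma tlift_scalef (X : lmodType k) c (f : U -> W -> X) t :
  tlift (fun u w => c *: f u w) t = c *: tlift f t.
Proof. by rewrite /tlift /formal_eval scaler_sumr. Qed.

Lemma pureZl c (u : U) (w : W) : pure (c *: u) w = c *: pure u w.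
Proof. exact: bilinear_mapZ (pure_bilinear _ _). Qed.

Lemma pureZr c (u : U) (w : W) : pure u (c *: w) = c *: pure u w.
Proof. exact: (linZ (proj2 (pure_bilinear U W) u)). Qed.

Lemma pure_suml (I : Type) (r : seq I) (F : I -> U) (w : W) :
  pure (\sum_(i <- r) F i) w = \sum_(i <- r) pure (F i) w.
Proof. exact: (lin_sum (proj1 (pure_bilinear U W) w)). Qed.

Lemma pure_sumr (I : Type) (r : seq I) (u : U) (F : I -> W) :
  pure u (\sum_(i <- r) F i) = \sum_(i <- r) pure u (F i).
Proof. exact: (lin_sum (proj2 (pure_bilinear U W) u)). Qed.

End TensorSums.

Lemma big_subseq_uniq (k : fieldType) (V : lmodType k) (I : eqType) (r s : seq I)
    (F : I -> V) : uniq r -> uniq s -> {subset r <= s} ->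
  (forall i, i \notin r -> F i = 0) -> \sum_(i <- s) F i = \sum_(i <- r) F i.
Proof.
move=> ur us rs F0; rewrite (bigID (mem r)) /= [X in _ + X]big1 ?addr0 //.
rewrite -big_filter; apply: perm_big; apply: uniq_perm => //.
  exact: filter_uniq.
by move=> i; rewrite mem_filter; case: (boolP (i \in r)) => [/rs|].
Qed.

(* A spanning family [e] with finitely supported coordinates [c]; it may contain
   zeros and repetitions. *)
Record frame (k : fieldType) (U : lmodType k) (I : choiceType)
    (e : I -> U) (c : I -> U -> k) : Prop := Frame {
  frame_lin : forall i, linear (c i : U -> k^o);
  frame_fin : forall u, exists2 s : seq I, uniq s &
    u = \sum_(i <- s) c i u *: e i /\ forall i, i \notin s -> c i u = 0
}.

Section Frames.
Variable k : fieldType.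

Lemma frame_seq (U : lmodType k) (I : choiceType) (e : I -> U) c (l : seq U) :
  frame e c -> exists2 s : seq I, uniq s & forall u, u \in l ->
    u = \sum_(i <- s) c i u *: e i /\ forall i, i \notin s -> c i u = 0.
Proof.
move=> fr; elim: l => [|u l [s us hs]]; first by exists [::].
have [r ur [ru r0]] := frame_fin fr u.
have sub1 : {subset r <= undup (r ++ s)} by move=> i ir; rewrite mem_undup mem_cat ir.
have sub2 : {subset s <= undup (r ++ s)}.
  by move=> i ir; rewrite mem_undup mem_cat ir orbT.
exists (undup (r ++ s)); first exact: undup_uniq.
move=> v; rewrite inE => /orP[/eqP->|/hs[sv s0]]; split.
- rewrite (big_subseq_uniq (r := r)) ?undup_uniq // => i /r0 ->.
  by rewrite scale0r.
- by move=> i h; apply: r0; apply: contra h => /sub1.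
- rewrite (big_subseq_uniq (r := s)) ?undup_uniq // => i /s0 ->.
  by rewrite scale0r.
- by move=> i h; apply: s0; apply: contra h => /sub2.
Qed.

Lemma frame_inj (U : lmodType k) (I : choiceType) (e : I -> U) c (u v : U) :
  frame e c -> (forall i, c i u = c i v) -> u = v.
Proof.
move=> fr h; have [s us hs] := frame_seq [:: u; v] fr.
have [|-> _] := hs u; first by rewrite mem_head.
have [|-> _] := hs v; first by rewrite !inE eqxx orbT.
have [|eu _] := hs u; first by rewrite mem_head.
have [|ev _] := hs v; first by rewrite !inE eqxx orbT.
by rewrite -eu -ev {1}eu; rewrite [RHS]ev; apply: eq_bigr => i _; rewrite h.
Qed.

Lemma frame_tens (U W : lmodType k) (I J : choiceType) (e : I -> U) c (f : J -> W) d :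
  frame e c -> frame f d ->
  frame (fun p : (I * J)%type => pure (e p.1) (f p.2))
    (fun p t => (tlift (fun u w => c p.1 u * d p.2 w : k^o) t : k)).
Proof.
move=> fe ff; have bil p : bilinear_map (fun u w => c p.1 u * d p.2 w : k^o).
  move=> *; split=> [w a x y|u a x y] /=.
    by rewrite (frame_lin fe) scale_regularE mulrDl -mulrA.
  by rewrite (frame_lin ff) scale_regularE mulrDr mulrCA.
split=> [p|t]; first exact: tlift_linear.
have [s us hs] := frame_seq (map fst (repr t)) fe.
have [r ur hr] := frame_seq (map snd (repr t)) ff.
exists (allpairs pair s r).
  by rewrite allpairs_uniq // => -[? ?] [? ?].
split.
  rewrite big_allpairs_dep /= {1}(tens_sum_pure t).
  transitivity (\sum_(p <- repr t) \sum_(i <- s) \sum_(j <- r)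
     (c i p.1 * d j p.2) *: pure (e i) (f j)).
    apply: eq_big_seq => p pt; have [e1 _] := hs _ (map_f fst pt).
    have [e2 _] := hr _ (map_f snd pt).
    rewrite [in LHS]e1 [in LHS]e2 pure_suml; apply: eq_bigr => i _; rewrite pure_sumr.
    by apply: eq_bigr => j _; rewrite pureZl pureZr scalerA.
  rewrite exchange_big; apply: eq_bigr => i _; rewrite exchange_big.
  by apply: eq_bigr => j _; rewrite /tlift /formal_eval scaler_suml.
move=> [i j] ij; rewrite /tlift /formal_eval big_seq big1 // => p pt /=.
have [_ h1] := hs _ (map_f _ pt); have [_ h2] := hr _ (map_f _ pt).
have [is_|/h1->] := boolP (i \in s); last by rewrite mul0r.
have [jr|/h2->] := boolP (j \in r); last by rewrite mulr0.
by case/negP: ij; apply/allpairsP; exists (i, j).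
Qed.

End Frames.

(** * The Schur bialgebra and its graded dual *)

Section SchurCoefficients.
Variables (k : fieldType) (A : salg).
Notation L := (letter A).
Notation word := (seq L).
Notation S := (schur k A).
Implicit Types (x y : S) (u v w z : word).

Definition co x w : k := (schur_val x)@_w.

Lemma coE c x y w : co (c *: x + y) w = c * co x w + co y w.
Proof. by rewrite /co -[schur_val _]/(c *: schur_val x + schur_val y) mcoeffD mcoeffZ. Qed.

Lemma co_linear w : linear (co^~ w : S -> k^o).
Proof. by move=> c x y; rewrite coE. Qed.

Lemma schur_eqP x y : (forall w, co x w = co y w) -> x = y.
Proof. by move=> h; apply: val_inj; apply/malgP. Qed.

Lemma supersym_co x : supersym (co x).
Proof. by have /schurP[h _] := schur_valP x. Qed.

(** Outside characteristic 2 the signs imply it; in characteristic 2 it is the second condition of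
    [schur_pred]. *)
Lemma alternate_co x : alternate (co x).
Proof.
have /schurP[sx ax] := schur_valP x => i w e s.
have [k2|k2] := boolP (2 \in [pchar k]); first exact: (ax k2 i).
have := sx i w; rewrite e s expr1 mulN1r => /eqP.
rewrite -addr_eq0 -mulr2n -mulr_natr mulf_eq0 => /orP[/eqP //|k0].
by rewrite inE /= k0 in k2.
Qed.

Lemma schur_ofP (F : word -> k) (s : seq word) :
  supersym F -> alternate F -> (forall w, F w != 0 -> w \in s) ->
  {x : S | forall w, co x w = F w}.
Proof.
move=> sF aF hs.
pose g : {malg k[word]} := \sum_(w <- undup s) << F w *g w >>.
have gE w : g@_w = F w.
  rewrite /g raddf_sum /=; have [ws|ws] := boolP (w \in undup s).
    rewrite (bigD1_seq w) ?undup_uniq //= mcoeffU eqxx mulr1n big1 ?addr0 //.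
    by move=> v vw; rewrite mcoeffU (negPf vw).
  have -> : F w = 0.
    by apply/eqP; apply: contraNT ws => /hs; rewrite mem_undup.
  rewrite big_seq big1 // => v vs; rewrite mcoeffU.
  by case: eqVneq => // e; rewrite -e vs in ws.
have gS : g \in @schur_pred k A.
  by apply/schurP; split=> [i w|_ i w e h]; rewrite !gE; [exact: sF|exact: aF e h].
by exists (Schur gS).
Qed.

Lemma supersym_intr (F : word -> int) : supersym F -> supersym (fun w => (F w)%:~R : k).
Proof. by move=> h i w; rewrite h rmorphM rmorph_sign. Qed.

Lemma orb_subproof u : {x : S | forall w, co x w = (rsgn u w)%:~R}.
Proof.
apply: (@schur_ofP _ (permutations u)).
- exact/supersym_intr/supersym_rsgn.
- by move=> i w e h; rewrite (supersym_alternate (@supersym_rsgn _ u) e h).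
- move=> w h; rewrite mem_permutations perm_sym; apply: rsgn_neq0.
  by apply: contra_neq h => ->.
Qed.

Definition orb u : S := sval (orb_subproof u).

Lemma co_orb u w : co (orb u) w = (rsgn u w)%:~R.
Proof. exact: svalP (orb_subproof u) w. Qed.

Lemma lsh_subproof z x : {y : S | forall w, co y w = co x (z ++ w)}.
Proof.
apply: (@schur_ofP _ [seq drop (size z) w | w <- msupp (schur_val x)]).
- exact: supersym_cat (@supersym_co x).
- elim: z (co x) (@alternate_co x) => //= a z IH F aF.
  exact: (IH _ (alternate_cons a aF)).
- move=> w h; apply/mapP; exists (z ++ w); last by rewrite drop_size_cat.
  by rewrite -mcoeff_neq0.
Qed.

(** Like [rsh], the pairing of one factor of the comultiplication with a coefficient functional (see
    [lsh_comul]), by which the Sweedler sums of the double are evaluated. *)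
Definition lsh z x : S := sval (lsh_subproof z x).

Lemma co_lsh z x w : co (lsh z x) w = co x (z ++ w).
Proof. exact: svalP (lsh_subproof z x) w. Qed.

Lemma rsh_subproof z x : {y : S | forall w, co y w = co x (w ++ z)}.
Proof.
apply: (@schur_ofP _ [seq take (size w - size z) w | w <- msupp (schur_val x)]).
- move=> i w; rewrite !(supersym_catC _ z (@supersym_co x)).
  rewrite (wpar_perm (perm_wswap i w)) mulrCA; congr (_ * _).
  exact: (supersym_cat z (@supersym_co x)).
- move=> i w e h; rewrite (supersym_catC _ z (@supersym_co x)) -co_lsh.
  by rewrite (@alternate_co (lsh z x) i w e h) mulr0.
- move=> w h; apply/mapP; exists (w ++ z); first by rewrite -mcoeff_neq0.
  by rewrite size_cat addnK take_size_cat.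
Qed.

Definition rsh z x : S := sval (rsh_subproof z x).

Lemma co_rsh z x w : co (rsh z x) w = co x (w ++ z).
Proof. exact: svalP (rsh_subproof z x) w. Qed.

(* Rearrangements of a word give the same orbit sum up to sign: only the words that
   represent their class are used as indices, the coordinate being 0 elsewhere. *)
Definition rep u : word := choose (perm_eq u) u.

Lemma perm_rep u : perm_eq u (rep u).
Proof. by apply: chooseP; exact: perm_refl. Qed.

Lemma eq_rep u v : perm_eq u v -> rep u = rep v.
Proof.
move=> uv; have e : perm_eq u =1 perm_eq v by exact/permPl.
rewrite /rep (eq_choose e) //; apply: choose_id; first by rewrite perm_sym.
exact: perm_refl.
Qed.

Definition orb_coord u x : k := (u == rep u)%:R * co x u.

Lemma schur_expand x (s : seq word) : uniq s ->
  (forall u, u \notin s -> orb_coord u x = 0) ->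
  x = \sum_(u <- s) orb_coord u x *: orb u.
Proof.
move=> us h; apply: schur_eqP => w; rewrite (lin_sum (co_linear w)) /=.
have E u : co (orb_coord u x *: orb u) w = orb_coord u x * (rsgn u w)%:~R.
  by rewrite (linZ (co_linear w)) /= co_orb.
rewrite (eq_bigr _ (fun u _ => E u)).
have eqw : co x w = co x (rep w) * (rsgn (rep w) w)%:~R.
  apply: (supersym_perm_eq (u := rep w) (@supersym_co x)
    (supersym_scale _ (supersym_intr (@supersym_rsgn _ (rep w))))).
    rewrite rsgn_diag; case: (boolP (odd_uniq (rep w))) => [_|/alternate_odd_uniq ->].
    - by rewrite mulr1.
    - by rewrite mul0r.
    - exact: supersym_co.
    - exact: alternate_co.
  by rewrite perm_sym perm_rep.
have rr : rep w == rep (rep w) by apply/eqP/eq_rep/perm_rep.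
have z u : u != rep w -> orb_coord u x * (rsgn u w)%:~R = 0.
  move=> uw; rewrite /orb_coord; case: eqP => [e|_]; last by rewrite !mul0r.
  have [->|/rsgn_neq0/eq_rep e'] := eqVneq (rsgn u w) 0; first by rewrite mulr0.
  by rewrite e e' eqxx in uw.
have [ws|ws] := boolP (rep w \in s).
  rewrite (bigD1_seq (rep w)) //= big1 ?addr0 => [|u uw]; last exact: z.
  by rewrite eqw /orb_coord rr mul1r.
rewrite big_seq big1 => [|u us']; last first.
  by apply: z; apply: contraNneq ws => <-.
by rewrite eqw; have := h _ ws; rewrite /orb_coord rr mul1r => ->; rewrite mul0r.
Qed.

Lemma frame_schur : frame orb (fun u x => orb_coord u x).
Proof.
split=> [u c x y|x].
  by rewrite /orb_coord coE scale_regularE mulrDr mulrCA.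
have h u : u \notin undup (map rep (msupp (schur_val x))) -> orb_coord u x = 0.
  rewrite mem_undup /orb_coord; case: eqP => [e|_ _]; last by rewrite mul0r.
  have [->|c0] := eqVneq (co x u) 0; first by rewrite mulr0.
  by case/negP; rewrite e; apply: map_f; rewrite -mcoeff_neq0.
exists (undup (map rep (msupp (schur_val x)))); first exact: undup_uniq.
by split=> //; apply: schur_expand => //; exact: undup_uniq.
Qed.

Lemma mcoeff_pair x y u v : (schur_pair x y)@_(u, v) = co x u * co y v.
Proof.
rewrite /schur_pair /lext raddf_sum /=.
rewrite (eq_bigr (fun w => co x w * ((u == w)%:R * co y v))).
  have [us|us] := boolP (u \in msupp (schur_val x)).
    rewrite (bigD1_seq u) ?fset_uniq //= eqxx mul1r big1 ?addr0 // => w uw.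
    by rewrite eq_sym (negPf uw) mul0r mulr0.
  rewrite big_seq big1 => [|w ws]; first by rewrite {1}/co mcoeff_outdom ?mul0r.
  by case: eqP => [e|_]; [rewrite e ws in us|rewrite mul0r mulr0].
move=> w _; rewrite mcoeffZ; congr (_ * _); rewrite raddf_sum /=.
have [->|uw] := eqVneq u w; last first.
  rewrite mul0r big1 // => z _; rewrite mcoeffZ mcoeffU xpair_eqE.
  by rewrite eq_sym (negPf uw) mulr0.
rewrite mul1r; have [vs|vs] := boolP (v \in msupp (schur_val y)).
  rewrite (bigD1_seq v) ?fset_uniq //= mcoeffZ mcoeffU !eqxx mulr1 big1 ?addr0 // => z zv.
  by rewrite mcoeffZ mcoeffU xpair_eqE (negPf zv) andbF mulr0.
rewrite big_seq big1 => [|z zs]; first by rewrite /co mcoeff_outdom.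
rewrite mcoeffZ mcoeffU xpair_eqE; case: (eqVneq z v) => [e|_].
  by rewrite e in zs; rewrite zs in vs.
by rewrite andbF mulr0.
Qed.

Lemma schur_pair_bilinear : bilinear_map (@schur_pair k A).
Proof.
split=> [y c x1 x2|x c y1 y2]; apply/malgP => -[u v] /=.
  rewrite [LHS]mcoeff_pair [RHS]mcoeffD [X in _ = X + _]mcoeffZ.
  rewrite [X in _ = _ * X + _]mcoeff_pair [X in _ = _ + X]mcoeff_pair.
  by rewrite [co (_ + _) _]coE mulrDl mulrA.
rewrite [LHS]mcoeff_pair [RHS]mcoeffD [X in _ = X + _]mcoeffZ.
rewrite [X in _ = _ * X + _]mcoeff_pair [X in _ = _ + X]mcoeff_pair.
by rewrite [co (_ + _) _]coE mulrDr mulrCA.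
Qed.

Lemma mcoeff_tcomul x u v : (tcomul (schur_val x))@_(u, v) = co x (u ++ v).
Proof.
rewrite /tcomul /lext raddf_sum /=.
have E w : ((schur_val x)@_w *: (\sum_(i < (size w).+1) << (take i w, drop i w) >>
    : {malg k[(word * word)%type]}))@_(u, v) = co x w * (u ++ v == w)%:R.
  rewrite mcoeffZ; congr (_ * _); rewrite raddf_sum /=.
  have [<-|uw] := eqVneq (u ++ v) w.
    have lt : (size u < (size (u ++ v)).+1)%N by rewrite ltnS size_cat leq_addr.
    rewrite (bigD1 (Ordinal lt)) //= mcoeffU take_size_cat // drop_size_cat // eqxx.
    rewrite big1 ?addr0 // => i; rewrite mcoeffU xpair_eqE => ni.
    case: eqP => //= tu; case/eqP: ni; apply: val_inj => /=.
    have := congr1 size tu; rewrite size_take_min => <-.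
    by rewrite (minn_idPl _) // -ltnS.
  rewrite big1 // => i _; rewrite mcoeffU xpair_eqE.
  by case: eqP => //= e1; case: eqP => //= e2; rewrite -e1 -e2 cat_take_drop eqxx in uw.
rewrite (eq_bigr _ (fun w _ => E w)).
have [us|us] := boolP (u ++ v \in msupp (schur_val x)).
  rewrite (bigD1_seq (u ++ v)) ?fset_uniq //= eqxx mulr1 big1 ?addr0 // => w uw.
  by rewrite eq_sym (negPf uw) mulr0.
rewrite big_seq big1 => [|w ws]; first by rewrite /co mcoeff_outdom.
by case: eqP => [e|_]; [rewrite e ws in us|rewrite mulr0].
Qed.

(** The invariants form a subcoalgebra because [co x (u ++ v)] is supersymmetric and alternating in
    [u] and in [v] separately; expanding it in orbit sums, first in [v] and then in [u], gives a
    preimage. The index sets contain the representatives of all prefixes and suffixes of the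
    support, so that they serve every [u] and [v] at once. *)
Lemma tcomulP x : exists t : tens S S, tlift (@schur_pair k A) t = tcomul (schur_val x).
Proof.
pose U := undup (flatten [seq [seq rep (take i w) | i <- iota 0 (size w).+1]
                         | w <- msupp (schur_val x)]).
pose V := undup (flatten [seq [seq rep (drop i w) | i <- iota 0 (size w).+1]
                         | w <- msupp (schur_val x)]).
have hU v u : u \notin U -> orb_coord u (rsh v x) = 0.
  rewrite /orb_coord co_rsh; case: eqP => [e|_]; last by rewrite mul0r.
  have [->|c0] := eqVneq (co x (u ++ v)) 0; first by rewrite mulr0.
  case/negP; rewrite mem_undup; apply/flattenP.
  exists [seq rep (take i (u ++ v)) | i <- iota 0 (size (u ++ v)).+1].
    by apply: map_f; rewrite -mcoeff_neq0.
  apply/mapP; exists (size u); last by rewrite take_size_cat.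
  by rewrite mem_iota /= add0n ltnS size_cat leq_addr.
have hV u v : v \notin V -> orb_coord v (lsh u x) = 0.
  rewrite /orb_coord co_lsh; case: eqP => [e|_]; last by rewrite mul0r.
  have [->|c0] := eqVneq (co x (u ++ v)) 0; first by rewrite mulr0.
  case/negP; rewrite mem_undup; apply/flattenP.
  exists [seq rep (drop i (u ++ v)) | i <- iota 0 (size (u ++ v)).+1].
    by apply: map_f; rewrite -mcoeff_neq0.
  apply/mapP; exists (size u); last by rewrite drop_size_cat.
  by rewrite mem_iota /= add0n ltnS size_cat leq_addr.
exists (\sum_(u <- U) \sum_(v <- V)
  ((u == rep u)%:R * ((v == rep v)%:R * co x (u ++ v))) *: pure (orb u) (orb v)).
have lt := tlift_linear schur_pair_bilinear.
apply/malgP => -[u v]; rewrite mcoeff_tcomul (lin_sum lt) raddf_sum /=.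
rewrite -co_lsh (schur_expand (undup_uniq _) (hV u)) (lin_sum (co_linear v)) /=.
under eq_bigr => u' _.
  rewrite (lin_sum lt) raddf_sum /=.
  under eq_bigr => v' _.
    rewrite (linZ lt) mcoeffZ tlift_pure; last exact: schur_pair_bilinear.
    rewrite mcoeff_pair.
  over.
over.
rewrite exchange_big; apply: eq_bigr => v' _ /=.
rewrite (linZ (co_linear v)) scale_regularE.
transitivity ((v' == rep v')%:R * co (orb v') v * co (rsh v' x) u).
  rewrite (schur_expand (undup_uniq _) (hU v')) (lin_sum (co_linear u)) /=.
  rewrite mulr_sumr; apply: eq_bigr => u' _.
  by rewrite (linZ (co_linear u)) scale_regularE /orb_coord co_rsh; ring.
by rewrite /orb_coord co_rsh co_lsh; ring.
Qed.

Lemma schur_comulP x u v :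
  tlift (fun a b => co a u * co b v : k^o) (schur_comul x) = co x (u ++ v).
Proof.
have lin : linear (fun m : {malg k[(word * word)%type]} => m@_(u, v) : k^o).
  by move=> c a b; rewrite mcoeffD mcoeffZ.
rewrite -mcoeff_tcomul -(xgetPex 0 (tcomulP x)) (tlift_comp _ _ lin).
by apply: eq_tlift => a b; rewrite mcoeff_pair.
Qed.

(** [schur_comul] is a chosen preimage, so linearity rests on uniqueness: [schur_comulP] determines
    all coordinates with respect to [frame_tens]. *)
Lemma schur_comul_linear : linear (@schur_comul k A).
Proof.
move=> c x y; apply: (frame_inj (frame_tens frame_schur frame_schur)) => -[u v] /=.
have bil : bilinear_map (fun a b => orb_coord u a * orb_coord v b : k^o).
  by split=> [b d a1 a2|a d b1 b2]; rewrite /orb_coord coE scale_regularE; ring.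
have E (a : S) : tlift (fun a b => orb_coord u a * orb_coord v b : k^o) (schur_comul a) =
    (u == rep u)%:R * (v == rep v)%:R * co a (u ++ v).
  rewrite -schur_comulP -scale_regularE -tlift_scalef; apply: eq_tlift => a1 a2.
  by rewrite /orb_coord scale_regularE; ring.
rewrite [RHS](tlift_linear bil) [LHS]E (E x) (E y) coE scale_regularE; ring.
Qed.

End SchurCoefficients.

Section SchurProduct.
Variables (k : fieldType) (A : salg) (s : salg_anti A) (inA : pred (letter A)).
Variable X : factorization s inA.
Notation L := (letter A).
Notation word := (seq L).
Notation S := (schur k A).
Implicit Types (x y : S) (u v w z : word).

Lemma wmul_sgn u v e w : wmul u v = Some (e, w) -> e = wsgn u v.
Proof.
elim: u v e w => [|a u IH] [|b v] e w //=; first by case.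
case: (lmul a b) => // c; case E: (wmul u v) => [[f z]|] // [<- _].
by rewrite (IH _ _ _ E).
Qed.

Lemma mem_wfac w u v : ((u, v) \in wfac (fac X) w) = (wmul u v == Some (wsgn u v, w)).
Proof.
elim: w u v => [|c w IH] u v /=.
  rewrite inE; apply/eqP/eqP; case: u v => [|a u] [|b v] //=.
  by case: (lmul a b) => [c|] //; case: (wmul u v) => [[e z]|].
apply/allpairsP/eqP.
  case=> -[[a b] [u' v']] /= [hp hq [-> ->]]; move: hp hq.
  by rewrite facP IH /= => /eqP-> /eqP->.
case: u v => [|a u] [|b v] //=.
case E: (lmul a b) => [c'|] //; case E': (wmul u v) => [[f z]|] // [h e e'].
exists ((a, b), (u, v)); split=> //=; first by rewrite facP /= E e.
by rewrite IH E' -(wmul_sgn E') e'.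
Qed.

Lemma wfac_uniq w : uniq (wfac (fac X) w).
Proof.
elim: w => //= c w IH; apply: allpairs_uniq => //; first exact: fac_uniq.
by move=> [[a b] [u v]] [[a' b'] [u' v']] _ _ /= [-> -> -> ->].
Qed.

Lemma mcoeff_wmulT u v w : (wmulT k u v)@_w =
  ((u, v) \in wfac (fac X) w)%:R * (-1) ^+ wsgn u v.
Proof.
rewrite mem_wfac /wmulT; case E: (wmul u v) => [[e z]|]; last by rewrite mcoeff0 mul0r.
rewrite (wmul_sgn E) mcoeffU; have [->|zw] := eqVneq z w.
  by rewrite eqxx mul1r.
by case: eqP => [[/eqP]|_]; rewrite ?(negPf zw) // mulr0n mul0r.
Qed.

Lemma co_mul x y w : co (schur_mul x y) w = conv (fac X) (co x) (co y) w.
Proof.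
pose G (p : word * word) := (-1) ^+ wsgn p.1 p.2 * (co x p.1 * co y p.2).
pose P := [seq (u, v) | u <- msupp (schur_val x), v <- msupp (schur_val y)].
pose W := wfac (fac X) w.
transitivity (\sum_(p <- P) (p \in W)%:R * G p : k^o).
  rewrite /co /= /tmul /lext raddf_sum big_allpairs_dep; apply: eq_bigr => u _ /=.
  rewrite mcoeffZ raddf_sum mulr_sumr /=; apply: eq_bigr => v _.
  rewrite mcoeffZ mcoeff_wmulT /G /=; rewrite -/(co x u) -/(co y v) -/W; ring.
have uP : uniq P by rewrite allpairs_uniq ?fset_uniq // => -[? ?] [? ?].
(* The sum over pairs of words in the supports and the sum over factorizations of [w] are both
   extended to the union; the added terms vanish. *)
transitivity (\sum_(p <- undup (P ++ W)) (p \in W)%:R * G p : k^o).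
  apply: esym; apply: (@big_subseq_uniq k k^o) => //; first exact: undup_uniq.
    by move=> p pP; rewrite mem_undup mem_cat pP.
  move=> [u v] nP; rewrite /G /=.
  have [->|xu] := eqVneq (co x u) 0; first by rewrite mul0r !mulr0.
  have [->|yv] := eqVneq (co y v) 0; first by rewrite !mulr0.
  case/negP: nP; apply/allpairsP; exists (u, v).
  by rewrite -!mcoeff_neq0.
rewrite (@big_subseq_uniq k k^o _ W) ?undup_uniq ?wfac_uniq //.
- by rewrite /conv !big_seq; apply: eq_bigr => p pW; rewrite pW mul1r.
- by move=> p pW; rewrite mem_undup mem_cat pW orbT.
by move=> p /negPf ->; rewrite mulr0n mul0r.
Qed.

Lemma schur_mul_linl y : linear (fun x => schur_mul x y).
Proof.
move=> c x x'; apply: schur_eqP => w; rewrite coE !co_mul -convZl -convDl.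
by apply: eq_conv => // z; rewrite coE.
Qed.

Lemma schur_mul_linr x : linear (schur_mul x).
Proof.
move=> c y y'; apply: schur_eqP => w; rewrite coE !co_mul -convZr -convDr.
by apply: eq_conv => // z; rewrite coE.
Qed.

Lemma co_par b x w : co (schur_par b x) w = (wpar w == b)%:R * co x w.
Proof.
by rewrite /co /= mcoeff_tproj; case: eqP; rewrite ?mul1r ?mul0r.
Qed.

Lemma schur_par_lin b : linear (@schur_par k A b).
Proof. by move=> c x y; apply: schur_eqP => w; rewrite coE !co_par coE; ring. Qed.

Lemma co_anti x w : co (schur_antimap s x) w = co x (wanti s w).
Proof. by rewrite /co /= mcoeff_tanti. Qed.

Lemma schur_antimap_lin : linear (@schur_antimap k A s).
Proof. by move=> c x y; apply: schur_eqP => w; rewrite coE !co_anti coE. Qed.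

Lemma co_hom d x w : co (schur_hom d x) w = (has_deg d w)%:R * co x w.
Proof. by rewrite /co /= mcoeff_tproj; case: ifP; rewrite ?mul1r ?mul0r. Qed.

End SchurProduct.

(** * The graded dual and its operations *)

Section GradedDual.
Variables (k : fieldType) (A : salg) (s : salg_anti A) (inA : pred (letter A)).
Variable X : factorization s inA.
Hypothesis fin_deg : forall d : deg A, exists l : seq (letter A),
  forall a, ldeg a = d -> a \in l.
Notation L := (letter A).
Notation word := (seq L).
Notation S := (schur k A).
Notation B := (schur_sbialg k s).
Implicit Types (x y : B) (u v w z : word) (f g h : gdual B).

Lemma evE c f g x : ev (c *: f + g) x = c * ev f x + ev g x.
Proof. by []. Qed.

Lemma ev_linl x : linear (fun f => ev f x : k^o).
Proof. by []. Qed.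

Lemma ev_linr f : linear (ev f : B -> k^o).
Proof. by case: f => f hf; have /asboolP[lf _] := hf. Qed.

Lemma evZ c f x : ev (c *: f) x = c * ev f x.
Proof. by []. Qed.

Lemma ev_sum (I : Type) (r : seq I) (F : I -> gdual B) x :
  ev (\sum_(i <- r) F i) x = \sum_(i <- r) ev (F i) x.
Proof. exact: (lin_sum (ev_linl x)). Qed.

Lemma gdual_eqP f g : (forall x, ev f x = ev g x) -> f = g.
Proof. by move=> e; apply: val_inj; apply: funext. Qed.

Lemma xi_subproof u : ((fun x : B => co (x : S) u) : B -> k^o) \in @gdual_pred k B.
Proof.
apply/asboolP; split; first exact: (@co_linear k A u).
exists [:: map ldeg u] => x hx.
have := hx _ (mem_head _ _); move/(congr1 (fun y : S => co y u)).
by rewrite /= co_hom /has_deg perm_refl mul1r => ->; rewrite /co mcoeff0.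
Qed.

Definition xi u : gdual B := GDual (xi_subproof u).

Lemma ev_xi u x : ev (xi u) x = co (x : S) u.
Proof. by []. Qed.

Lemma fin_word (d : seq (deg A)) : exists l : seq word,
  forall w, map ldeg w = d -> w \in l.
Proof.
elim: d => [|d ds [l hl]]; first by exists [:: [::]] => -[].
have [r hr] := fin_deg d; exists [seq a :: w | a <- r, w <- l] => -[|a w] //= [ad wd].
by apply/allpairsP; exists (a, w); split=> //=; [exact: hr|exact: hl].
Qed.

Lemma fin_has_deg (d : seq (deg A)) : exists l : seq word,
  forall w, has_deg d w -> w \in l.
Proof.
suff [l hl] : exists l : seq word, forall w, map ldeg w \in permutations d -> w \in l.
  by exists l => w hw; apply: hl; rewrite mem_permutations.
elim: (permutations d) => [|e r [l hl]]; first by exists [::].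
have [m hm] := fin_word e; exists (m ++ l) => w; rewrite inE mem_cat.
by case/orP=> [/eqP/hm->|/hl->]; rewrite ?orbT.
Qed.

Definition dual_coord u f : k := (u == rep u)%:R * ev f (orb k u).

(** A form in the graded dual sees finitely many multidegrees, and [fin_deg] leaves finitely many
    words in each; the orbit sums of all other words are killed. *)
Lemma gdual_fin f : exists2 r : seq word, uniq r & forall u, u \notin r -> dual_coord u f = 0.
Proof.
case: f => f hf; have /asboolP[lf [ds hds]] := hf.
have [l hl] : exists l : seq word, forall w, has (fun d => has_deg d w) ds -> w \in l.
  elim: ds {hds} => [|d ds [l hl]]; first by exists [::].
  have [m hm] := fin_has_deg d; exists (m ++ l) => w /=; rewrite mem_cat.
  by case/orP=> [/hm->|/hl->]; rewrite ?orbT.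
exists (undup l); first exact: undup_uniq.
move=> u; rewrite mem_undup /dual_coord => ul; rewrite [ev _ _]hds ?mulr0 // => d dds.
apply: (@schur_eqP k A) => w; rewrite co_hom co_orb [RHS]/co mcoeff0.
have [->|/rsgn_neq0 uw] := eqVneq (rsgn u w) 0; first by rewrite mulr0.
case: (boolP (has_deg d w)) => [dw|_]; last by rewrite mul0r.
case/negP: ul; apply: hl; apply/hasP; exists d => //.
by rewrite /has_deg (perm_trans _ dw) // perm_map.
Qed.

Lemma gdual_expand f (r : seq word) : uniq r -> (forall u, u \notin r -> dual_coord u f = 0) ->
  f = \sum_(u <- r) dual_coord u f *: xi u.
Proof.
move=> ur h; apply: gdual_eqP => x; rewrite (lin_sum (ev_linl x)) /=.
have [l0 ul0 [_ xl0]] := frame_fin (frame_schur k A) x.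
set l := undup (l0 ++ r).
have xl u : u \notin l -> orb_coord u (x : S) = 0.
  by move=> ul; apply: xl0; apply: contra ul; rewrite mem_undup mem_cat => ->.
rewrite {1}(schur_expand (undup_uniq _) xl : x = _) (lin_sum (ev_linr f)).
transitivity (\sum_(u <- l) dual_coord u f *: (co (x : S) u : k^o)).
  apply: eq_bigr => u _; rewrite [LHS](linZ (ev_linr f)) !scale_regularE.
  by rewrite /dual_coord /orb_coord; ring.
rewrite (big_subseq_uniq (r := r)) ?undup_uniq //.
- by move=> u uR; rewrite mem_undup mem_cat uR orbT.
- by move=> u /h ->; rewrite scale0r.
Qed.

Lemma frame_gdual : frame xi dual_coord.
Proof.
split=> [u c f g|f]; first by rewrite /dual_coord evE scale_regularE; ring.
have [r ur hr] := gdual_fin f; exists r => //; split=> //.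
exact: gdual_expand.
Qed.

End GradedDual.

Section DualOperations.
Variables (k : fieldType) (A : salg) (s : salg_anti A) (inA : pred (letter A)).
Variable X : factorization s inA.
Hypothesis fin_deg : forall d : deg A, exists l : seq (letter A),
  forall a, ldeg a = d -> a \in l.
Notation L := (letter A).
Notation word := (seq L).
Notation S := (schur k A).
Notation B := (schur_sbialg k s).
Notation xi := (@xi k A s).
Implicit Types (x y : B) (u v w z : word) (f g h : gdual B).

Let frD := frame_gdual k s fin_deg.

Lemma ev2D_bilinear x y : bilinear_map (fun f g => ev f x * ev g y : k^o).
Proof. by split=> [g c f1 f2|f c g1 g2]; rewrite evE scale_regularE /=; ring. Qed.

Lemma comul_xi u v x :
  tlift (fun x1 x2 => ev (xi u) x1 * ev (xi v) x2 : k^o) (sb_comul x) =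
  ev (xi (u ++ v)) x.
Proof. exact: schur_comulP. Qed.

(** The content is that an element with the prescribed pairings exists; on coefficient functionals
    it is given by concatenation. *)
Lemma gdual_mulP f g x : ev (gdual_mul f g) x =
  tlift (fun x1 x2 => ev f x1 * ev g x2 : k^o) (sb_comul x).
Proof.
suff h : exists h : gdual B, forall x, ev h x =
    tlift (fun x1 x2 => ev f x1 * ev g x2 : k^o) (sb_comul x).
  exact: (xgetPex 0 h).
have [r _ [fE _]] := frame_fin frD f; have [l _ [gE _]] := frame_fin frD g.
exists (\sum_(u <- r) \sum_(v <- l) (dual_coord u f * dual_coord v g) *: xi (u ++ v)) => y.
rewrite ev_sum.
rewrite (eq_tlift (g := fun x1 x2 => \sum_(u <- r) \sum_(v <- l)
  (dual_coord u f * dual_coord v g) *: (ev (xi u) x1 * ev (xi v) x2 : k^o))); last first.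
  move=> x1 x2; rewrite {1}fE {1}gE !ev_sum.
  rewrite mulr_suml; apply: eq_bigr => u _; rewrite mulr_sumr; apply: eq_bigr => v _.
  by rewrite !evZ scale_regularE; ring.
rewrite tlift_sumf; apply: eq_bigr => u _; rewrite ev_sum tlift_sumf.
by apply: eq_bigr => v _; rewrite evZ tlift_scalef comul_xi.
Qed.

Lemma gdual_mul_bilinear : bilinear_map (@gdual_mul k B).
Proof.
split=> [g c f f'|f c g g']; apply: gdual_eqP => x; rewrite evE !gdual_mulP.
  have := tlift_lin c (fun x1 x2 => ev f x1 * ev g x2 : k^o)
    (fun x1 x2 => ev f' x1 * ev g x2 : k^o) (sb_comul x).
  rewrite scale_regularE => <-.
  by apply: (@eq_tlift k B B k^o) => x1 x2; rewrite evE scale_regularE; ring.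
have := tlift_lin c (fun x1 x2 => ev f x1 * ev g x2 : k^o)
  (fun x1 x2 => ev f x1 * ev g' x2 : k^o) (sb_comul x).
rewrite scale_regularE => <-.
by apply: (@eq_tlift k B B k^o) => x1 x2; rewrite evE scale_regularE; ring.
Qed.

Lemma gdual_mul_xi u v : gdual_mul (xi u) (xi v) = xi (u ++ v).
Proof. by apply: gdual_eqP => x; rewrite gdual_mulP comul_xi. Qed.

Lemma gdual_parP b f x : ev (gdual_par b f) x = ev f (sb_par b x).
Proof.
suff h : exists h : gdual B, forall x, ev h x = ev f (sb_par b x).
  exact: (xgetPex 0 h).
have [r _ [fE _]] := frame_fin frD f.
exists (\sum_(u <- r) (dual_coord u f * (wpar u == b)%:R) *: xi u) => y.
rewrite [in RHS]fE !ev_sum; apply: eq_bigr => u _.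
by rewrite !evZ !ev_xi co_par mulrA.
Qed.

Lemma gdual_par_linear b : linear (@gdual_par k B b).
Proof. by move=> c f g; apply: gdual_eqP => x; rewrite evE !gdual_parP evE. Qed.

Lemma gdual_par_xi b u : gdual_par b (xi u) = (wpar u == b)%:R *: xi u.
Proof.
apply: gdual_eqP => x; by rewrite gdual_parP evZ !ev_xi co_par.
Qed.

(** The transpose of [co_mul], a candidate for the coproduct of [xi w]. *)
Definition comul_word w : tens (gdual B) (gdual B) :=
  \sum_(p <- wfac (fac X) w) (-1) ^+ wsgn p.1 p.2 *: pure (xi p.1) (xi p.2).

Lemma comul_wordP w x y : tlift (fun f1 f2 => ev f1 x * ev f2 y : k^o) (comul_word w) =
  ev (xi w) (sb_mul x y).
Proof.
rewrite (lin_sum (tlift_linear (ev2D_bilinear x y))) ev_xi (co_mul X).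
apply: eq_bigr => p _; rewrite (linZ (tlift_linear (ev2D_bilinear x y))).
by rewrite tlift_pure //; exact: ev2D_bilinear.
Qed.

Lemma gdual_comulP f x y : tlift (fun f1 f2 => ev f1 x * ev f2 y : k^o) (gdual_comul f) =
  ev f (sb_mul x y).
Proof.
suff h : exists t : tens (gdual B) (gdual B), forall x y,
    tlift (fun f1 f2 => ev f1 x * ev f2 y : k^o) t = ev f (sb_mul x y).
  exact: (xgetPex 0 h).
have [r _ [fE _]] := frame_fin frD f.
exists (\sum_(u <- r) dual_coord u f *: comul_word u) => x' y'.
rewrite (lin_sum (tlift_linear (ev2D_bilinear x' y'))).
rewrite [in RHS]fE ev_sum; apply: eq_bigr => u _.
by rewrite (linZ (tlift_linear (ev2D_bilinear x' y'))) comul_wordP evZ.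
Qed.

(** The coordinates are pairings with orbit sums. The coproduct is thus determined by its pairings,
    which gives its linearity and its value on [xi w]. *)
Lemma gdual_tens_inj (t t' : tens (gdual B) (gdual B)) :
  (forall x y, tlift (fun f1 f2 => ev f1 x * ev f2 y : k^o) t =
               tlift (fun f1 f2 => ev f1 x * ev f2 y : k^o) t') -> t = t'.
Proof.
move=> h; apply: (frame_inj (frame_tens frD frD)) => -[u v] /=.
have E (a : tens (gdual B) (gdual B)) :
    tlift (fun f g => dual_coord u f * dual_coord v g : k^o) a =
    ((u == rep u)%:R * (v == rep v)%:R) *:
    tlift (fun f1 f2 => ev f1 (orb k u : B) * ev f2 (orb k v : B) : k^o) a.
  by rewrite -tlift_scalef; apply: eq_tlift => f g; rewrite /dual_coord scale_regularE; ring.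
by rewrite !E h.
Qed.

Lemma gdual_comul_linear : linear (@gdual_comul k B).
Proof.
move=> c f g; apply: gdual_tens_inj => x y.
rewrite [RHS](tlift_linear (ev2D_bilinear x y)).
by rewrite !gdual_comulP evE.
Qed.

Lemma gdual_comul_xi w : gdual_comul (xi w) = comul_word w.
Proof. by apply: gdual_tens_inj => x y; rewrite gdual_comulP comul_wordP. Qed.

End DualOperations.

(** * The product of the double *)

Section LinearClosure.
Variables (k : fieldType).

Lemma lin_comp (V U W : lmodType k) (g : U -> W) (h : V -> U) :
  linear g -> linear h -> linear (fun z => g (h z)).
Proof. by move=> lg lh c x y; rewrite lh lg. Qed.

Lemma lin_big (V W : lmodType k) (I : Type) (r : seq I) (F : I -> V -> W) :
  (forall i, linear (F i)) -> linear (fun z => \sum_(i <- r) F i z).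
Proof.
move=> h c x y; rewrite scaler_sumr -big_split; apply: eq_bigr => i _; exact: h.
Qed.

Lemma lin_tlift (V U W Y : lmodType k) (F : V -> U -> W -> Y) (t : tens U W) :
  (forall u w, linear (fun z => F z u w)) -> linear (fun z => tlift (F z) t).
Proof. by move=> h c x y; rewrite -tlift_lin; apply: eq_tlift => u w; exact: h. Qed.

Lemma lin_scalel (V W : lmodType k) (g : V -> k^o) (w : W) :
  linear g -> linear (fun z => (g z : k) *: w).
Proof. by move=> lg c x y; rewrite lg scalerDl scalerA. Qed.

Lemma lin_scaler (V W : lmodType k) (d : k) (h : V -> W) :
  linear h -> linear (fun z => d *: h z).
Proof. by move=> lh c x y; rewrite lh scalerDr !scalerA mulrC. Qed.

Lemma lin_times (V : lmodType k) (d : k) (h : V -> k^o) :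
  linear h -> linear (fun z => d * h z : k^o).
Proof. by move=> lh c x y; rewrite lh !scale_regularE mulrDr mulrCA. Qed.

Lemma lin_timesr (V : lmodType k) (d : k) (h : V -> k^o) :
  linear h -> linear (fun z => h z * d : k^o).
Proof. by move=> lh c x y; rewrite lh !scale_regularE mulrDl mulrA. Qed.

Lemma bool_sum1 (V : lmodType k) (b : bool) (F : bool -> V) :
  \sum_(i : bool) (b == i)%:R *: F i = F b.
Proof.
have e (c d : bool) (x : V) : (c == d)%:R *: x = if c == d then x else 0.
  by case: eqP; rewrite ?scale1r ?scale0r.
by rewrite big_bool /= !e; case: b; rewrite ?addr0 ?add0r.
Qed.

End LinearClosure.

Section DoubleProduct.
Variables (k : fieldType) (A : salg) (s : salg_anti A) (inA : pred (letter A)).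
Variable X : factorization s inA.
Hypothesis fin_deg : forall d : deg A, exists l : seq (letter A),
  forall a, ldeg a = d -> a \in l.
Notation L := (letter A).
Notation word := (seq L).
Notation S := (schur k A).
Notation B := (schur_sbialg k s).
Notation xi := (@xi k A s).
Implicit Types (a b : B) (u v w : word) (al be : gdual B).

Let com_lin : linear (@sb_comul k B) := @schur_comul_linear k A.
Let par_lin p : linear (@sb_par k B p) := @schur_par_lin k A p.
Let anti_lin : linear (@sb_anti k B) := @schur_antimap_lin k A s.
Let mull (y : B) : linear (fun x : B => sb_mul x y) := schur_mul_linl X y.
Let mulr (x : B) : linear (sb_mul x : B -> B) := schur_mul_linr X x.
Let gmul := gdual_mul_bilinear k s fin_deg.
Let gpar_lin := @gdual_par_linear k A s fin_deg.
Let gcom_lin := @gdual_comul_linear k A s inA X fin_deg.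
Let pure_lin := @pure_bilinear k B (gdual B).

(** The innermost summand of [double_mul_pure], isolated in order to prove linearity in each of its
    eight arguments, from which the bilinearity of the product follows. *)
Definition dterm (i j : bool) (a1 a2 b1 b2 : B) (al1 al2 be1 be2 : gdual B) : double B :=
  \sum_(p : bool) \sum_(q : bool) \sum_(r : bool) \sum_(t : bool)
      ((-1) ^+ (p * (q + r) + r * i + t * j)%N
        * ev be1 (sb_anti (sb_par p a1)) * ev al2 (sb_anti b2)) *:
      pure (sb_mul (sb_par q a2) (sb_par r b1))
           (gdual_mul be2 (gdual_par t al1)).

Lemma double_mul_pureE a al b be : double_mul_pure a al b be =
  \sum_(i : bool) \sum_(j : bool)
  tlift (fun a1 a2 => tlift (fun b1 b2 => tlift (fun al1 al2 =>
    tlift (dterm i j a1 a2 b1 b2 al1 al2)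
  (gdual_comul (gdual_par j be))) (gdual_comul (gdual_par i al)))
  (sb_comul b)) (sb_comul a).
Proof. by []. Qed.

Let dterm_be1 i j a1 a2 b1 b2 al1 al2 be2 :
  linear (fun z => dterm i j a1 a2 b1 b2 al1 al2 z be2).
Proof.
do 4 (apply: lin_big => ?); apply: lin_scalel; apply: lin_timesr; apply: lin_times.
exact: ev_linl.
Qed.

Let dterm_be2 i j a1 a2 b1 b2 al1 al2 be1 :
  linear (dterm i j a1 a2 b1 b2 al1 al2 be1).
Proof.
do 4 (apply: lin_big => ?); apply: lin_scaler; apply: lin_comp.
  exact: (proj2 pure_lin).
exact: (proj1 gmul).
Qed.

Let dterm_al1 i j a1 a2 b1 b2 al2 be1 be2 :
  linear (fun z => dterm i j a1 a2 b1 b2 z al2 be1 be2).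
Proof.
do 4 (apply: lin_big => ?); apply: lin_scaler; apply: lin_comp.
  exact: (proj2 pure_lin).
apply: lin_comp; first exact: (proj2 gmul).
exact: gpar_lin.
Qed.

Let dterm_al2 i j a1 a2 b1 b2 al1 be1 be2 :
  linear (fun z => dterm i j a1 a2 b1 b2 al1 z be1 be2).
Proof.
do 4 (apply: lin_big => ?); apply: lin_scalel.
by apply: (@lin_times k (gdual B) _ (fun z => ev z _)); exact: ev_linl.
Qed.

Let dterm_b1 i j a1 a2 b2 al1 al2 be1 be2 :
  linear (fun z => dterm i j a1 a2 z b2 al1 al2 be1 be2).
Proof.
do 4 (apply: lin_big => ?); apply: lin_scaler.
apply: (@lin_comp k B B (double B) (fun y => pure y _)); first exact: (proj1 pure_lin).
apply: lin_comp; first exact: mulr.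
exact: par_lin.
Qed.

Let dterm_b2 i j a1 a2 b1 al1 al2 be1 be2 :
  linear (fun z => dterm i j a1 a2 b1 z al1 al2 be1 be2).
Proof.
do 4 (apply: lin_big => ?); apply: lin_scalel.
apply: (@lin_times k B _ (fun z => ev _ (sb_anti z))).
apply: lin_comp; first exact: ev_linr.
exact: anti_lin.
Qed.

Let dterm_a1 i j a2 b1 b2 al1 al2 be1 be2 :
  linear (fun z => dterm i j z a2 b1 b2 al1 al2 be1 be2).
Proof.
do 4 (apply: lin_big => ?); apply: lin_scalel; apply: lin_timesr; apply: lin_times.
apply: lin_comp; first exact: ev_linr.
apply: lin_comp; first exact: anti_lin.
exact: par_lin.
Qed.

Let dterm_a2 i j a1 b1 b2 al1 al2 be1 be2 :
  linear (fun z => dterm i j a1 z b1 b2 al1 al2 be1 be2).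
Proof.
do 4 (apply: lin_big => ?); apply: lin_scaler.
apply: (@lin_comp k B B (double B) (fun y => pure y _)); first exact: (proj1 pure_lin).
apply: (@lin_comp k B B B (fun y => sb_mul y _)); first exact: mull.
exact: par_lin.
Qed.

Let bil_be i j a1 a2 b1 b2 al1 al2 : bilinear_map (dterm i j a1 a2 b1 b2 al1 al2).
Proof. by split=> z; [exact: dterm_be1|exact: dterm_be2]. Qed.

Let bil_al i j a1 a2 b1 b2 t :
  bilinear_map (fun al1 al2 => tlift (dterm i j a1 a2 b1 b2 al1 al2) t).
Proof.
by split=> z; apply: lin_tlift => x y; [exact: dterm_al1|exact: dterm_al2].
Qed.

Let bil_b i j a1 a2 t t' :
  bilinear_map (fun b1 b2 => tlift (fun al1 al2 =>
    tlift (dterm i j a1 a2 b1 b2 al1 al2) t) t').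
Proof.
by split=> z; apply: lin_tlift => x y; apply: lin_tlift => x' y';
  [exact: dterm_b1|exact: dterm_b2].
Qed.

Let bil_a i j t t' t'' :
  bilinear_map (fun a1 a2 => tlift (fun b1 b2 => tlift (fun al1 al2 =>
    tlift (dterm i j a1 a2 b1 b2 al1 al2) t) t') t'').
Proof.
by split=> z; apply: lin_tlift => x y; apply: lin_tlift => x' y';
  apply: lin_tlift => x'' y''; [exact: dterm_a1|exact: dterm_a2].
Qed.

Lemma double_mul_pure_be a al b : linear (double_mul_pure a al b).
Proof.
do 2 (apply: lin_big => ?); do 3 (apply: lin_tlift => ? ?).
apply: lin_comp; first exact: tlift_linear (bil_be _ _ _ _ _ _ _ _).
by apply: lin_comp; [exact: gcom_lin|exact: gpar_lin].
Qed.

Lemma double_mul_pure_al a b be : linear (fun al => double_mul_pure a al b be).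
Proof.
do 2 (apply: lin_big => ?); do 2 (apply: lin_tlift => ? ?).
apply: lin_comp; first exact: tlift_linear (bil_al _ _ _ _ _ _ _).
by apply: lin_comp; [exact: gcom_lin|exact: gpar_lin].
Qed.

Lemma double_mul_pure_b a al be : linear (fun b => double_mul_pure a al b be).
Proof.
do 2 (apply: lin_big => ?); apply: lin_tlift => ? ?.
apply: lin_comp; first exact: tlift_linear (bil_b _ _ _ _ _ _).
exact: com_lin.
Qed.

Lemma double_mul_pure_a al b be : linear (fun a => double_mul_pure a al b be).
Proof.
do 2 (apply: lin_big => ?).
apply: lin_comp; first exact: tlift_linear (bil_a _ _ _ _ _).
exact: com_lin.
Qed.

Let bil_r a al : bilinear_map (fun b be => double_mul_pure a al b be).
Proof. by split=> z; [exact: double_mul_pure_b|exact: double_mul_pure_be]. Qed.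

Let bil_l (y : double B) :
  bilinear_map (fun a al => tlift (fun b be => double_mul_pure a al b be) y).
Proof.
by split=> z; apply: lin_tlift => ? ?; [exact: double_mul_pure_a|exact: double_mul_pure_al].
Qed.

Lemma double_mul_linl (y : double B) : linear (fun x => double_mul x y).
Proof. exact: tlift_linear (bil_l y). Qed.

Lemma double_mul_linr (x : double B) : linear (double_mul x).
Proof.
apply: lin_tlift => a al; exact: tlift_linear (bil_r a al).
Qed.

Lemma double_mul_pures a al b be :
  double_mul (pure a al) (pure b be) = double_mul_pure a al b be.
Proof.
by rewrite /double_mul (tlift_pure _ _ (bil_l _)) (tlift_pure _ _ (bil_r a al)).
Qed.

Lemma lsh_comul (Y : lmodType k) (G : B -> Y) z a : linear G ->
  tlift (fun a1 a2 : B => co (a1 : S) z *: G a2) (sb_comul a) = G (lsh z (a : S)).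
Proof.
move=> lG; transitivity (G (tlift (fun a1 a2 : B => co (a1 : S) z *: a2) (sb_comul a))).
  by rewrite (tlift_comp _ _ lG); apply: eq_tlift => a1 a2; rewrite (linZ lG).
congr G; apply: (@schur_eqP k A) => w; rewrite co_lsh -schur_comulP.
rewrite (tlift_comp _ _ (@co_linear k A w)); apply: (@eq_tlift k B B k^o) => a1 a2.
by rewrite (linZ (@co_linear k A w)).
Qed.

Lemma rsh_comul (Y : lmodType k) (G : B -> Y) z a : linear G ->
  tlift (fun a1 a2 : B => co (a2 : S) z *: G a1) (sb_comul a) = G (rsh z (a : S)).
Proof.
move=> lG; transitivity (G (tlift (fun a1 a2 : B => co (a2 : S) z *: a1) (sb_comul a))).
  by rewrite (tlift_comp _ _ lG); apply: eq_tlift => a1 a2; rewrite (linZ lG).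
congr G; apply: (@schur_eqP k A) => w; rewrite co_rsh -schur_comulP.
rewrite (tlift_comp _ _ (@co_linear k A w)); apply: (@eq_tlift k B B k^o) => a1 a2.
by rewrite (linZ (@co_linear k A w)) scale_regularE mulrC.
Qed.

Let dterm_comul i j a1 a2 b1 b2 u v :
  tlift (fun al1 al2 => tlift (dterm i j a1 a2 b1 b2 al1 al2)
    (gdual_comul (gdual_par j (xi u)))) (gdual_comul (gdual_par i (xi v))) =
  (wpar v == i)%:R *: ((wpar u == j)%:R *:
    \sum_(r <- wfac (fac X) v) \sum_(q <- wfac (fac X) u)
      (-1) ^+ (wsgn r.1 r.2 (+) wsgn q.1 q.2) *:
      dterm i j a1 a2 b1 b2 (xi r.1) (xi r.2) (xi q.1) (xi q.2)).
Proof.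
rewrite (gdual_par_xi k s fin_deg i v) (linZ gcom_lin) (gdual_comul_xi k X fin_deg v).
rewrite (linZ (tlift_linear (bil_al _ _ _ _ _ _ _))); congr (_ *: _).
rewrite /comul_word (lin_sum (tlift_linear (bil_al _ _ _ _ _ _ _))) scaler_sumr.
apply: eq_bigr => r _; rewrite (linZ (tlift_linear (bil_al _ _ _ _ _ _ _))).
rewrite (tlift_pure _ _ (bil_al _ _ _ _ _ _ _)).
rewrite (gdual_par_xi k s fin_deg j u) (linZ gcom_lin) (gdual_comul_xi k X fin_deg u).
have lb := tlift_linear (bil_be i j a1 a2 b1 b2 (xi r.1) (xi r.2)).
rewrite (linZ lb) scalerA mulrC -scalerA; congr (_ *: _).
rewrite /comul_word (lin_sum lb) scaler_sumr; apply: eq_bigr => q _.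
rewrite (linZ lb) tlift_pure; last exact: bil_be.
by rewrite scalerA signr_addb.
Qed.

(** The coproducts of [xi v] and [xi u] run over factorizations [r] and [q]. The pairings evaluate
    one factor of the comultiplication of [a] at [wanti s q.1] and one of [b] at [wanti s r.2],
    which leaves shifts of [a] and [b]. *)
Lemma double_mul_words a b u v : double_mul_pure a (xi v) b (xi u) =
  \sum_(r <- wfac (fac X) v) \sum_(q <- wfac (fac X) u) \sum_(i : bool) \sum_(j : bool)
  (-1) ^+ (wsgn r.1 r.2 (+) wsgn q.1 q.2 (+) (wpar q.1 && (i (+) j)) (+)
           (j && wpar v) (+) (wpar r.1 && wpar u)) *:
  pure (sb_mul (sb_par i (lsh (wanti s q.1) (a : S) : B))
               (sb_par j (rsh (wanti s r.2) (b : S) : B))) (xi (q.2 ++ r.1)).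
Proof.
rewrite double_mul_pureE.
transitivity (\sum_(i : bool) (wpar v == i)%:R *: \sum_(j : bool) (wpar u == j)%:R *:
  \sum_(r <- wfac (fac X) v) \sum_(q <- wfac (fac X) u)
      (-1) ^+ (wsgn r.1 r.2 (+) wsgn q.1 q.2) *:
    tlift (fun a1 a2 => tlift (fun b1 b2 =>
      dterm i j a1 a2 b1 b2 (xi r.1) (xi r.2) (xi q.1) (xi q.2))
    (sb_comul b)) (sb_comul a)).
  apply: eq_bigr => i _; rewrite scaler_sumr; apply: eq_bigr => j _.
  transitivity (tlift (fun a1 a2 => (wpar v == i)%:R *: ((wpar u == j)%:R *:
    \sum_(r <- wfac (fac X) v) \sum_(q <- wfac (fac X) u)
      (-1) ^+ (wsgn r.1 r.2 (+) wsgn q.1 q.2) *: tlift (fun b1 b2 =>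
      dterm i j a1 a2 b1 b2 (xi r.1) (xi r.2) (xi q.1) (xi q.2)) (sb_comul b)))
    (sb_comul a)); last first.
    rewrite !tlift_scalef tlift_sumf; congr (_ *: (_ *: _)); apply: eq_bigr => r _.
    by rewrite tlift_sumf; apply: eq_bigr => q _; rewrite tlift_scalef.
  apply: eq_tlift => a1 a2.
  rewrite (eq_tlift _ (fun b1 b2 => dterm_comul i j a1 a2 b1 b2 u v)).
  rewrite !tlift_scalef tlift_sumf; congr (_ *: (_ *: _)); apply: eq_bigr => r _.
  by rewrite tlift_sumf; apply: eq_bigr => q _; rewrite tlift_scalef.
(* Coefficient functionals are homogeneous, so the sums over the parities of the two forms reduce to
   one term each. *)
rewrite bool_sum1 bool_sum1; apply: eq_bigr => r _; apply: eq_bigr => q _.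
set z1 := wanti s q.1; set z2 := wanti s r.2.
have dE a1 a2 b1 b2 :
    dterm (wpar v) (wpar u) a1 a2 b1 b2 (xi r.1) (xi r.2) (xi q.1) (xi q.2) =
    \sum_(i : bool) \sum_(j : bool)
      (-1) ^+ ((wpar q.1 && (i (+) j)) (+) (j && wpar v) (+) (wpar r.1 && wpar u)) *:
      (co (a1 : S) z1 *: (co (b2 : S) z2 *:
        pure (sb_mul (sb_par i a2) (sb_par j b1)) (xi (q.2 ++ r.1)))).
  transitivity (\sum_(p : bool) (wpar q.1 == p)%:R *: \sum_(i : bool) \sum_(j : bool)
    \sum_(t : bool) (wpar r.1 == t)%:R *: (
      (-1) ^+ ((p && (i (+) j)) (+) (j && wpar v) (+) (t && wpar u)) *:
      (co (a1 : S) z1 *: (co (b2 : S) z2 *: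
        pure (sb_mul (sb_par i a2) (sb_par j b1)) (xi (q.2 ++ r.1)))))).
    apply: eq_bigr => p _; rewrite scaler_sumr; apply: eq_bigr => i _.
    rewrite scaler_sumr; apply: eq_bigr => j _.
    rewrite scaler_sumr; apply: eq_bigr => t _.
    rewrite gdual_par_xi // (linZ (proj2 gmul (xi q.2))) gdual_mul_xi //.
    rewrite pureZr !scalerA; congr (_ *: _).
    rewrite !ev_xi co_anti co_anti co_par wpar_wanti -/z1 -/z2.
    rewrite -signr_odd !oddD !oddM !oddb oddD !oddb; ring.
  rewrite bool_sum1; apply: eq_bigr => i _; apply: eq_bigr => j _.
  by rewrite bool_sum1.
rewrite (eq_tlift (g := fun a1 a2 => \sum_(i : bool) \sum_(j : bool)
      (-1) ^+ ((wpar q.1 && (i (+) j)) (+) (j && wpar v) (+) (wpar r.1 && wpar u)) *: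
      (co (a1 : S) z1 *: pure (sb_mul (sb_par i a2) (sb_par j (rsh z2 (b : S) : B)))
        (xi (q.2 ++ r.1))))); last first.
  move=> a1 a2; rewrite (eq_tlift _ (dE a1 a2)) tlift_sumf; apply: eq_bigr => i _.
  rewrite tlift_sumf; apply: eq_bigr => j _; rewrite !tlift_scalef.
  congr (_ *: (_ *: _)).
  apply: (rsh_comul (G := fun b1 =>
    pure (sb_mul (sb_par i a2) (sb_par j b1)) (xi (q.2 ++ r.1)))).
  apply: (@lin_comp k B B (double B) (fun y => pure y _)).
    exact: (proj1 pure_lin).
  by apply: lin_comp; [exact: mulr|exact: par_lin].
rewrite tlift_sumf scaler_sumr; apply: eq_bigr => i _.
rewrite tlift_sumf scaler_sumr; apply: eq_bigr => j _.
rewrite tlift_scalef scalerA -signr_addb !addbA; congr (_ *: _).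
apply: (lsh_comul (G := fun a2 =>
  pure (sb_mul (sb_par i a2) (sb_par j (rsh z2 (b : S) : B))) (xi (q.2 ++ r.1)))).
apply: (@lin_comp k B B (double B) (fun y => pure y _)).
  exact: (proj1 pure_lin).
by apply: (@lin_comp k B B B (fun y => sb_mul y _)); [exact: mull|exact: par_lin].
Qed.

End DoubleProduct.

Section DoubleBasis.
Variables (k : fieldType) (A : salg) (s : salg_anti A) (inA : pred (letter A)).
Variable X : factorization s inA.
Hypothesis fin_deg : forall d : deg A, exists l : seq (letter A),
  forall a, ldeg a = d -> a \in l.
Notation L := (letter A).
Notation word := (seq L).
Notation S := (schur k A).
Notation B := (schur_sbialg k s).
Notation xi := (@xi k A s).
Notation inw := (filter inA).
Notation outw := (filter (predC inA)).
Implicit Types (x y : B) (u v w P : word) (f g : gdual B) (t : double B).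

(** The sign makes the coefficient function equal to [rsgn P] for unsorted [P] too; relabelling a
    sorted word by [phi] may unsort it, as letters change side. *)
Definition double_basis P : double B :=
  (-1) ^+ unshuf_sgn inA P *: pure (orb k (inw P) : B) (xi (outw P)).

Definition double_coeff w t : k := (-1) ^+ unshuf_sgn inA w *
  tlift (fun x f => co (x : S) (inw w) * ev f (orb k (outw w) : B) : k^o) t.

Lemma double_coeff_bilinear w : bilinear_map
  (fun (x : B) (f : gdual B) => co (x : S) (inw w) * ev f (orb k (outw w) : B) : k^o).
Proof. by split=> [f c x1 x2|x c f1 f2]; rewrite ?coE ?evE scale_regularE; ring. Qed.

Lemma double_coeff_linear w : linear (double_coeff w : double B -> k^o).
Proof. exact: lin_times (tlift_linear (double_coeff_bilinear w)). Qed.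

Lemma double_coeff_pure w x f : double_coeff w (pure x f) =
  (-1) ^+ unshuf_sgn inA w * (co (x : S) (inw w) * ev f (orb k (outw w) : B)).
Proof. by rewrite /double_coeff (tlift_pure _ _ (double_coeff_bilinear w)). Qed.

Lemma double_coeff_basis w P : double_coeff w (double_basis P) = (rsgn P w)%:~R.
Proof.
rewrite /double_basis (linZ (double_coeff_linear w)) double_coeff_pure ev_xi !co_orb.
rewrite (rsgn_ext inA P w) /ext.
by rewrite (rsgnC (outw w)) !rmorphM /= !rmorph_sign.
Qed.

Lemma double_coeff_mul_basis w P P' :
  double_coeff w (double_mul (double_basis P) (double_basis P')) = (dconst X P P' w)%:~R.
Proof.
rewrite /double_basis (linZ (double_mul_linl X fin_deg _)) (linZ (double_mul_linr X fin_deg _)).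
rewrite (double_mul_pures X fin_deg) !(linZ (double_coeff_linear w)) (double_mul_words X fin_deg).
rewrite (lin_sum (double_coeff_linear w)) /dconst /dprod rmorphM rmorph_sign rmorph_sum.
rewrite /= !scale_regularE mulrA !mulr_sumr; apply: eq_bigr => r _.
rewrite (lin_sum (double_coeff_linear w)) rmorph_sum /= !mulr_sumr; apply: eq_bigr => q _.
rewrite (lin_sum (double_coeff_linear w)) rmorph_sum /= !mulr_sumr.
transitivity (\sum_(i : bool) \sum_(j : bool) \sum_(p <- wfac (fac X) (inw w))
  (wpar p.1 == i)%:R *: ((wpar p.2 == j)%:R *:
  ((-1) ^+ (unshuf_sgn inA P (+) unshuf_sgn inA P' (+) unshuf_sgn inA w) *
   (-1) ^+ (wsgn r.1 r.2 (+) wsgn q.1 q.2 (+) wsgn p.1 p.2 (+)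
    (wpar q.1 && (i (+) j)) (+) (j && wpar (outw P)) (+)
    (wpar r.1 && wpar (outw P'))) *
   ((rsgn (inw P) (wanti s q.1 ++ p.1))%:~R *
    (rsgn (inw P') (p.2 ++ wanti s r.2))%:~R * (rsgn (q.2 ++ r.1) (outw w))%:~R) : k^o))).
  apply: eq_bigr => i _; rewrite (lin_sum (double_coeff_linear w)) mulr_sumr.
  apply: eq_bigr => j _; rewrite (linZ (double_coeff_linear w)) double_coeff_pure ev_xi scale_regularE.
  rewrite (co_mul X) co_orb rsgnC /conv mulr_suml !mulr_sumr.
  apply: eq_bigr => p _; rewrite !co_par co_lsh co_rsh !co_orb !scale_regularE.
  by rewrite !signr_addb; ring.
rewrite exchange_big; under eq_bigr => j _ do rewrite exchange_big.
rewrite exchange_big; apply: eq_bigr => p _ /=.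
rewrite exchange_big.
under eq_bigr => i _ do rewrite -scaler_sumr bool_sum1.
by rewrite bool_sum1 !rmorphM /= !rmorph_sign !mulrA.
Qed.

Definition in_sub x := forall w, ~~ all inA w -> co (x : S) w = 0.
Definition in_dual f := forall x : B,
  (forall w, all (predC inA) w -> co (x : S) w = 0) -> ev f x = 0.

Definition summand t := exists r : seq (B * gdual B),
  (forall p, p \in r -> in_sub p.1 /\ in_dual p.2) /\
  t = \sum_(p <- r) pure p.1 p.2.

Lemma summand_pure x f : in_sub x -> in_dual f -> summand (pure x f).
Proof.
move=> hx hf; exists [:: (x, f)]; rewrite big_seq1; split=> // p.
by rewrite inE => /eqP->.
Qed.

Lemma summand_sum (I : eqType) (r : seq I) (F : I -> double B) :
  (forall i, i \in r -> summand (F i)) -> summand (\sum_(i <- r) F i).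
Proof.
elim: r => [|i r IH] h; first by exists [::]; rewrite !big_nil.
rewrite big_cons; have [|l1 [h1 ->]] := h i; first exact: mem_head.
have [|l2 [h2 ->]] := IH; first by move=> j jr; apply: h; rewrite inE jr orbT.
exists (l1 ++ l2); rewrite big_cat; split=> // p.
by rewrite mem_cat => /orP[/h1|/h2].
Qed.

Lemma in_subZ c x : in_sub x -> in_sub (c *: x).
Proof. by move=> h w hw; rewrite (linZ (@co_linear k A w)) scale_regularE h ?mulr0. Qed.

Lemma summandZ c t : summand t -> summand (c *: t).
Proof.
move=> [r [hr ->]]; rewrite scaler_sumr big_seq; rewrite -big_seq.
apply: summand_sum => p pr; have [h1 h2] := hr p pr.
by rewrite -pureZl; apply: summand_pure => //; exact: in_subZ.
Qed.

Lemma in_sub_orb u : all inA u -> in_sub (orb k u).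
Proof.
move=> uA w wA; rewrite co_orb; have [->//|/rsgn_neq0 p] := eqVneq (rsgn u w) 0.
by rewrite -(perm_all _ p) uA in wA.
Qed.

Lemma in_dual_xi u : all (predC inA) u -> in_dual (xi u).
Proof. by move=> uA x h; rewrite ev_xi h. Qed.

Lemma summand_basis P : summand (double_basis P).
Proof.
apply: summandZ; apply: summand_pure; first exact/in_sub_orb/filter_all.
exact/in_dual_xi/filter_all.
Qed.

Lemma double_basis_cat u v : all inA u -> all (predC inA) v ->
  double_basis (u ++ v) = pure (orb k u : B) (xi v).
Proof.
move=> uA vA; rewrite /double_basis unshuf_sgn_cat // scale1r !filter_cat.
have -> : inw u = u by exact/all_filterP.
have -> : outw v = v by exact/all_filterP.
have -> : inw v = [::].
  by apply/eqP; rewrite -[_ == _]negbK -has_filter -all_predC vA.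
have -> : outw u = [::].
  apply/eqP; rewrite -[_ == _]negbK -has_filter -all_predC.
  by rewrite (eq_all (a2 := inA)) ?uA // => x /=; rewrite negbK.
by rewrite cats0.
Qed.

Lemma orb_coord_sub u x : in_sub x -> ~~ all inA u -> orb_coord u (x : S) = 0.
Proof. by move=> h /h; rewrite /orb_coord => ->; rewrite mulr0. Qed.

Lemma dual_coord_in_dual v f : in_dual f -> ~~ all (predC inA) v -> dual_coord v f = 0.
Proof.
move=> h vA; rewrite /dual_coord h ?mulr0 // => w wA; rewrite co_orb.
have [->//|/rsgn_neq0 p] := eqVneq (rsgn v w) 0.
by rewrite (perm_all _ p) wA in vA.
Qed.

Let fr := frame_tens (frame_schur k A) (frame_gdual k s fin_deg).

Lemma coord_summand t u v : summand t -> ~~ (all inA u && all (predC inA) v) ->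
  tlift (fun (x : S) f => orb_coord u x * dual_coord v f : k^o) t = 0.
Proof.
move=> [r [hr ->]] uv.
have lin := frame_lin fr (u, v); rewrite /= in lin.
rewrite (lin_sum lin) big_seq big1 // => p /hr[h1 h2].
rewrite tlift_pure; last by split=> [g c x1 x2|x c f1 f2];
  rewrite /orb_coord /dual_coord ?coE ?evE scale_regularE; ring.
move: uv; rewrite negb_and => /orP[] nA.
  by rewrite orb_coord_sub // mul0r.
by rewrite dual_coord_in_dual // mulr0.
Qed.

Lemma summand_span t : summand t ->
  exists l : seq (k * word), t = \sum_(p <- l) p.1 *: double_basis p.2.
Proof.
move=> ht; have [r _ [{2}-> _]] := frame_fin fr t.
exists [seq (tlift (fun (x : S) f => orb_coord p.1 x * dual_coord p.2 f : k^o) t : k,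
             p.1 ++ p.2) | p <- r].
rewrite big_map; apply: eq_bigr => -[u v] _ /=.
case: (boolP (all inA u && all (predC inA) v)) => [/andP[uA vA]|uv].
  by rewrite double_basis_cat.
by rewrite coord_summand // !scale0r.
Qed.

(** Up to a factor from [rep], the coefficient at the sorted word [u ++ v] is the coordinate at
    [(u, v)]; all other coordinates vanish on the summand. *)
Lemma summand_inj t t' : summand t -> summand t' ->
  (forall w, double_coeff w t = double_coeff w t') -> t = t'.
Proof.
move=> ht ht' h; apply: (frame_inj fr) => -[u v] /=.
case: (boolP (all inA u && all (predC inA) v)) => [/andP[uA vA]|uv]; last first.
  by rewrite !coord_summand.
have fu : inw (u ++ v) = u.
  rewrite filter_cat; have -> : inw u = u by exact/all_filterP.
  have -> : inw v = [::] by apply/eqP; rewrite -[_ == _]negbK -has_filter -all_predC vA.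
  by rewrite cats0.
have fv : outw (u ++ v) = v.
  rewrite filter_cat; have -> : outw v = v by exact/all_filterP.
  have -> // : outw u = [::].
  apply/eqP; rewrite -[_ == _]negbK -has_filter -all_predC.
  by rewrite (eq_all (a2 := inA)) ?uA // => x /=; rewrite negbK.
have E (a : double B) : tlift (fun (x : S) f => orb_coord u x * dual_coord v f : k^o) a =
    ((u == rep u)%:R * (v == rep v)%:R) * double_coeff (u ++ v) a.
  rewrite /double_coeff unshuf_sgn_cat // mul1r -scale_regularE -tlift_scalef fu fv.
  by apply: (@eq_tlift k B (gdual B) k^o) => x f; rewrite /orb_coord /dual_coord scale_regularE; ring.
by rewrite !E h.
Qed.

Lemma in_sub_mul x y : in_sub x -> in_sub y -> in_sub (sb_mul x y).
Proof.
move=> hx hy w wA; rewrite (co_mul X) /conv big_seq big1 // => -[u v] /= h.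
suff : ~~ all inA u \/ ~~ all inA v.
  by case=> [/hx->|/hy->]; rewrite ?(mul0r, mulr0).
apply/orP; apply: contraNT wA; rewrite negb_or !negbK => /andP[].
elim: w u v h => //= c w IH u v /allpairsP[[p q] /= [hp hq [-> ->]]] /=.
move=> /andP[pA qA] /andP[_ qA']; rewrite (IH q.1 q.2) -?surjective_pairing // andbT.
by move: hp; rewrite facP => /eqP/(inA_mul X)[<- _].
Qed.

Lemma wfac_out u p : all (predC inA) u -> p \in wfac (fac X) u ->
  all (predC inA) p.1 && all (predC inA) p.2.
Proof.
elim: u p => [|c u IH] p /=; first by rewrite inE => _ /eqP->.
move=> /andP[cA uA] /allpairsP[[a q] /= [ha hq ->]].
have /andP[e1 e2] := IH q uA hq.
move: ha; rewrite facP => /eqP/(inA_mul X)[a1 a2].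
by rewrite /= a1 a2 cA e1 e2.
Qed.

Lemma in_sub_par i x : in_sub x -> in_sub (sb_par i x).
Proof. by move=> h w wA; rewrite co_par h ?mulr0. Qed.

(** Shifts, parity projections and products preserve elements supported on words in [inA], and the
    factors of a word outside [inA] stay outside. *)
Lemma summand_mul_basis P P' : summand (double_mul (double_basis P) (double_basis P')).
Proof.
rewrite /double_basis (linZ (double_mul_linl X fin_deg _)) (linZ (double_mul_linr X fin_deg _)).
do 2 apply: summandZ.
rewrite (double_mul_pures X fin_deg) (double_mul_words X fin_deg).
apply: summand_sum => r hr; apply: summand_sum => q hq.
apply: summand_sum => i _; apply: summand_sum => j _; apply: summandZ.
have uA Y : in_sub (orb k (inw Y)) by exact/in_sub_orb/filter_all.
have /andP[q1 q2] := wfac_out (filter_all _ _) hq.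
have /andP[r1 r2] := wfac_out (filter_all _ _) hr.
apply: summand_pure; last by apply: in_dual_xi; rewrite all_cat q2.
apply: in_sub_mul; apply: in_sub_par => w wA.
  by rewrite co_lsh uA // all_cat (negPf wA) andbF.
by rewrite co_rsh uA // all_cat (negPf wA).
Qed.

Lemma summand_mul t t' : summand t -> summand t' -> summand (double_mul t t').
Proof.
move=> /summand_span[l ->] /summand_span[l' ->].
rewrite (lin_sum (double_mul_linl X fin_deg _)); apply: summand_sum => p _.
rewrite (lin_sum (double_mul_linr X fin_deg _)); apply: summand_sum => p' _.
rewrite (linZ (double_mul_linl X fin_deg _)) (linZ (double_mul_linr X fin_deg _)).
by do 2 apply: summandZ; exact: summand_mul_basis.
Qed.

End DoubleBasis.

Arguments double_basis {k A} s inA P.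
Arguments double_coeff {k A s} inA w t.

(** * Reversing edges *)

Section Transport.
Variables (k : fieldType) (A A' : salg) (s : salg_anti A) (s' : salg_anti A').
Variables (inA : pred (letter A)) (inA' : pred (letter A')).
Variables (X : factorization s inA) (X' : factorization s' inA').
Hypothesis fin_deg : forall d : deg A, exists l : seq (letter A),
  forall a, ldeg a = d -> a \in l.
Hypothesis fin_deg' : forall d : deg A', exists l : seq (letter A'),
  forall a, ldeg a = d -> a \in l.
Variable phi : letter A -> letter A'.
Hypothesis phi_inj : injective phi.
Hypothesis phi_par : forall m, lpar (phi m) = lpar m.
Hypothesis phi_even : forall m, ~~ lpar m -> inA' (phi m) = inA m.
Hypothesis phi_zfac : forall m,
  perm_eq (zfac X' (phi m)) [seq (phi p.1, phi p.2) | p <- zfac X m].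
Notation D := (double (schur_sbialg k s)).
Notation D' := (double (schur_sbialg k s')).
Implicit Types (t : D).

(** The graph of the isomorphism that sends the basis element of [P] to that of [map phi P]. Words
    represent basis elements only up to order and sign, and comparing coefficient functions avoids
    choosing representatives. *)
Definition related t (t' : D') := forall w, double_coeff inA' (map phi w) t' = double_coeff inA w t.

Let related_span (l : seq (k * seq (letter A))) :
  related (\sum_(p <- l) p.1 *: double_basis s inA p.2)
          (\sum_(p <- l) p.1 *: double_basis s' inA' (map phi p.2)).
Proof.
move=> w; rewrite !(lin_sum (double_coeff_linear _ _)); apply: eq_bigr => p _.
rewrite [LHS](linZ (double_coeff_linear _ _)) [RHS](linZ (double_coeff_linear _ _)).
by rewrite !double_coeff_basis rsgn_map.
Qed.

Let summand_map (l : seq (k * seq (letter A))) :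
  summand inA' (\sum_(p <- l) p.1 *: (double_basis s' inA' (map phi p.2) : D')).
Proof. by apply: summand_sum => p _; apply: summandZ; exact: summand_basis. Qed.

Lemma related_exists t : summand inA t ->
  exists2 t' : D', summand inA' t' & related t t'.
Proof.
move=> /(summand_span fin_deg)[l ->].
exists (\sum_(p <- l) p.1 *: double_basis s' inA' (map phi p.2)); first exact: summand_map.
exact: related_span.
Qed.

Hypothesis phi_surj : forall a, exists b, phi b = a.

Lemma map_surj (u : seq (letter A')) : exists w, map phi w = u.
Proof.
elim: u => [|a u [w <-]]; first by exists [::].
by have [b <-] := phi_surj a; exists (b :: w).
Qed.

Lemma related_surj (t' : D') : summand inA' t' ->
  exists2 t, summand inA t & related t t'.
Proof.
move=> /(summand_span fin_deg')[l' ->].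
have [l ->] : exists l : seq (k * seq (letter A)), l' = [seq (p.1, map phi p.2) | p <- l].
  elim: l' => [|[c u] l' [l ->]]; first by exists [::].
  by have [w <-] := map_surj u; exists ((c, w) :: l).
exists (\sum_(p <- l) p.1 *: double_basis s inA p.2); last by rewrite big_map; exact: related_span.
by apply: summand_sum => p _; apply: summandZ; exact: summand_basis.
Qed.

Lemma related_inj t t1 (t' : D') : summand inA t -> summand inA t1 ->
  related t1 t' -> related t t' -> t1 = t.
Proof.
move=> h h1 r1 r; apply: (summand_inj fin_deg h1 h) => w.
by rewrite -r1 -r.
Qed.

Lemma related_fun t (t1' t2' : D') : summand inA' t1' -> summand inA' t2' ->
  related t t1' -> related t t2' -> t1' = t2'.
Proof.
move=> h1 h2 r1 r2; apply: (summand_inj fin_deg' h1 h2) => u.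
by have [w <-] := map_surj u; rewrite r1 r2.
Qed.

Lemma related_mul t1 t2 (t1' t2' : D') : summand inA t1 -> summand inA t2 ->
  summand inA' t1' -> summand inA' t2' -> related t1 t1' -> related t2 t2' ->
  related (double_mul t1 t2) (double_mul t1' t2').
Proof.
move=> /(summand_span fin_deg)[l ->] /(summand_span fin_deg)[m ->] h1 h2 r1 r2.
(* Being related determines [t1'] and [t2'], so they are the relabelled combinations; bilinearity
   then reduces the claim to [dconst_map]. *)
have -> := related_fun h1 (summand_map l) r1 (related_span l).
have -> := related_fun h2 (summand_map m) r2 (related_span m).
move=> w; rewrite (lin_sum (double_mul_linl X fin_deg _)).
rewrite (lin_sum (double_mul_linl X' fin_deg' _)) !(lin_sum (double_coeff_linear _ _)).
apply: eq_bigr => p _.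
rewrite (lin_sum (double_mul_linr X fin_deg _)).
rewrite (lin_sum (double_mul_linr X' fin_deg' _)) !(lin_sum (double_coeff_linear _ _)).
apply: eq_bigr => q _.
rewrite (linZ (double_mul_linl X fin_deg _)) (linZ (double_mul_linr X fin_deg _)).
rewrite (linZ (double_mul_linl X' fin_deg' _)) (linZ (double_mul_linr X' fin_deg' _)).
rewrite [LHS](linZ (double_coeff_linear _ _)) [RHS](linZ (double_coeff_linear _ _)).
apply: (congr1 (fun z : k^o => p.1 *: z)).
rewrite [LHS](linZ (double_coeff_linear _ _)) [RHS](linZ (double_coeff_linear _ _)).
apply: (congr1 (fun z : k^o => q.1 *: z)).
rewrite (double_coeff_mul_basis k X fin_deg).
by rewrite (double_coeff_mul_basis k X' fin_deg') (dconst_map _ _ _ phi_inj phi_par phi_even phi_zfac).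
Qed.

Lemma related_lin c t1 t2 (t1' t2' : D') : related t1 t1' -> related t2 t2' ->
  related (c *: t1 + t2) (c *: t1' + t2').
Proof. by move=> r1 r2 w; rewrite !double_coeff_linear r1 r2. Qed.

End Transport.

(** * Finiteness for path algebras and the doubled quiver *)

Section PathFactorization.
Variables (V E : choiceType) (Q : quiver V E) (n : nat).
Notation A := (path_salg Q n).
Implicit Types a b c : letter A.

(** A finite list containing every basis letter with an end at [v]; this is where local finiteness
    enters. *)
Definition nearby (v : V) : seq (letter A) :=
  [seq (x, ij) | x <- inl v :: map inr (projT1 (cid (locally_finite Q v))),
                 ij <- enum {: 'I_n * 'I_n}].

Lemma mem_nearby a : a \in nearby (ldeg a).1 /\ a \in nearby (ldeg a).2.
Proof.
have near v x (ij : 'I_n * 'I_n) :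
    x \in inl v :: map inr (projT1 (cid (locally_finite Q v))) -> (x, ij) \in nearby v.
  by move=> xv; apply: (allpairs_f pair xv); rewrite mem_enum.
case: a => [[v|e] ij]; first by split; apply: near; exact: mem_head.
split; apply: near; rewrite inE /=; apply: map_f; case: cid => r /= hr; apply: hr;
  by [left|right].
Qed.

Lemma lmul_deg a b c : lmul a b = Some c ->
  (ldeg a).2 = (ldeg b).1 /\ ldeg c = ((ldeg a).1, (ldeg b).2).
Proof.
case: a b => [x [i j]] [y [j' l]]; rewrite /lmul /= /pq_mul /=; case: eqP => // _.
by case: x y => [v|e] [w|f] //=; case: eqP => //= h [<-]; rewrite /pq_deg /= h.
Qed.

Lemma path_fin_deg (d : deg A) : exists l : seq (letter A),
  forall a, ldeg a = d -> a \in l.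
Proof. by exists (nearby d.1) => a <-; have [] := mem_nearby a. Qed.

End PathFactorization.

Lemma enum_pred (T : choiceType) (P : pred T) (l : seq T) :
  (forall x, P x -> x \in l) -> {r : seq T | uniq r & forall x, (x \in r) = P x}.
Proof.
move=> h; exists (undup (filter P l)); first exact: undup_uniq.
by move=> x; rewrite mem_undup mem_filter; case: (boolP (P x)) => // /h.
Qed.

Section DoubleQuiver.
Variables (n : nat) (V E : choiceType) (Q : quiver V E).
Notation A := (double_salg n Q).
Notation s := (double_anti n Q).
Notation near := (@nearby _ _ (double_quiver Q) n).

(** The first factor shares the source of [m] and the second its target, so both lie among finitely
    many letters. *)
Lemma fac_subproof (m : letter A) : {r : seq (letter A * letter A) | uniq r &
  forall p, (p \in r) = (lmul p.1 p.2 == Some m)}.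
Proof.
apply: (@enum_pred _ (fun p : letter A * letter A => lmul p.1 p.2 == Some m)
  (allpairs pair (near (ldeg m).1) (near (ldeg m).2))).
move=> [a b] /eqP/lmul_deg[_ ->].
have [h1 _] := mem_nearby a; have [_ h2] := mem_nearby b.
exact: (allpairs_f pair h1 h2).
Qed.

Lemma facl_subproof (m : letter A) : {r : seq (letter A * letter A) | uniq r &
  forall p, (p \in r) = (lmul (s p.1) m == Some p.2)}.
Proof.
apply: (@enum_pred _ (fun p : letter A * letter A => lmul (s p.1) m == Some p.2)
  [seq (s z, a) | z <- near (ldeg m).1, a <- near (ldeg m).2]).
move=> [y a] /eqP h; have [h1 h2] := lmul_deg h.
have [_] := mem_nearby (s y); have [_] := mem_nearby a.
rewrite h1 h2 => ha hy; rewrite -[(y, a)]/(y, a) -{1}(lantiK s y).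
exact: (allpairs_f (fun z a => (s z, a)) hy ha).
Qed.

Lemma facr_subproof (m : letter A) : {r : seq (letter A * letter A) | uniq r &
  forall p, (p \in r) = (lmul m (s p.2) == Some p.1)}.
Proof.
apply: (@enum_pred _ (fun p : letter A * letter A => lmul m (s p.2) == Some p.1)
  [seq (a, s z) | a <- near (ldeg m).1, z <- near (ldeg m).2]).
move=> [a y] /eqP h; have [h1 h2] := lmul_deg h.
have [+ _] := mem_nearby (s y); have [+ _] := mem_nearby a.
rewrite -h1 h2 => ha hy; rewrite -{1}(lantiK s y).
exact: (allpairs_f (fun a z => (a, s z)) ha hy).
Qed.

Lemma in_Q_anti (m : letter A) : in_Q (s m) = ~~ in_Q m.
Proof. by case: m => [[[v|v]|[e|e]] ij]. Qed.

Lemma in_Q_mul (a b c : letter A) : lmul a b = Some c ->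
  in_Q a = in_Q c /\ in_Q b = in_Q c.
Proof.
case: a b => [x [i j]] [y [j' l]]; rewrite /lmul /= /pq_mul /=; case: eqP => // _.
by case: x y => [[v|v]|[e|e]] [[w|w]|[f|f]] //=; case: eqP => //= _ [<-].
Qed.

Definition double_factorization : factorization s (@in_Q n V E Q) :=
  @Factorization A s (@in_Q n V E Q)
    (fun m => s2val (fac_subproof m)) (fun m => s2val (facl_subproof m))
    (fun m => s2val (facr_subproof m))
    (fun m => s2valP (fac_subproof m)) (fun m => s2valP (facl_subproof m))
    (fun m => s2valP (facr_subproof m))
    (fun m => s2valP' (fac_subproof m)) (fun m => s2valP' (facl_subproof m))
    (fun m => s2valP' (facr_subproof m)) in_Q_anti in_Q_mul.

End DoubleQuiver.

(** * Reversal of edges as a relabelling of the zigzag algebra *)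

Section Flip.
Variables (n : nat) (V E : choiceType) (Q Q' : quiver V E).
Hypothesis same : same_underlying_graph Q Q'.

(** For quivers with the same underlying graph, a loop does not count as flipped, and any other edge
    is flipped exactly when it is reversed. *)
Definition flipped (e : E) : bool := src Q e != src Q' e.

Lemma flippedP e :
  if flipped e then src Q' e = tgt Q e /\ tgt Q' e = src Q e
  else src Q' e = src Q e /\ tgt Q' e = tgt Q e.
Proof.
have /fsetP h := same e.
have := h (src Q e); have := h (tgt Q e); have := h (src Q' e); have := h (tgt Q' e).
rewrite /flipped !inE !eqxx ?orbT /=.
rewrite ![tgt Q' e == _]eq_sym ![src Q' e == _]eq_sym.
by do 4?[case: eqP => //= ?]; rewrite ?orbF ?orbT => *; split; congruence.
Qed.

Definition flip_path (x : (V + V) + (E + E)) : (V + V) + (E + E) :=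
  match x with
  | inl v => inl v
  | inr (inl e) => inr (if flipped e then inr e else inl e)
  | inr (inr e) => inr (if flipped e then inl e else inr e)
  end.

Lemma flip_pathK : involutive flip_path.
Proof. by case=> [//|[e|e]] /=; case: (boolP (flipped e)) => h /=; rewrite ?h ?(negPf h). Qed.

Definition flip (a : letter (double_salg n Q)) : letter (double_salg n Q') :=
  (flip_path a.1, a.2).

Definition unflip (a : letter (double_salg n Q')) : letter (double_salg n Q) :=
  (flip_path a.1, a.2).

Lemma flipK : cancel flip unflip.
Proof. by move=> [x ij]; rewrite /unflip /flip /= flip_pathK. Qed.

Lemma unflipK : cancel unflip flip.
Proof. by move=> [x ij]; rewrite /unflip /flip /= flip_pathK. Qed.

Lemma flip_inj : injective flip.
Proof. exact: can_inj flipK. Qed.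

Lemma flip_par a : lpar (flip a) = lpar a.
Proof. by case: a => [[v|[e|e]] ij]. Qed.

Lemma flip_even a : ~~ lpar a -> in_Q (flip a) = in_Q a.
Proof. by case: a => [[v|[e|e]] ij]. Qed.

End Flip.

Section ZigzagPaths.
Variables (V E : choiceType).
Implicit Types Q : quiver V E.

Definition op_path (x : (V + V) + (E + E)) : (V + V) + (E + E) :=
  match x with inl v => inl (sum_swap v) | inr e => inr (sum_swap e) end.

Definition path_in_Q (x : (V + V) + (E + E)) : bool :=
  match x with inl (inl _) | inr (inl _) => true | _ => false end.

(* r is the product of p and q in the zigzag algebra. *)
Definition zigzag Q (p q r : (V + V) + (E + E)) : bool :=
  if path_in_Q r then path_mul (double_quiver Q) p q == Some r
  else (path_mul (double_quiver Q) (op_path p) r == Some q) ||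
       (path_mul (double_quiver Q) r (op_path q) == Some p).

(** The product of an edge and its dual letter is the form dual to the source, and in the opposite
    order the form dual to the target. Reversal exchanges the two letters as well as the two ends,
    so these rules are permuted, and so are those for the action of vertices. The proof runs through
    all shapes of [p], [q] and [r]. *)
Lemma zigzag_flip Q Q' p q r : same_underlying_graph Q Q' ->
  zigzag Q' (flip_path Q Q' p) (flip_path Q Q' q) (flip_path Q Q' r) = zigzag Q p q r.
Proof.
move=> same.
have fP e : (flipped Q Q' e /\ src Q' e = tgt Q e /\ tgt Q' e = src Q e) \/
    (flipped Q Q' e = false /\ src Q' e = src Q e /\ tgt Q' e = tgt Q e).
  by have := flippedP same e; case: (flipped Q Q' e) => -[]; [left|right].
have noneE (x : (V + V) + (E + E)) : (None == Some x) = false by [].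
case: p => [[v|v]|[e|e]]; case: q => [[w|w]|[f|f]]; case: r => [[u|u]|[g|g]];
  rewrite /zigzag /=;
  try (case: (fP e) => -[fe [es et]]; rewrite ?fe);
  try (case: (fP f) => -[ff [fs ft]]; rewrite ?ff);
  try (case: (fP g) => -[fg [gs gt]]; rewrite ?fg);
  rewrite /= ?es ?et ?fs ?ft ?gs ?gt;
  repeat match goal with |- context [if ?x == ?y then _ else _] =>
    case: (x =P y) => ? /= end;
  repeat match goal with |- context [Some ?x == Some ?y] =>
    case: (Some x =P Some y) => ? /= end;
  rewrite ?noneE //=; congruence.
Qed.

End ZigzagPaths.

Section ZigzagLetters.
Variables (n : nat) (V E : choiceType).
Implicit Types Q : quiver V E.

Lemma mem_zfac Q (a b m : letter (double_salg n Q)) :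
  ((a, b) \in zfac (double_factorization n Q) m) =
  [&& a.2.1 == m.2.1, a.2.2 == b.2.1, b.2.2 == m.2.2 & zigzag Q a.1 b.1 m.1].
Proof.
case: a b m => [p [i j]] [q [j' l]] [r [i' l']] /=.
have SE (x : option ((V + V) + (E + E))) (y : (V + V) + (E + E)) (c d : 'I_n * 'I_n) :
    (omap (fun z => (z, c)) x == Some (y, d)) = (c == d) && (x == Some y).
  case: x => [x|] /=; last by rewrite andbF.
  by rewrite -[RHS]/((c == d) && (x == y)) andbC.
rewrite /zfac; case: ifP => rQ.
  rewrite [LHS](facP (double_factorization n Q)) /= /pq_mul /= /zigzag.
  have -> : path_in_Q r by case: r rQ => [[]|[]].
  case: (eqVneq j j') => _ /=; last by rewrite andbF.
  by rewrite SE xpair_eqE; case: (i == i'); case: (l == l').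
rewrite mem_cat [X in X || _](faclP (double_factorization n Q)).
rewrite [X in _ || X](facrP (double_factorization n Q)) /= /pq_mul /=.
rewrite /zigzag; have -> : path_in_Q r = false by case: r rQ => [[]|[]].
rewrite !(fun_if (fun z => z == Some _)) !SE !xpair_eqE /=.
have op x : match x with inl v => inl (sum_swap v) | inr e => inr (sum_swap e) end =
  op_path (V := V) (E := E) x by case: x.
rewrite !op [l' == l]eq_sym [j' == j]eq_sym [i' == i]eq_sym.
case: (i == i'); case: (j == j'); case: (l == l');
  by rewrite /= ?andbF ?andbT ?orbF.
Qed.

(** The lists [facl] and [facr] are disjoint: for a letter outside [in_Q], the first factor lies in
    [in_Q] in the one and outside it in the other. *)
Lemma zfac_uniq Q (m : letter (double_salg n Q)) :
  uniq (zfac (double_factorization n Q) m).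
Proof.
rewrite /zfac; case: ifP => mQ; first exact: fac_uniq.
rewrite cat_uniq facl_uniq facr_uniq andbT; apply/hasPn => p pr; apply/negP => pl.
have /andP[+ _] := facr_out (negbT mQ) pr.
by have /andP[-> _] := facl_out (negbT mQ) pl.
Qed.

Lemma zfac_flip Q Q' (m : letter (double_salg n Q)) : same_underlying_graph Q Q' ->
  perm_eq (zfac (double_factorization n Q') (flip Q' m))
    [seq (flip Q' p.1, flip Q' p.2) | p <- zfac (double_factorization n Q) m].
Proof.
move=> same; apply: uniq_perm; first exact: zfac_uniq.
  rewrite map_inj_uniq; first exact: zfac_uniq.
  move=> [a b] [c d] e.
  by have /= <- := flip_inj (congr1 fst e); have /= <- := flip_inj (congr1 snd e).
have E2 (a b : letter (double_salg n Q)) :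
    ((flip Q' a, flip Q' b) \in zfac (double_factorization n Q') (flip Q' m)) =
    ((a, b) \in zfac (double_factorization n Q) m).
  by rewrite !mem_zfac /= zigzag_flip.
move=> [a b]; rewrite -(unflipK Q a) -(unflipK Q b) E2; apply/idP/mapP => [h|].
  by exists (unflip Q a, unflip Q b).
case=> -[c d] h e.
by have /= -> := flip_inj (congr1 fst e); have /= -> := flip_inj (congr1 snd e).
Qed.

End ZigzagLetters.

Theorem theorem157 (k : fieldType) (n : nat) (V E : choiceType)
    (Q Q' : quiver V E) :
  same_underlying_graph Q Q' ->
  exists f : schiver k n Q -> schiver k n Q',
    [/\ linear f,
        bijective f
      & forall x y : schiver k n Q,
          f (schiver_mul x y) = schiver_mul (f x) (f y)].
Proof.
move=> same.
have fin R := @path_fin_deg _ _ (double_quiver (V := V) (E := E) R) n.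
have sumP R (x : schiver k n R) : summand (@in_Q n V E R) (schiver_val x).
  by case: x => x hx; have /asboolP := hx.
have sch R t (h : summand (@in_Q n V E R) t) : {x : schiver k n R | schiver_val x = t}.
  have ht : t \in @schiver_pred k n V E R by apply/asboolP.
  by exists (Schiver ht).
(* [schiver_mul] selects an element by its value in the double; [summand_mul] ensures that there is
   one. *)
have mulP (R : quiver V E) (x y : schiver k n R) :
    schiver_val (schiver_mul x y) = double_mul (schiver_val x) (schiver_val y).
  have [z hz] := sch _ _ (summand_mul (double_factorization n R) (fin R) (sumP _ x) (sumP _ y)).
  apply: (@xgetPex (schiver k n R) 0
    [set z | schiver_val z = double_mul (schiver_val x) (schiver_val y)]%classic).
  by exists z.
have surj (a : letter (double_salg n Q')) :
    exists b : letter (double_salg n Q), flip Q' b = a.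
  by exists (unflip Q a); exact: unflipK.
pose rel (x : schiver k n Q) (y : schiver k n Q') :=
  related (@in_Q n V E Q) (@in_Q n V E Q') (@flip n V E Q Q') (schiver_val x) (schiver_val y).
have finQ := fin Q; have finQ' := fin Q'.
have zf m := zfac_flip (n := n) m same.
have inj := @flip_inj n V E Q Q'.
have par := @flip_par n V E Q Q'.
have even := @flip_even n V E Q Q'.
(* Every element has exactly one related element on the other side, so the relation yields a
   bijection, whose linearity and multiplicativity follow from uniqueness. *)
have fwd (x : schiver k n Q) : {y : schiver k n Q' | rel x y}.
  apply: cid; have [t h r] := related_exists (double_anti n Q') (@in_Q n V E Q')
    finQ inj par (sumP _ x).
  by have [y hy] := sch _ _ h; exists y; rewrite /rel hy.
have bwd (y : schiver k n Q') : {x : schiver k n Q | rel x y}.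
  apply: cid; have [t h r] := related_surj (double_anti n Q) (@in_Q n V E Q)
    finQ' inj par surj (sumP _ y).
  by have [x hx] := sch _ _ h; exists x; rewrite /rel hx.
have relF x y y' : rel x y -> rel x y' -> y = y'.
  by move=> r r'; apply: val_inj; exact (@related_fun _ _ _ _ _ _ _ finQ' _ surj _ _ _
    (sumP _ y) (sumP _ y') r r').
have relI x x' y : rel x y -> rel x' y -> x = x'.
  by move=> r r'; apply: val_inj; exact (@related_inj _ _ _ _ _ _ _ finQ _ _ _ _
    (sumP _ x') (sumP _ x) r r').
exists (fun x => sval (fwd x)); split.
- move=> c x y; apply: relF (svalP (fwd _)) _.
  exact: related_lin (svalP (fwd x)) (svalP (fwd y)).
- exists (fun y => sval (bwd y)) => [x|y].
    exact: relI (svalP (bwd _)) (svalP (fwd x)).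
  exact: relF (svalP (fwd _)) (svalP (bwd y)).
move=> x y; apply: relF (svalP (fwd _)) _; rewrite /rel !mulP.
exact: (related_mul finQ finQ' inj par even zf surj (sumP _ x) (sumP _ y)
  (sumP _ _) (sumP _ _) (svalP (fwd x)) (svalP (fwd y))).
Qed.
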